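(* Let $f:[0,\infty)\to\mathbb{R}$ be a Lipschitz function which, for some $p_M>0$, satisfies one of the following: (bistable) there is $\alpha\in(0,p_M)$ with $f>0$ in $(\alpha,p_M)$ and $f<0$ in $[0,\alpha)\cup(p_M,\infty)$; or (monostable) $f(0)=0$, $f>0$ in $(0,p_M)$ and $f<0$ in $(p_M,\infty)$. Let $K:=\sup_{p>0}\frac{f(p)}{p}<\infty$ and $L^*:=\frac{\pi}{\sqrt K}$. For each $m$ let $\rho_{in,m}\ge0$, $\rho_{in,m}\in L^1(\mathbb{R})$, be such that $p_{in,m}:=\frac{m}{m-1}\rho_{in,m}^{m-1}$ satisfies $$p_{in,m}\le p_M\chi_{(0,L)}\quad\text{for some }L<L^*\text{ independent of }m,$$ and let $(\rho_m,p_m)$ be the solution of $$\partial_t\rho_m-\partial_x(\rho_m\partial_x p_m)=\rho_m f(p_m),\quad p_m=\tfrac{m}{m-1}\rho_m^{m-1}\ \text{ in }\mathbb{R}\times(0,\infty),\qquad\rho_m(\cdot,0)=\rho_{in,m}.$$ Then any accumulation point $(\rho_\infty,p_\infty)$ of $(\rho_m,p_m)$ as $m\to\infty$ (for the weak-$*$ topology of $L^\infty(\mathbb{R}\times(0,\infty))$) satisfies $$p_\infty(x,t)=0\quad\text{and}\quad\rho_\infty(x,t)=\rho_{in}(x)e^{f(0)t}\qquad\text{a.e. in }\mathbb{R}\times(0,\infty),$$ where $\rho_{in}$ is the weak-$*$ limit in $L^\infty(\mathbb{R})$ of $\rho_{in,m}$ (along the corresponding subsequence).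
   Context: For $m>1$ and non-negative $\rho_{in,m}\in L^1\cap L^\infty(\mathbb{R})$, the solution of the equation means the unique non-negative weak (distributional) solution of the porous medium equation with reaction $\partial_t\rho=\partial_{xx}\rho^m+\rho f(\tfrac{m}{m-1}\rho^{m-1})$ (note $\rho\,\partial_x p=\partial_x\rho^m$), obtained as the limit of smooth positive solutions with regularized initial data bounded below by $1/k$, $k\to\infty$. *)

(* Defs.v *)
From HB Require Import structures.
From mathcomp Require Import all_boot all_order all_algebra.
From mathcomp Require Import all_classical all_reals all_analysis.

Set Implicit Arguments.
Unset Strict Implicit.
Unset Printing Implicit Defensive.

Import Order.TTheory GRing.Theory Num.Theory.
Import numFieldNormedType.Exports.

Local Open Scope classical_set_scope.
Local Open Scope ring_scope.

Section Reaction.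
Context {R : realType}.
Implicit Types (f : R -> R) (pM : R).

(* A function [0, +oo[ -> R is represented by a function R -> R whose values
   at negative arguments are never used. *)

Definition bistable f pM : Prop :=
  exists alpha : R, [/\ 0 < alpha < pM,
    forall p, alpha < p < pM -> 0 < f p &
    forall p, 0 <= p < alpha \/ pM < p -> f p < 0].

Definition monostable f pM : Prop :=
  [/\ f 0 = 0,
    forall p, 0 < p < pM -> 0 < f p &
    forall p, pM < p -> f p < 0].

Definition growth_ratios f : set R := [set f p / p | p in [set p : R | 0 < p]].

Definition maxK f : R := sup (growth_ratios f).

Definition Lstar f : R := pi / Num.sqrt (maxK f).

(* [sup] is not a default value: the ratios are bounded above because f is
   Lipschitz and f 0 <= 0 in both cases. *)
Lemma growth_ratios_has_sup f pM :
  [lipschitz f p | p in `[0, +oo[] -> 0 < pM ->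
  bistable f pM \/ monostable f pM -> has_sup (growth_ratios f).
Proof.
move=> [M [_ /(_ (M + 1))]]; rewrite ltrDl ltr01 => /(_ isT) fM pM0 fH.
have f0 : f 0 <= 0.
  case: fH => [[a [/andP[a0 _] _ fneg]]|[-> _ _]//].
  by apply/ltW/fneg; left; rewrite lexx.
split; first by exists (f 1 / 1); exists 1 => //=; exact: ltr01.
exists (M + 1) => _ [p /= p0 <-].
rewrite ler_pdivrMr//.
have /= := fM (p, 0).
rewrite !in_itv/= !andbT (ltW p0) lexx => /(_ (conj isT isT)).
rewrite subr0 (gtr0_norm p0); apply: le_trans.
by apply: le_trans (ler_norm _); rewrite lerBrDl gerDr.
Qed.

End Reaction.

Section WeakStar.
Context d (T : measurableType d) (R : realType).
Context (mu : {measure set T -> \bar R}) (D : set T).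

Definition Linfty (u : T -> R) : Prop :=
  measurable_fun D u /\
  exists M : R, {ae mu, forall z, D z -> `|u z| <= M}.

Definition L1 (u : T -> R) : Prop := mu.-integrable D (EFin \o u).

Definition weak_star_cvg (u : nat -> T -> R) (v : T -> R) : Prop :=
  [/\ forall n, Linfty (u n), Linfty v &
    forall g : T -> R, L1 g ->
      Rintegral mu D (fun z => u n z * g z) @[n --> \oo]
        --> Rintegral mu D (fun z => v z * g z)].

End WeakStar.

Section SpaceTime.
Context {R : realType}.

Definition leb : {measure set (measurableTypeR R) -> \bar R} := lebesgue_measure.

Definition leb2 :
    {measure set (measurableTypeR R * measurableTypeR R) -> \bar R} :=
  (lebesgue_measure \x lebesgue_measure)%E.

(* A point of space-time is a pair (x, t). *)
Definition halfplane : set (R * R) := [set z | 0 < z.2].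

Definition strip (T : R) : set (R * R) := [set z | 0 < z.2 < T].

Definition dx (u : R * R -> R) (z : R * R) : R :=
  derive1 (fun y => u (y, z.2)) z.1.

Definition dt (u : R * R -> R) (z : R * R) : R :=
  derive1 (fun s => u (z.1, s)) z.2.

Definition derivable_x (u : R * R -> R) (z : R * R) : Prop :=
  derivable (fun y => u (y, z.2)) z.1 1.

Definition derivable_t (u : R * R -> R) (z : R * R) : Prop :=
  derivable (fun s => u (z.1, s)) z.2 1.

Definition smooth1 (g : R -> R) : Prop :=
  forall n x, derivable (derive1n n g) x 1.

(* All iterated partial derivatives, in any order, exist and are continuous. *)
Definition smooth2 (phi : R * R -> R) : Prop :=
  forall w : seq bool,
    let g := foldr (fun b => if b then dt else dx) phi w in
    continuous g /\ forall z, derivable_x g z /\ derivable_t g z.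

(* Test functions for R x [0, +oo[: they need not vanish at t = 0. *)
Definition test_function (phi : R * R -> R) : Prop :=
  smooth2 phi /\ compact (closure [set z | phi z != 0]).

End SpaceTime.

Section PorousMedium.
Context {R : realType}.
Implicit Types (f : R -> R) (m : R) (rho_in : R -> R) (rho : R * R -> R).

Definition pressure m (r : R) : R := m / (m - 1) * r `^ (m - 1).

Definition weak_solution f m rho_in rho : Prop :=
  [/\ forall T : R, 0 < T ->
        L1 leb2 (strip T) rho /\ Linfty leb2 (strip T) rho,
    {ae leb2, forall z, halfplane z -> 0 <= rho z} &
    forall phi, test_function phi ->
      Rintegral leb2 halfplane (fun z =>
        rho z * dt phi z + rho z `^ m * dx (dx phi) z
        + rho z * f (pressure m (rho z)) * phi z)
      + Rintegral leb setT (fun x => rho_in x * phi (x, 0)) = 0].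

(* As f is only Lipschitz, smoothness of a positive solution means that it is
   of class C^{2,1} for t > 0 and continuous up to t = 0; boundedness on bounded
   time intervals selects the usual one. *)
Definition positive_classical_solution f m (r : R -> R) (u : R * R -> R) : Prop :=
  [/\ forall z : R * R, 0 <= z.2 -> 0 < u z,
    forall T : R, exists M : R, forall z : R * R, 0 <= z.2 <= T -> u z <= M,
    {within [set z : R * R | 0 <= z.2], continuous u} /\ (forall x, u (x, 0) = r x),
    forall z, halfplane z ->
      [/\ derivable_t u z, derivable_x u z & derivable_x (dx u) z] /\
      [/\ {for z, continuous (dt u)}, {for z, continuous (dx u)} &
          {for z, continuous (dx (dx u))}] &
    forall z, halfplane z ->
      dt u z = dx (dx (fun z' => u z' `^ m)) z + u z * f (pressure m (u z))].

Definition mollifier (e : R) (eta : R -> R) : Prop :=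
  [/\ smooth1 eta, forall x, 0 <= eta x,
    forall x, e < `|x| -> eta x = 0 &
    Rintegral leb setT eta = 1].

Definition mollify (eta g : R -> R) (x : R) : R :=
  Rintegral leb setT (fun y => eta (x - y) * g y).

(* Smooth data bounded below by 1/(k+1) which differ from mollifications of
   rho_in by a uniformly small error; both [mollify eta rho_in + 1/(k+1)] and
   [mollify eta (max(rho_in, 1/(k+1)))] are of this form. *)
Definition regularized_data rho_in (r : nat -> R -> R) : Prop :=
  exists (eta : nat -> R -> R) (e : nat -> R),
    [/\ e n @[n --> \oo] --> 0,
      forall k, 0 < e k /\ mollifier (e k) (eta k) &
      forall k, smooth1 (r k) /\
        forall x, k.+1%:R^-1 <= r k x /\
                  `|r k x - mollify (eta k) rho_in x| <= e k].

Definition limit_of_positive_solutions f m rho_in rho : Prop :=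
  exists (r : nat -> R -> R) (u : nat -> R * R -> R),
    [/\ regularized_data rho_in r,
      forall k, positive_classical_solution f m (r k) (u k) &
      {ae leb2, forall z, halfplane z -> u k z @[k --> \oo] --> rho z}].

Definition is_solution f m rho_in rho : Prop :=
  weak_solution f m rho_in rho /\ limit_of_positive_solutions f m rho_in rho.

(* Joint limit along m_n -> +oo of (rho_m, p_m) in the weak-* topology. *)
Definition accumulation_along (rho : R -> R * R -> R) (ms : nat -> R)
    (rho_oo p_oo : R * R -> R) : Prop :=
  [/\ forall n, 1 < ms n, ms n @[n --> \oo] --> +oo,
    weak_star_cvg leb2 halfplane (fun n => rho (ms n)) rho_oo &
    weak_star_cvg leb2 halfplane
      (fun n z => pressure (ms n) (rho (ms n) z)) p_oo].

End PorousMedium.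

(* Main.v *)
(* Write [m = a + 2] and [Phi u = u^a - D u^(-a)] with [D = m^(-2a)]. For a smooth
   positive solution [u], [w = Phi u] satisfies
     w_t <= m u^(a+1) w_xx + (4u + 4) w_x^2 + K m u (u^(2a) + D),
   and [w] is very negative where [u] is small, so that no lateral boundary has
   to be treated. As [L < pi / sqrt K], the initial pressure lies below
   [A0 (cos (sqrt K (x - L/2)) - c0)] for large [A0] and small [c0], and since
   the cosine solves [V_xx + K V = 0] up to the shift [c0], the profile
   [A0 / (1 + n t) (cos (sqrt K (x - L/2)) - c(t))] with [n] proportional to [m] is a
   supersolution. Comparison gives [p_m <= C (1/(1 + ka m t) + 1/m)] on bounded
   time intervals, hence [p_oo = 0].

   Tested against [a(x) e^(-f(0)t) c(t)], the weak formulation then loses the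
   diffusion term and [f(p)] may be replaced by [f(0)]; in the limit
     c(0) lim int rho_in,m a = - int rho_oo a e^(-f(0)t) c'(t).
   Choosing [a] and [c'] close to indicators of intervals shows that
   [rho_oo e^(-f(0)t)] does not depend on [t] and is the limit of the data. *)

Require Import Defs.
From HB Require Import structures.
From mathcomp Require Import all_boot all_order all_algebra.
From mathcomp Require Import all_classical all_reals all_analysis.
From mathcomp Require Import measurable_realfun ring lra.

Set Implicit Arguments.
Unset Strict Implicit.
Unset Printing Implicit Defensive.

Import Order.TTheory GRing.Theory Num.Theory.
Import numFieldNormedType.Exports.

Local Open Scope classical_set_scope.
Local Open Scope ring_scope.

(** The pressure obeys [p_t = (m-1) p (p_xx + f(p)) + p_x^2], so it relaxes on the time scale [1/m];
    on an interval shorter than [pi / sqrt K], with zero boundary values and [f(p) <= K p], the only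
    non-negative steady state is zero. The decay is merely like [1/(1 + n t)] because diffusion and
    reaction both carry the factor [p]. That degeneracy is the obstacle: where [u] is small, the
    damping of order [m u^(a+1) c] gained from the shift of the cosine disappears, while the squared
    gradient of the profile stays. The latter is of order [(1 + n t)^(-2)], which is what a
    logarithmic decrease of [c] produces; the total decrease is of order [(ln m)/m], hence
    [c >= c0/2] for large [m]. The bound [M] of an approximating solution depends on the
    regularization. It is therefore allowed only in the growth rate of an auxiliary tail whose
    amplitude is sent to zero; the constants of the barrier do not see it. Convergence of the data
    is a conclusion. Their limit is built from [rho_oo] as a weighted average in time, with a test
    profile such that [c(0) = 1]. *)

Section AlmostEverywhere.
Context d (T : measurableType d) (R : realType) (mu : {measure set T -> \bar R}).
Implicit Types P Q : T -> Prop.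

Lemma aeW P Q : {ae mu, forall z, P z} -> (forall z, P z -> Q z) ->
  {ae mu, forall z, Q z}.
Proof.
by move=> aP PQ; move: aP; exact: filterS.
Qed.

Lemma aeI P Q : {ae mu, forall z, P z} -> {ae mu, forall z, Q z} ->
  {ae mu, forall z, P z /\ Q z}.
Proof.
move=> aP aQ; exact: filterI.
Qed.

Lemma ae_forall (P : nat -> T -> Prop) :
  (forall n, {ae mu, forall z, P n z}) -> {ae mu, forall z, forall n, P n z}.
Proof.
move=> aP.
have H : mu.-negligible (\bigcup_n ~` P n).
  by apply: negligible_bigcup => n; exact: aP.
by apply: negligibleS H => z /= /existsNP[n Pn]; exists n.
Qed.

End AlmostEverywhere.

(** * Calculus and first touching points *)

Section Calculus.
Context {R : realType}.
Implicit Types (g h : R -> R) (x t : R).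

Lemma derivable1_cvg_quotient h x : derivable h x 1 ->
  (fun y : R => y^-1 * (h (y + x) - h x)) y @[y --> 0^'] --> derive1 h x.
Proof.
move=> dh; rewrite derive1E; rewrite /derivable in dh.
have -> : (fun y : R => y^-1 * (h (y + x) - h x)) =
   (fun y : R => y^-1 *: ((h \o shift x) (y *: 1) - h x)).
  by apply/funext => y /=; rewrite /GRing.scale/= mulr1.
exact: dh.
Qed.

(** At a first touching point only earlier times can be compared. A negative derivative would make
    [h] exceed [h t0] slightly before [t0]. *)
Lemma derive1_left_max_ge0 h t0 : 0 < t0 -> derivable h t0 1 ->
  (forall t, 0 < t < t0 -> h t <= h t0) -> 0 <= derive1 h t0.
Proof.
move=> t0_gt0 dh hle.
rewrite leNgt; apply/negP => d0.
have /cvgr_lt/(_ 0 d0) := derivable1_cvg_quotient dh.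
move=> [e /= e0 He].
pose s := Num.min (e / 2) (t0 / 2).
have s0 : 0 < s by rewrite lt_min !divr_gt0.
have := He (- s).
rewrite /ball_/= sub0r opprK (gtr0_norm s0) oppr_eq0 gt_eqF// => Hs.
have se : s < e by rewrite /s gt_min ltr_pdivrMr// ltr_pMr// ltr1n.
have st : s < t0 by rewrite /s gt_min (ltr_pdivrMr t0 t0)// ltr_pMr// ltr1n orbT.
have {Hs} := Hs se isT.
rewrite [- s + _]addrC invrN mulNr oppr_lt0 pmulr_rgt0 ?invr_gt0// subr_gt0 ltNge.
by rewrite hle// subr_gt0 st/= gtrBl.
Qed.

Lemma derive1_max_eq0 h x0 : (forall x, derivable h x 1) ->
  (forall x, h x <= h x0) -> derive1 h x0 = 0.
Proof.
move=> dh hle.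
have [||_ <-] := @derive1_at_max _ h (x0 - 1) (x0 + 1) x0 _ (fun t _ => dh t) _ (fun t _ => hle t).
- lra.
- by rewrite in_itv/=; lra.
- exact: derive1E.
Qed.

(** As the first derivative vanishes at [x0], a positive second derivative would make it positive
    just to the right, and [h] would increase strictly past its maximum. *)
Lemma derive2_max_le0 h x0 : (forall x, derivable h x 1) ->
  derivable (derive1 h) x0 1 -> (forall x, h x <= h x0) ->
  derive1 (derive1 h) x0 <= 0.
Proof.
move=> dh ddh hle; have d0 := derive1_max_eq0 dh hle.
rewrite leNgt; apply/negP => c0.
have /cvgr_gt/(_ 0 c0) := derivable1_cvg_quotient ddh.
move=> [e /= e0 He].
have e20 : 0 < e / 2 by rewrite divr_gt0.
have pos y : y \in `]x0, x0 + e / 2[ -> 0 < derive1 h y.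
  rewrite in_itv/= => /andP[xy ye].
  have yx : 0 < y - x0 by rewrite subr_gt0.
  have := He (y - x0).
  rewrite /ball_/= sub0r normrN (gtr0_norm yx) (gt_eqF yx) subrK d0 subr0.
  have -> : y - x0 < e by lra.
  by move=> /(_ isT isT); rewrite pmulr_rgt0// invr_gt0.
have := @gtr0_derive1_incr _ h x0 (x0 + e / 2) (fun y _ => dh y) pos _ x0 (x0 + e / 2).
have -> : (x0 < x0 + e / 2) = true by rewrite ltrDl.
rewrite !lexx => /(_ _ isT isT isT); rewrite ltNge hle => H.
suff : false by [].
apply: H; apply: continuous_subspaceT => y.
exact/differentiable_continuous/derivable1_diffP/dh.
Qed.

Lemma is_deriveD1 h g x dh dg : is_derive x 1 h dh -> is_derive x 1 g dg ->
  is_derive x 1 (fun y => h y + g y) (dh + dg).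
Proof. exact: is_deriveD. Qed.

Lemma is_deriveB1 h g x dh dg : is_derive x 1 h dh -> is_derive x 1 g dg ->
  is_derive x 1 (fun y => h y - g y) (dh - dg).
Proof. exact: is_deriveB. Qed.

Lemma is_deriveM1 h g x dh dg : is_derive x 1 h dh -> is_derive x 1 g dg ->
  is_derive x 1 (fun y => h y * g y) (dh * g x + h x * dg).
Proof.
move=> Hh Hg; apply: (is_derive_eq (is_deriveM Hh Hg)).
by rewrite /GRing.scale/=; ring.
Qed.

Lemma is_deriveZ1 g c x dg : is_derive x 1 g dg ->
  is_derive x 1 (fun y => c * g y) (c * dg).
Proof. exact: is_deriveZ. Qed.

Lemma is_derive_comp1 h g x dh dg : is_derive x 1 g dg ->
  is_derive (g x) 1 h dh -> is_derive x 1 (fun y => h (g y)) (dh * dg).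
Proof. by move=> Hg Hh; apply: is_derive1_comp. Qed.

Lemma is_derive_const (c x : R) : is_derive x 1 (fun=> c) 0.
Proof. exact: is_derive_cst. Qed.

Lemma is_derive_var x : is_derive x 1 (fun y : R => y) 1.
Proof. exact: is_derive_id. Qed.

Lemma is_derive_derive1 h x dh : is_derive x 1 h dh -> derive1 h x = dh.
Proof. by move=> [_ <-]; exact: derive1E. Qed.

Lemma derivable_is_derive h x : derivable h x 1 -> is_derive x 1 h (derive1 h x).
Proof. by move=> dh; rewrite derive1E; exact: derivableP. Qed.

(** As [g] is negative for [|x| >= X], the points with [0 <= t <= T] and [g >= 0] form a compact
    set, and one of them has the smallest time. At that time [g] is positive nowhere, since by
    continuity it would be positive a little earlier. *)
Lemma first_touch (g : R * R -> R) (X T : R) :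
  {within [set z : R * R | 0 <= z.2], continuous g} ->
  (forall x, g (x, 0) < 0) ->
  (forall x t, 0 <= t <= T -> X <= `|x| -> g (x, t) < 0) ->
  (exists z : R * R, 0 <= z.2 <= T /\ 0 <= g z) ->
  exists x0 t0, [/\ 0 < t0 <= T, g (x0, t0) = 0,
    forall x, g (x, t0) <= 0 & forall t, 0 <= t < t0 -> g (x0, t) < 0].
Proof.
move=> cg g0 gX [[x1 t1] /= [t1T g1]].
(* Clamping the time at [0] gives a function continuous on the whole plane, so that its superlevel
   set is closed there. *)
pose gb (z : R * R) := g (z.1, Num.max 0 z.2).
have cgb : continuous gb.
  move=> z; rewrite /gb.
  have cz : (fun w : R * R => (w.1, Num.max 0 w.2)) w @[w --> z] --> (z.1, Num.max 0 z.2).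
    have c1 : fst w @[w --> z] --> z.1 by exact: cvg_fst.
    have c0 : {for z, continuous (fun=> 0 : R^o)} by exact: cvg_cst.
    have c2 : {for z, continuous (snd : R * R -> R^o)} by exact: cvg_snd.
    exact: (cvg_pair c1 (continuous_max c0 c2)).
  have hz (w : R * R) : [set z : R * R | 0 <= z.2] (w.1, Num.max 0 w.2).
    by rewrite /= le_max lexx.
  move/subspace_continuousP : cg => /(_ _ (hz z)) cg' B /cg' /= gB.
  have W : nbhs z [set w : R * R | 0 <= Num.max 0 w.2 -> B (g (w.1, Num.max 0 w.2))].
    exact: cz _ gB.
  rewrite /= nbhs_simpl/=; move: W; apply: filterS => w /= H.
  exact: H (hz w).
have gbE z : 0 <= z.2 -> gb z = g z.
  by move=> z0; rewrite /gb max_r//; case: z z0.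
pose A := [set z : R * R | 0 <= z.2 <= T /\ 0 <= gb z].
have cA : compact A.
  have -> : A = (gb @^-1` [set y | 0 <= y]) `&` (`[- X, X] `*` `[0, T]).
    apply/seteqP; split => -[x t] /=; rewrite !in_itv/=.
      move=> [tT gxt]; split=> //; split => //.
      rewrite -ler_norml leNgt; apply/negP => Xx.
      move: gxt; rewrite gbE/=; last by case/andP: tT.
      by rewrite leNgt gX// ltW.
    by move=> [gxt [_ tT]].
  rewrite setIC; apply: compact_closedI.
    by apply: compact_setX; exact: segment_compact.
  by move/continuous_closedP : cgb; apply; exact: (@closed_ge _ 0).
have A0 : A !=set0.
  exists (x1, t1); split => //=; rewrite gbE//=; by case/andP: t1T.
have [[x0 t0]] := @compact_EVT_min _ R snd A A0 cA
   (continuous_subspaceT (fun z => cvg_snd)).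
rewrite inE => -[/= /andP[t00 t0T] gxt] Hmin.
rewrite gbE//= in gxt.
have t0p : 0 < t0.
  rewrite lt_neqAle t00 andbT; apply/eqP => t0E.
  by move: gxt; rewrite -t0E leNgt g0.
have neg x t : 0 <= t < t0 -> g (x, t) < 0.
  move=> /andP[t_ge0 tt0]; rewrite ltNge; apply/negP => gxt'.
  have := Hmin (x, t); rewrite inE /A/= gbE//= t_ge0/= gxt'.
  have -> : t <= T by rewrite (le_trans (ltW tt0)).
  by move=> /(_ (conj isT isT)); rewrite leNgt tt0.
have le0 x : g (x, t0) <= 0.
  rewrite leNgt; apply/negP => gp.
  have : gb (x, t0) > 0 by rewrite gbE.
  move=> gbp.
  have ct : (fun t => gb (x, t)) t @[t --> t0] --> gb (x, t0).
    apply: (@continuous_comp _ _ _ (fun t : R => (x, t)) gb); last exact: cgb.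
    have c1 : (fun=> x) s @[s --> t0] --> x by exact: cvg_cst.
    exact: (cvg_pair c1 cvg_id).
  have /= [e /= e0 He] := cvgr_gt _ ct _ gbp.
  pose s := Num.min (e / 2) (t0 / 2).
  have s0 : 0 < s by rewrite lt_min !divr_gt0.
  have se : s < e by rewrite /s gt_min ltr_pdivrMr// ltr_pMr// ltr1n.
  have st : s < t0 by rewrite /s gt_min (ltr_pdivrMr t0 t0)// ltr_pMr// ltr1n orbT.
  have := He (t0 - s); rewrite /ball_/= opprD opprK addNKr gtr0_norm// => /(_ se).
  rewrite gbE/= ?subr_ge0 ?ltW// ltNge ltW// neg// gtrBl s0 andbT subr_ge0.
  exact: ltW.
exists x0, t0; split => //.
- by rewrite t0p.
- by apply/eqP; rewrite eq_le le0.
- by move=> t; exact: neg.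
Unshelve. all: by end_near. Qed.

End Calculus.

(** * Comparison with the barrier *)

Section Transform.
Context {R : realType}.
Implicit Types a D m s u v : R.

Definition Phi a D s := s `^ a - D * s `^ (- a).
Definition dPhi a D s := a / s * (s `^ a + D * s `^ (- a)).
Definition ddPhi a D s :=
  a / s ^+ 2 * ((a - 1) * s `^ a - (a + 1) * (D * s `^ (- a))).

Lemma is_derive_powR a s : 0 < s ->
  is_derive s 1 (fun y => y `^ a) (a / s * s `^ a).
Proof.
move=> s0; apply: (is_derive_eq (is_derive1_powR a s0)).
rewrite powRB; last by rewrite (gt_eqF s0) implybT.
by rewrite powRr1 ?ltW//; ring.
Qed.

Lemma is_derive_inv s : 0 < s -> is_derive s 1 (fun y : R => y^-1) (- s ^- 2).
Proof.
move=> s0; apply: (is_derive_eq (is_deriveV _ (is_derive_id s 1))).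
  by rewrite gt_eqF.
by rewrite /GRing.scale/= mulr1.
Qed.

Lemma is_derive_Phi a D s : 0 < s -> is_derive s 1 (Phi a D) (dPhi a D s).
Proof.
move=> s0; have := is_deriveB1 (is_derive_powR a s0)
  (is_deriveZ1 D (is_derive_powR (- a) s0)).
by move=> /is_derive_eq; apply; rewrite /dPhi; ring.
Qed.

Lemma is_derive_dPhi a D s : 0 < s -> is_derive s 1 (dPhi a D) (ddPhi a D s).
Proof.
move=> s0; have := is_deriveM1 (is_deriveZ1 a (is_derive_inv s0))
  (is_deriveD1 (is_derive_powR a s0) (is_deriveZ1 D (is_derive_powR (- a) s0))).
move=> /is_derive_eq; apply; rewrite /ddPhi; field.
by rewrite gt_eqF.
Qed.

(** The first-order chain rule must hold on the whole line before it can be differentiated again at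
    [x0]; hence positivity of [h] everywhere, but second differentiability at [x0] alone. *)
Lemma derive_comp_pos (F F1 F2 h : R -> R) (x0 : R) :
  (forall s : R, 0 < s -> is_derive s 1 F (F1 s)) ->
  (forall s : R, 0 < s -> is_derive s 1 F1 (F2 s)) ->
  (forall x : R, 0 < h x) -> (forall x : R, derivable h x 1) ->
  derivable (derive1 h) x0 1 ->
  (forall x : R, is_derive x 1 (fun y => F (h y)) (F1 (h x) * derive1 h x)) /\
  is_derive x0 1 (derive1 (fun y => F (h y)))
    (F2 (h x0) * derive1 h x0 ^+ 2 + F1 (h x0) * derive1 (derive1 h) x0).
Proof.
move=> dF dF1 h0 dh ddh.
have dFh (x : R) : is_derive x 1 (fun y => F (h y)) (F1 (h x) * derive1 h x).
  exact: is_derive_comp1 (derivable_is_derive (dh x)) (dF _ (h0 x)).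
split; first exact: dFh.
have -> : derive1 (fun y => F (h y)) = (fun x => F1 (h x) * derive1 h x).
  by apply/funext => x; exact: is_derive_derive1.
have := is_deriveM1 (is_derive_comp1 (derivable_is_derive (dh x0)) (dF1 _ (h0 x0)))
   (derivable_is_derive ddh).
by move=> /is_derive_eq; apply; ring.
Qed.

(** Pure algebra: [v] stands for [u^a], [P1] and [P2] for the first two derivatives of [Phi]. The
    substitution leaves the gradient term [2 a (a + 2) / u * (v^2 + (a + 1) D) * ux^2], and the
    point is to bound it by a multiple of [(P1 * ux)^2] that does not grow with [a]. The dangerous
    part carries [(a + 1) D]; the hypothesis on [(a + 1) * u * D * v ^+ 2] tames it. *)
Lemma transform_pde_le a D K u v ut ux uxx f P1 P2 : 2 <= a -> 0 <= D -> 0 <= K ->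
  0 < u -> 0 < v -> (a + 1) * u * D * v ^+ 2 <= (v ^+ 2 + D) ^+ 2 ->
  f <= K * ((a + 2) / (a + 1) * (u * v)) ->
  ut = (a + 2) * (a + 1) * v * ux ^+ 2 + (a + 2) * (u * v) * uxx + u * f ->
  P1 = a / u * (v + D / v) ->
  P2 = a / u ^+ 2 * ((a - 1) * v - (a + 1) * (D / v)) ->
  P1 * ut <= (a + 2) * u * v * (P2 * ux ^+ 2 + P1 * uxx)
    + (4 * u + 4) * (P1 * ux) ^+ 2 + K * (a + 2) * u * (v ^+ 2 + D).
Proof.
move=> a2 D0 K0 u0 v0 HG Hf -> P1E P2E.
have v2D : 0 < v ^+ 2 + D by rewrite ltr_wpDr// exprn_gt0.
have P10 : 0 <= P1.
  by rewrite P1E mulr_ge0 ?divr_ge0 ?addr_ge0 ?divr_ge0//; lra.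
have reac : P1 * (u * f) <= K * (a + 2) * u * (v ^+ 2 + D).
  apply: (@le_trans _ _ (P1 * (u * (K * ((a + 2) / (a + 1) * (u * v)))))).
    by rewrite ler_wpM2l// ler_wpM2l// ltW.
  have -> : P1 * (u * (K * ((a + 2) / (a + 1) * (u * v)))) =
      (a / (a + 1)) * (K * (a + 2) * u * (v ^+ 2 + D)).
    by rewrite P1E; field; rewrite !gt_eqF//; lra.
  rewrite ler_piMl//; last by rewrite ler_pdivrMr ?mul1r; lra.
  by rewrite !mulr_ge0//; lra.
(* After multiplication by [u^2 v^2 / a] the claim splits into [u v^4 <= u (v^2 + D)^2] and the
   hypothesis on [D]. The constant [4] comes from [a + 2 <= 2 a]. *)
have grad : (a + 2) * a / u * 2 * (v ^+ 2 + (a + 1) * D) <= (4 * u + 4) * P1 ^+ 2.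
  have -> : (4 * u + 4) * P1 ^+ 2 =
     (a / (u ^+ 2 * v ^+ 2)) * ((4 * u + 4) * a * (v ^+ 2 + D) ^+ 2).
    by rewrite P1E; field; rewrite !gt_eqF.
  have -> : (a + 2) * a / u * 2 * (v ^+ 2 + (a + 1) * D) =
     (a / (u ^+ 2 * v ^+ 2)) * (2 * (a + 2) * (u * v ^+ 2 * (v ^+ 2 + (a + 1) * D))).
    by field; rewrite !gt_eqF.
  apply: ler_wpM2l; first by rewrite divr_ge0 ?mulr_ge0 ?exprn_ge0//; lra.
  have E : u * v ^+ 2 * (v ^+ 2 + (a + 1) * D) <= (u + 1) * (v ^+ 2 + D) ^+ 2.
    have -> : u * v ^+ 2 * (v ^+ 2 + (a + 1) * D) =
       u * (v ^+ 2) ^+ 2 + (a + 1) * u * D * v ^+ 2 by ring.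
    have -> : (u + 1) * (v ^+ 2 + D) ^+ 2 = u * (v ^+ 2 + D) ^+ 2 + (v ^+ 2 + D) ^+ 2 by ring.
    apply: lerD => //; apply: ler_wpM2l; first exact: ltW.
    by rewrite lerXn2r// ?nnegrE ?lerDl ?(ltW v2D)// exprn_ge0// ltW.
  have E0 : 0 <= u * v ^+ 2 * (v ^+ 2 + (a + 1) * D).
    by rewrite !mulr_ge0 ?addr_ge0 ?mulr_ge0 ?exprn_ge0//; lra.
  apply: (@le_trans _ _ (4 * a * (u * v ^+ 2 * (v ^+ 2 + (a + 1) * D)))).
    by rewrite ler_wpM2r//; lra.
  have -> : (4 * u + 4) * a * (v ^+ 2 + D) ^+ 2 = 4 * a * ((u + 1) * (v ^+ 2 + D) ^+ 2).
    by ring.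
  by rewrite ler_wpM2l//; lra.
have -> : P1 * ((a + 2) * (a + 1) * v * ux ^+ 2 + (a + 2) * (u * v) * uxx + u * f) =
   (a + 2) * u * v * (P2 * ux ^+ 2 + P1 * uxx)
   + (a + 2) * a / u * 2 * (v ^+ 2 + (a + 1) * D) * ux ^+ 2 + P1 * (u * f).
  by rewrite P1E P2E; field; rewrite !gt_eqF.
have -> : (4 * u + 4) * (P1 * ux) ^+ 2 = (4 * u + 4) * P1 ^+ 2 * ux ^+ 2 by ring.
apply: lerD => //.
apply: lerD => //.
by apply: ler_wpM2r => //; exact: sqr_ge0.
Qed.

(* With [D = d^(2a)], the diffusion coefficient of the transformed equation
   exceeds that of the density by at most [d], whatever the size of [u]. *)
Lemma transform_coefficient_le a d u v D : 1 <= a -> 0 < d -> 0 < u ->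
  v = u `^ a -> D = d `^ (2 * a) ->
  u * D * v ^+ 2 <= d * (v ^+ 2 + D) ^+ 2.
Proof.
move=> a1 d0 u0 vE DE0.
have v0 : 0 < v by rewrite vE powR_gt0.
have D0 : 0 < D by rewrite DE0 powR_gt0.
have DE : D = (d `^ a) ^+ 2.
  by rewrite DE0 mulrC powRrM powR_mulrn ?powR_ge0.
have [ud|du] := leP u d.
  have : D * v ^+ 2 <= (v ^+ 2 + D) ^+ 2.
    rewrite -subr_ge0.
    have -> : (v ^+ 2 + D) ^+ 2 - D * v ^+ 2 = v ^+ 4 + D * v ^+ 2 + D ^+ 2 by ring.
    by rewrite !addr_ge0 ?mulr_ge0 ?exprn_ge0 ?ltW.
  move=> H; rewrite -mulrA ler_pM//; first exact: ltW.
  by rewrite mulr_ge0 ?exprn_ge0 ?ltW.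
(* For [u > d] one has [(d/u)^a <= d/u] because [a >= 1]. Together with [d^a <= v] this yields
   [u D <= d v^2]. *)
have key : u * d `^ a <= d * v.
  have -> : u * d `^ a = d * (u * d `^ (a - 1)).
    by rewrite mulrCA mulr_powRB1// ?ltW//; lra.
  have -> : d * v = d * (u * u `^ (a - 1)).
    by rewrite vE mulr_powRB1// ?ltW//; lra.
  apply: (ler_wpM2l (ltW d0)); apply: (ler_wpM2l (ltW u0)).
  apply: ge0_ler_powR; rewrite ?nnegrE ?(ltW u0) ?(ltW d0) ?(ltW du)//.
  lra.
have dv : d `^ a <= v.
  rewrite vE; apply: ge0_ler_powR; rewrite ?nnegrE ?(ltW u0) ?(ltW d0) ?(ltW du)//; lra.
have uD : u * D <= d * v ^+ 2.
  rewrite DE !expr2 !mulrA.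
  apply: (@le_trans _ _ (d * v * d `^ a)).
    exact: ler_wpM2r (powR_ge0 _ _) _ _ key.
  exact: ler_wpM2l (mulr_ge0 (ltW d0) (ltW v0)) _ _ dv.
have H2 : (v ^+ 2) ^+ 2 <= (v ^+ 2 + D) ^+ 2.
  apply: lerXn2r; rewrite ?nnegrE ?lerDl ?(ltW D0) ?sqr_ge0//.
  exact: addr_ge0 (sqr_ge0 v) (ltW D0).
apply: (@le_trans _ _ (d * (v ^+ 2) ^+ 2)).
  have -> : d * (v ^+ 2) ^+ 2 = d * v ^+ 2 * v ^+ 2 by ring.
  exact: ler_wpM2r (sqr_ge0 v) _ _ uD.
exact: ler_wpM2l (ltW d0) _ _ H2.
Qed.

End Transform.

(** * Arithmetic at a first touching point *)

Section Touching.
Context {R : realType}.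

(** The last inequality is what the derivative tests give where [Phi u] first touches barrier plus
    tail; [V] and [th] are the values of these two, [C] and [S] the cosine and sine. Every error has
    its own budget: terms with the factor [th] are paid by [nu * th], the squared gradient of order
    [tau^(-2)] by [A0 * lam / tau^2], and the decay term [n V / tau] by the damping that the shift
    [c] produces. *)
Lemma touching_contradiction (a K om D A0 tau tauT n lam c c0 C S th thx thxx nu u v M M' m V : R) :
  0 < m -> V = A0 / tau * (C - c) -> 0 < K -> om ^+ 2 = K -> 0 < D <= 1 -> 1 <= A0 -> 0 < c0 -> c0 / 2 <= c ->
  1 <= tau <= tauT -> C <= 1 -> S ^+ 2 <= 1 ->
  n = K * A0 * c0 / 2 * m / 4 -> A0 * lam = 8 * (A0 + 3) * A0 ^+ 2 * K + 2 ->
  0 < th -> thx ^+ 2 <= 4 * th -> thxx <= 2 * th ->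
  0 < u <= M -> 0 < v <= M' -> (1 <= u -> u <= v) ->
  v - D / v = V + th ->
  2 * K * m * (A0 + 2) * D * tauT ^+ 2 <= 1 ->
  4^-1 <= u \/ n * v * tauT <= 1 ->
  K * m * M * M' + 2 * m * M * M' + 8 * (4 * M + 4) + 8 * A0 ^+ 2 * K
    + 2 * K * m * D * tauT ^+ 2 <= nu ->
  tau^-1 * (- (n * V) + A0 * lam / tau) + nu * th <=
    m * u * v * (- (K * A0 / tau * C) + thxx)
    + (4 * u + 4) * (- (A0 / tau * om * S) + thx) ^+ 2
    + K * m * u * (v ^+ 2 + D) -> False.
Proof.
move=> m0 VE' K0 omK /andP[D0 D1] A01 c00 cc /andP[tau1 tauT1] C1 S1 nE lamE
  th0 thx2 thxx2 /andP[u0 uM] /andP[v0 vM] uv vE r1 r2 nuM.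
have tauT_ge1 : 1 <= tauT by exact: le_trans tauT1.
set q := tau^-1.
have tau0 : 0 < tau by clear -tau1; lra.
have q0 : 0 < q by rewrite invr_gt0.
have q1 : q <= 1 by rewrite invf_le1.
have Dv0 : 0 < D / v by rewrite divr_gt0.
have A00 : 0 < A0 by clear -A01; lra.
have M0 : 0 < M by clear -u0 uM; lra.
have M'0 : 0 < M' by clear -v0 vM; lra.
have VE : V = A0 * q * (C - c) by exact: VE'.
have A0q : 0 < A0 * q by rewrite mulr_gt0.
have VA : V <= A0.
  rewrite VE; apply: (@le_trans _ _ (A0 * q * 1)).
    by rewrite ler_pM2l//; clear -C1 c00 cc; lra.
  by rewrite mulr1 ler_piMr ?(ltW A00).
have Vv : V <= v by clear -vE Dv0 th0; lra.
(* [M] may enter [nu] only. Elsewhere [u] is bounded through the touching relation: [u <= v] once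
   [u >= 1], and [v = V + th + D / v]. *)
have uA : u <= A0 + 2 + th.
  have [u1|u1] := ltP u 1; first by clear -u1 A01 th0; lra.
  have uv' := uv u1; have v1 : 1 <= v by clear -u1 uv'; lra.
  have Dv1 : D / v <= 1 by rewrite ler_pdivrMr//; clear -D1 v1; lra.
  by clear -Dv1 uv' vE VA; lra.
(* Here the cosine does its work: by [v - D / v = V + th] the reaction contains [K m u v V], which
   cancels the second derivative of the cosine except for the shift. Up to terms in [th] and [D]
   there remains the damping [- K A0 c m u v / tau]. *)
have E1 : - (m * u * v * (K * A0 * q * C)) + K * m * u * (v ^+ 2 + D) =
    - (K * A0 * c * m * u * v * q) + K * m * u * v * th + 2 * (K * m * u * D).
  have -> : K * m * u * (v ^+ 2 + D) = K * m * u * v * (v - D / v) + 2 * (K * m * u * D).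
    by field; rewrite gt_eqF.
  by rewrite vE VE; ring.
have muv0 : 0 < m * u * v by rewrite !mulr_gt0.
have uvM : u * v <= M * M' by rewrite ler_pM ?(ltW u0) ?(ltW v0).
have E2 : K * A0 * c0 / 2 * m * u * v * q <= K * A0 * c * m * u * v * q.
  do 4 (apply: ler_wpM2r; first exact: ltW).
  have -> : K * A0 * c0 / 2 = K * A0 * (c0 / 2) by rewrite mulrA.
  exact: ler_wpM2l (mulr_ge0 (ltW K0) (ltW A00)) _ _ cc.
have E3 : K * m * u * v * th <= K * m * M * M' * th.
  rewrite ler_wpM2r ?(ltW th0)//.
  by rewrite -!mulrA ler_wpM2l ?(ltW K0)// ler_wpM2l ?(ltW m0).
have E4 : 2 * (K * m * u * D) <= 2 * K * m * (A0 + 2) * D + 2 * K * m * D * tauT ^+ 2 * th.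
  have KmD : 0 < K * m * D by rewrite !mulr_gt0.
  have T1 : 1 <= tauT ^+ 2 by rewrite expr_ge1// (le_trans ler01).
  apply: (@le_trans _ _ (2 * (K * m * D) * (A0 + 2 + th))).
    have -> : 2 * (K * m * u * D) = 2 * (K * m * D) * u by ring.
    exact: ler_wpM2l (mulr_ge0 (ler0n _ 2) (ltW KmD)) _ _ uA.
  have : K * m * D * th <= K * m * D * th * tauT ^+ 2.
    exact: ler_peMr (mulr_ge0 (ltW KmD) (ltW th0)) T1.
  clear; lra.
have E5 : m * u * v * thxx <= 2 * m * M * M' * th.
  apply: (@le_trans _ _ (m * u * v * (2 * th))).
    by rewrite ler_wpM2l ?(ltW muv0).
  have -> : m * u * v * (2 * th) = 2 * m * th * (u * v) by ring.
  have -> : 2 * m * M * M' * th = 2 * m * th * (M * M') by ring.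
  apply: ler_wpM2l uvM.
  exact: mulr_ge0 (mulr_ge0 (ler0n _ 2) (ltW m0)) (ltW th0).
have E6 : (4 * u + 4) * (- (A0 * q * om * S) + thx) ^+ 2 <=
    8 * (A0 + 3) * A0 ^+ 2 * K * q ^+ 2 + 8 * A0 ^+ 2 * K * th + 8 * (4 * M + 4) * th.
  clear E1 E2 E3 E4 E5 vE r1 r2 nuM nE lamE VE VE'.
  have sq (x y : R) : (x + y) ^+ 2 <= 2 * x ^+ 2 + 2 * y ^+ 2.
    by rewrite -subr_ge0; have := sqr_ge0 (x - y); rewrite !expr2; clear; lra.
  apply: (@le_trans _ _ ((4 * u + 4) * (2 * (A0 ^+ 2 * K * q ^+ 2) + 2 * (4 * th)))).
    apply: ler_wpM2l; first by clear -u0; lra.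
    apply: (le_trans (sq _ _)); apply: lerD; last by clear -thx2; lra.
    rewrite sqrrN !exprMn omK.
    have W0 : 0 <= A0 ^+ 2 * q ^+ 2 * K.
      exact: mulr_ge0 (mulr_ge0 (sqr_ge0 A0) (sqr_ge0 q)) (ltW K0).
    have W1 := ler_piMr W0 S1.
    clear -W0 W1; lra.
  have B0 : 0 <= A0 ^+ 2 * K := mulr_ge0 (sqr_ge0 A0) (ltW K0).
  have Bq : 0 <= A0 ^+ 2 * K * q ^+ 2 := mulr_ge0 B0 (sqr_ge0 q).
  have Bth : 0 <= A0 ^+ 2 * K * th := mulr_ge0 B0 (ltW th0).
  have X1 : (4 * u + 4) * (2 * (A0 ^+ 2 * K * q ^+ 2)) <=
       (4 * (A0 + 2 + th) + 4) * (2 * (A0 ^+ 2 * K * q ^+ 2)).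
    apply: ler_wpM2r; [exact: mulr_ge0 (ler0n _ 2) Bq | clear -uA; lra].
  have X2 : (4 * u + 4) * (2 * (4 * th)) <= (4 * M + 4) * (2 * (4 * th)).
    apply: ler_wpM2r; [clear -th0; lra | clear -uM; lra].
  have X3 : th * (A0 ^+ 2 * K * q ^+ 2) <= A0 ^+ 2 * K * th.
    have -> : th * (A0 ^+ 2 * K * q ^+ 2) = A0 ^+ 2 * K * th * q ^+ 2 by ring.
    apply: ler_piMr Bth _.
    by rewrite exprn_ile1// ltW.
  move: X1 X2 X3.
  set Y := A0 ^+ 2 * K * q ^+ 2; set Z := A0 ^+ 2 * K * th.
  have -> : 8 * (A0 + 3) * A0 ^+ 2 * K * q ^+ 2 = 8 * (A0 * Y) + 24 * Y.
    by rewrite /Y; ring.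
  have -> : 8 * A0 ^+ 2 * K * th = 8 * Z by rewrite /Z; ring.
  have -> : (4 * (A0 + 2 + th) + 4) * (2 * Y) = 8 * (A0 * Y) + 24 * Y + 8 * (th * Y).
    by ring.
  rewrite mulrDr => X1 X2 X3; clear -X1 X2 X3; lra.
have E7 : q * (- (n * V) + A0 * lam * q) >= - (n * v * q) + A0 * lam * q ^+ 2.
  clear E1 E2 E3 E4 E5 E6 vE r1 r2 nuM lamE VE VE'.
  have n0 : 0 < n by rewrite nE !mulr_gt0 ?invr_gt0.
  have : n * V * q <= n * v * q by rewrite ler_wpM2r ?(ltW q0)// ler_wpM2l ?(ltW n0).
  have -> : q * (- (n * V) + A0 * lam * q) = - (n * V * q) + A0 * lam * q ^+ 2 by ring.
  by clear; lra.
rewrite -!/q => main.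
(* The summand [2] in the equation for [lam] is what is left once the squared gradient is paid.
   After multiplication by [tau^2] it is a constant surplus that nothing on the right can match. *)
have {main} main : 2 * q ^+ 2 + K * A0 * c0 / 2 * m * u * v * q <=
     n * v * q + 2 * K * m * (A0 + 2) * D.
  have := ler_wpM2r (ltW th0) nuM; rewrite 4!mulrDl => nuth.
  have {E7 main} main := le_trans (lerD E7 nuth) main.
  move: main E1 E2 E3 E4 E5 E6; rewrite lamE.
  have -> : m * u * v * (- (K * A0 * q * C) + thxx) =
     - (m * u * v * (K * A0 * q * C)) + m * u * v * thxx by ring.
  have -> : (8 * (A0 + 3) * A0 ^+ 2 * K + 2) * q ^+ 2 =
     8 * (A0 + 3) * A0 ^+ 2 * K * q ^+ 2 + 2 * q ^+ 2 by ring.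
  set e1 := n * v * q; set e2 := 8 * (A0 + 3) * A0 ^+ 2 * K * q ^+ 2.
  set e3 := K * m * M * M' * th; set e4 := 2 * m * M * M' * th.
  set e5 := 8 * (4 * M + 4) * th; set e6 := 8 * A0 ^+ 2 * K * th.
  set e7 := 2 * K * m * D * tauT ^+ 2 * th.
  set e8 := m * u * v * (K * A0 * q * C); set e9 := m * u * v * thxx.
  set e10 := (4 * u + 4) * _; set e11 := K * m * u * (v ^+ 2 + D).
  set e12 := K * A0 * c * m * u * v * q; set e13 := K * m * u * v * th.
  set e14 := 2 * (K * m * u * D).
  set e15 := K * A0 * c0 / 2 * m * u * v * q; set e16 := 2 * K * m * (A0 + 2) * D.
  set e17 := q ^+ 2.
  move: e1 e2 e3 e4 e5 e6 e7 e8 e9 e10 e11 e12 e13 e14 e15 e16 e17.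
  clear; move=> e1 e2 e3 e4 e5 e6 e7 e8 e9 e10 e11 e12 e13 e14 e15 e16 e17.
  move=> F0 F1 F2 F3 F4 F5 F6; lra.
clear E1 E2 E3 E4 E5 E6 E7 vE nuM lamE VE VE'.
have qtau : q * tau = 1 by rewrite mulVf// gt_eqF.
have {main} main : 2 + K * A0 * c0 / 2 * m * u * v * tau <=
     n * v * tau + 2 * K * m * (A0 + 2) * D * tau ^+ 2.
  have := ler_wpM2r (sqr_ge0 tau) main.
  have -> : (2 * q ^+ 2 + K * A0 * c0 / 2 * m * u * v * q) * tau ^+ 2 =
     2 * (q * tau) ^+ 2 + K * A0 * c0 / 2 * m * u * v * tau * (q * tau) by ring.
  have -> : (n * v * q + 2 * K * m * (A0 + 2) * D) * tau ^+ 2 =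
     n * v * tau * (q * tau) + 2 * K * m * (A0 + 2) * D * tau ^+ 2 by ring.
  by rewrite qtau expr1n !mulr1.
have r1' : 2 * K * m * (A0 + 2) * D * tau ^+ 2 <= 1.
  apply: le_trans r1; rewrite ler_wpM2l//.
    by rewrite !mulr_ge0 ?(ltW K0) ?(ltW m0) ?(ltW D0)// addr_ge0 ?(ltW A00).
  by apply: lerXn2r; rewrite ?nnegrE ?(ltW tau0) ?(le_trans ler01 tauT_ge1).
have kap0 : 0 < K * A0 * c0 / 2 * m.
  by rewrite !mulr_gt0 ?invr_gt0.
have vt0 : 0 < v * tau by rewrite mulr_gt0.
(* For [u >= 1/4] the damping dominates [n v tau], since [n] is a quarter of [K A0 c0 / 2 * m]. For
   smaller [u] the damping is useless, but [n v tau <= 1]; both sides then balance up to the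
   damping, whose strict positivity decides. *)
case: r2 => [u4|nv].
  have : n * v * tau <= K * A0 * c0 / 2 * m * u * v * tau.
    have -> : n * v * tau = K * A0 * c0 / 2 * m * (4^-1) * (v * tau) by rewrite nE; ring.
    have -> : K * A0 * c0 / 2 * m * u * v * tau = K * A0 * c0 / 2 * m * u * (v * tau) by ring.
    by rewrite ler_wpM2r ?(ltW vt0)// ler_wpM2l ?(ltW kap0).
  by move: main r1'; clear; lra.
have nv' : n * v * tau <= 1.
  apply: le_trans nv; rewrite ler_wpM2l// mulr_ge0 ?(ltW v0)// nE.
  by rewrite mulr_ge0// ltW.
have : 0 < K * A0 * c0 / 2 * m * u * v * tau by rewrite -!mulrA !mulr_gt0 ?invr_gt0.
by move: main r1' nv'; clear; lra.
Qed.

End Touching.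

(** * Derivatives and bounds of the barrier and of the tail *)

Section Barrier.
Context {R : realType}.
Implicit Types (om lam n x t eta nu : R).

(* The slowly decreasing level [c(t)] leaves room for the error terms of the
   transformed equation. *)
Definition level (c0 lam n t : R) : R := c0 - lam / n * ln (1 + n * t).

Definition barrier (A0 om y0 c0 lam n : R) (z : R * R) : R :=
  A0 / (1 + n * z.2) * (cos (om * (z.1 - y0)) - level c0 lam n z.2).

(* Added to the barrier so that a first touching point exists on the whole line. *)
Definition tail eta nu (z : R * R) : R := eta * (1 + z.1 ^+ 2) * expR (nu * z.2).

Lemma is_derive_level c0 lam n t : 0 < n -> 0 < 1 + n * t ->
  is_derive t 1 (level c0 lam n) (- (lam / (1 + n * t))).
Proof.
move=> n0 tau0.
have d1 : is_derive t 1 (fun s => 1 + n * s) (0 + n * 1).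
  exact: is_deriveD1 (is_derive_const 1 t) (is_deriveZ1 n (is_derive_var t)).
have := is_deriveB1 (is_derive_const c0 t)
  (is_deriveZ1 (lam / n) (is_derive_comp1 d1 (is_derive1_ln tau0))).
move=> /is_derive_eq; apply; field.
by rewrite !gt_eqF.
Qed.

(** The decay factor contributes [- n] times the barrier itself, the decreasing level the positive
    term [A0 * lam / (1 + n * t)] that later pays for the squared gradient. *)
Lemma is_derive_barrier_t A0 om y0 c0 lam n x t : 0 < n -> 0 < 1 + n * t ->
  is_derive t 1 (fun s => barrier A0 om y0 c0 lam n (x, s))
    ((1 + n * t)^-1 * (- (n * barrier A0 om y0 c0 lam n (x, t))
                       + A0 * lam / (1 + n * t))).
Proof.
move=> n0 tau0.
have d1 : is_derive t 1 (fun s => 1 + n * s) (0 + n * 1).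
  exact: is_deriveD1 (is_derive_const 1 t) (is_deriveZ1 n (is_derive_var t)).
have := is_deriveM1 (is_deriveZ1 A0 (is_derive_comp1 d1 (is_derive_inv tau0)))
  (is_deriveB1 (is_derive_const (cos (om * (x - y0))) t) (is_derive_level c0 lam n0 tau0)).
move=> /is_derive_eq; apply; rewrite /barrier/=; field.
by rewrite gt_eqF.
Qed.

Lemma is_derive_affine (om y0 x : R) : is_derive x 1 (fun y : R => om * (y - y0)) om.
Proof.
have := is_deriveZ1 om (is_deriveB1 (is_derive_var x) (is_derive_const y0 x)).
by move=> /is_derive_eq; apply; ring.
Qed.

Lemma is_derive_barrier_x A0 om y0 c0 lam n x t :
  is_derive x 1 (fun y => barrier A0 om y0 c0 lam n (y, t))
    (- (A0 / (1 + n * t) * om * sin (om * (x - y0)))).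
Proof.
have := is_deriveZ1 (A0 / (1 + n * t)) (is_deriveB1
   (is_derive_comp1 (is_derive_affine om y0 x) (is_derive_cos _))
   (is_derive_const (level c0 lam n t) x)).
by move=> /is_derive_eq; apply; ring.
Qed.

Lemma is_derive_barrier_xx (A0 om y0 n x t : R) :
  is_derive x 1 (fun y => - (A0 / (1 + n * t) * om * sin (om * (y - y0))))
    (- (om ^+ 2 * A0 / (1 + n * t) * cos (om * (x - y0)))).
Proof.
have := is_deriveZ1 (- (A0 / (1 + n * t) * om))
   (is_derive_comp1 (is_derive_affine om y0 x) (is_derive_sin _)).
have -> : (fun y => - (A0 / (1 + n * t) * om) * sin (om * (y - y0))) =
   (fun y => - (A0 / (1 + n * t) * om * sin (om * (y - y0)))).
  by apply/funext => y; rewrite mulNr.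
by move=> /is_derive_eq; apply; ring.
Qed.

Lemma is_derive_tail_t eta nu x t :
  is_derive t 1 (fun s => tail eta nu (x, s)) (nu * tail eta nu (x, t)).
Proof.
have d1 : is_derive t 1 (fun s => nu * s) (nu * 1).
  exact (is_deriveZ1 nu (is_derive_var t)).
have := is_deriveZ1 (eta * (1 + x ^+ 2)) (is_derive_comp1 d1 (is_derive_expR _)).
by move=> /is_derive_eq; apply; rewrite /tail/=; ring.
Qed.

Lemma is_derive_tail_x eta nu x t :
  is_derive x 1 (fun y => tail eta nu (y, t)) (2 * eta * expR (nu * t) * x).
Proof.
have := is_deriveZ1 (eta * expR (nu * t)) (is_deriveD1 (is_derive_const 1 x)
  (is_deriveM1 (is_derive_var x) (is_derive_var x))).
have -> : (fun y => tail eta nu (y, t)) =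
    (fun y => eta * expR (nu * t) * (1 + y * y)).
  by apply/funext => y; rewrite /tail/=; ring.
by move=> /is_derive_eq; apply; ring.
Qed.

Lemma is_derive_tail_xx eta nu x t :
  is_derive x 1 (fun y => 2 * eta * expR (nu * t) * y) (2 * eta * expR (nu * t)).
Proof.
have := is_deriveZ1 (2 * eta * expR (nu * t)) (is_derive_var x).
by move=> /is_derive_eq; apply; rewrite mulr1.
Qed.

(** A crude bound, uniform in [x], which confines possible touching points to a bounded interval. *)
Lemma barrier_ge A0 om y0 c0 lam n x t : 0 <= A0 -> 0 <= n -> 0 <= t ->
  0 <= level c0 lam n t <= c0 ->
  - (A0 * (1 + c0)) <= barrier A0 om y0 c0 lam n (x, t).
Proof.
move=> A00 n0 t0 /andP[l0 lc]; rewrite /barrier/=.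
have nt : 0 <= n * t by rewrite mulr_ge0.
have tau1 : 1 <= 1 + n * t by lra.
have q0 : 0 <= A0 / (1 + n * t) by rewrite divr_ge0//; lra.
have qA : A0 / (1 + n * t) <= A0.
  by rewrite ler_pdivrMr ?ler_peMr//; lra.
apply: (@le_trans _ _ (A0 / (1 + n * t) * - (1 + c0))).
  rewrite mulrN lerN2 ler_wpM2r//; lra.
rewrite ler_wpM2l//; have := cos_geN1 (om * (x - y0)); lra.
Qed.

Lemma continuous_barrier A0 om y0 c0 lam n (z : R * R) : 0 < 1 + n * z.2 ->
  {for z, continuous (barrier A0 om y0 c0 lam n)}.
Proof.
move=> tau0; rewrite /continuous_at.
have c1 : z'.1 @[z' --> z] --> z.1 by exact: cvg_fst.
have c2 : (1 + n * z'.2) @[z' --> z] --> 1 + n * z.2.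
  by apply: cvgD; [exact: cvg_cst|apply: cvgM; [exact: cvg_cst|exact: cvg_snd]].
apply: cvgM.
  apply: cvgM; first exact: cvg_cst.
  by apply: cvgV => //; rewrite gt_eqF.
apply: cvgB.
  apply: continuous_cvg; first exact: continuous_cos.
  by apply: cvgM; [exact: cvg_cst|apply: cvgB => //; exact: cvg_cst].
apply: cvgB; first exact: cvg_cst.
apply: cvgM; first exact: cvg_cst.
apply: continuous_cvg => //.
exact: continuous_ln.
Qed.

Lemma continuous_tail eta nu : continuous (tail eta nu).
Proof.
move=> z.
have c1 : z'.1 @[z' --> z] --> z.1 by exact: cvg_fst.
have c2 : z'.2 @[z' --> z] --> z.2 by exact: cvg_snd.
apply: cvgM.
  apply: cvgM; first exact: cvg_cst.
  by apply: cvgD; [exact: cvg_cst|exact: cvgM].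
apply: continuous_cvg; first exact: continuous_expR.
by apply: cvgM => //; exact: cvg_cst.
Qed.

End Barrier.

(** * Exclusion of touching points *)

Section Comparison.
Context {R : realType}.

(** The value of [D] is the case [d = 1/m], [m = a + 2], of the coefficient bound; as [a + 1 <= m],
    this gives the condition on [D] that the algebraic inequality requires. *)
Lemma transformed_pde_le (f : R -> R) (a K D : R) (u : R * R -> R) (x t : R) (w : R -> R) (v : R) :
  2 <= a -> 0 < K -> D = (a + 2)^-1 `^ (2 * a) ->
  (forall p : R, 0 < p -> f p <= K * p) ->
  (forall y, 0 < u (y, t)) ->
  (forall y, derivable_x u (y, t)) -> derivable_x (dx u) (x, t) ->
  dt u (x, t) = dx (dx (fun z => u z `^ (a + 2))) (x, t)
    + u (x, t) * f (pressure (a + 2) (u (x, t))) ->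
  w = (fun y => Phi a D (u (y, t))) -> v = u (x, t) `^ a ->
  dPhi a D (u (x, t)) * dt u (x, t) <=
    (a + 2) * u (x, t) * v * derive1 (derive1 w) x
    + (4 * u (x, t) + 4) * derive1 w x ^+ 2 + K * (a + 2) * u (x, t) * (v ^+ 2 + D).
Proof.
move=> a2 K0 DE fK upos du ddu pde wE vE.
have a0 : 0 < a by lra.
have a20 : 0 < (a + 2)^-1 by rewrite invr_gt0; lra.
pose h (y : R) : R := u (y, t).
have h0 y : 0 < h y by exact: upos.
have dh y : derivable h y 1 by exact: du.
have ddh : derivable (derive1 h) x 1 by exact: ddu.
have [dw ddw] := derive_comp_pos (is_derive_Phi a D) (is_derive_dPhi a D) h0 dh ddh.
rewrite -[fun y => Phi a D (h y)]/(fun y => Phi a D (u (y, t))) -wE in dw ddw.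
have d2 (s : R) : 0 < s -> is_derive s 1 (fun y => (a + 2) / y * y `^ (a + 2))
    ((a + 2) * (a + 1) / s ^+ 2 * s `^ (a + 2)).
  move=> s0; have := is_deriveM1 (is_deriveZ1 (a + 2) (is_derive_inv s0)) (is_derive_powR (a + 2) s0).
  by move=> /is_derive_eq; apply; field; rewrite gt_eqF.
have [dp ddp] := derive_comp_pos (is_derive_powR (a + 2)) d2 h0 dh ddh.
have -> : derive1 w x = dPhi a D (u (x, t)) * derive1 h x by exact: is_derive_derive1.
have -> : derive1 (derive1 w) x = _ := is_derive_derive1 ddw.
have u0 : 0 < u (x, t) by [].
have v0 : 0 < v by rewrite vE powR_gt0.
have vN : u (x, t) `^ (- a) = v^-1 by rewrite vE powRN.
have D0 : 0 < D by rewrite DE powR_gt0.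
have um : u (x, t) `^ (a + 2) = u (x, t) ^+ 2 * v.
  rewrite powRD; last by rewrite (gt_eqF u0) implybT.
  by rewrite vE [X in _ * X](powR_mulrn 2 (ltW u0)) mulrC.
have um1 : u (x, t) `^ (a + 2 - 1) = u (x, t) * v.
  have -> : a + 2 - 1 = a + 1 by lra.
  rewrite powRD; last by rewrite (gt_eqF u0) implybT.
  by rewrite vE powRr1 ?(ltW u0)// mulrC.
apply: (@transform_pde_le _ a D K (u (x, t)) v _ (derive1 h x) (derive1 (derive1 h) x)
   (f (pressure (a + 2) (u (x, t))))) => //.
- exact: ltW.
- exact: ltW.
- have := @transform_coefficient_le _ a (a + 2)^-1 (u (x, t)) v D.
  have a1 : 1 <= a by lra.
  move=> /(_ a1 a20 u0 vE DE) H.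
  have H2 : (a + 2) * (u (x, t) * D * v ^+ 2) <= (v ^+ 2 + D) ^+ 2.
    apply: (@le_trans _ _ ((a + 2) * ((a + 2)^-1 * (v ^+ 2 + D) ^+ 2))).
      by apply: ler_wpM2l H; lra.
    by rewrite mulrA divff ?mul1r// gt_eqF//; lra.
  apply: le_trans H2.
  have -> : (a + 1) * u (x, t) * D * v ^+ 2 = (a + 1) * (u (x, t) * D * v ^+ 2) by ring.
  apply: ler_wpM2r; last by clear; lra.
  exact: mulr_ge0 (mulr_ge0 (ltW u0) (ltW D0)) (sqr_ge0 v).
- apply: (le_trans (fK _ _)).
    rewrite /pressure mulr_gt0 ?divr_gt0 ?powR_gt0//; lra.
  by rewrite /pressure um1; have -> : a + 2 - 1 = a + 1 by lra.
- rewrite pde; congr (_ + _).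
  have -> : dx (dx (fun z => u z `^ (a + 2))) (x, t) =
    derive1 (derive1 (fun y => h y `^ (a + 2))) x by [].
  rewrite (is_derive_derive1 ddp) /h um.
  by field; rewrite gt_eqF.
- by rewrite /dPhi vN -vE.
- by rewrite /ddPhi /h vN -vE.
Qed.

(** The two bounds by [1] that contain [1 + n * T] express that [a] is large in terms of [T]; the
    lower bound on [nu] collects all that the tail has to absorb; and [eta * expR (nu * t) <= 1]
    makes the squared gradient of the tail at most linear in the tail. The derivative tests are
    applied to [g] in [x] at time [t], and in time at [x] from the left. *)
Lemma no_touching (f : R -> R) (a K om D A0 T n lam c0 y0 M nu eta : R)
    (u : R * R -> R) (x t : R) (g : R * R -> R) :
  2 <= a -> 0 < K -> om ^+ 2 = K -> D = (a + 2)^-1 `^ (2 * a) -> 1 <= A0 -> 0 < c0 ->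
  n = K * A0 * c0 / 2 * (a + 2) / 4 -> A0 * lam = 8 * (A0 + 3) * A0 ^+ 2 * K + 2 ->
  c0 / 2 <= level c0 lam n t ->
  2 * K * (a + 2) * (A0 + 2) * D * (1 + n * T) ^+ 2 <= 1 ->
  n * 4^-1 `^ a * (1 + n * T) <= 1 ->
  K * (a + 2) * M * M `^ a + 2 * (a + 2) * M * M `^ a + 8 * (4 * M + 4) + 8 * A0 ^+ 2 * K
    + 2 * K * (a + 2) * D * (1 + n * T) ^+ 2 <= nu ->
  0 < eta -> eta * expR (nu * t) <= 1 -> 0 < t <= T ->
  (forall p : R, 0 < p -> f p <= K * p) ->
  (forall y, 0 < u (y, t)) -> u (x, t) <= M ->
  (forall y, derivable_x u (y, t)) -> derivable_x (dx u) (x, t) ->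
  derivable_t u (x, t) ->
  dt u (x, t) = dx (dx (fun z => u z `^ (a + 2))) (x, t)
    + u (x, t) * f (pressure (a + 2) (u (x, t))) ->
  g = (fun z => Phi a D (u z) - barrier A0 om y0 c0 lam n z - tail eta nu z) ->
  g (x, t) = 0 -> (forall y, g (y, t) <= 0) ->
  (forall s : R, 0 <= s < t -> g (x, s) < 0) -> False.
Proof.
move=> a2 K0 omK DE A01 c00 nE lamE clev r1 r2 nuM eta0 etae /andP[t0 tT] fK upos uM
  du ddu dtu pde gE gxt gy gs.
have a0 : 0 < a by clear -a2; lra.
have n0 : 0 < n by rewrite nE !mulr_gt0 ?invr_gt0//; clear -a0 A01; lra.
have nt0 : 0 < n * t by rewrite mulr_gt0.
have tau0 : 0 < 1 + n * t by clear -nt0; lra.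
set tau := 1 + n * t in tau0.
have u0 : 0 < u (x, t) by [].
set v := u (x, t) `^ a.
have v0 : 0 < v by exact: powR_gt0.
have a20 : 0 < (a + 2)^-1 by rewrite invr_gt0; clear -a0; lra.
have D0 : 0 < D by rewrite DE powR_gt0.
have D1 : D <= 1.
  have h1 : (a + 2)^-1 <= 1 by rewrite invf_le1; clear -a0; lra.
  rewrite DE; apply: (@le_trans _ _ (1 `^ (2 * a))); last by rewrite powR1.
  apply: ge0_ler_powR => //.
  - by clear -a0; lra.
  - by rewrite nnegrE ltW.
  - by rewrite nnegrE.
set B := barrier A0 om y0 c0 lam n in gE *.
pose th := tail eta nu (x, t).
pose w (y : R) : R := Phi a D (u (y, t)).
pose h (y : R) : R := u (y, t).
have h0 y : 0 < h y by exact: upos.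
have dh y : derivable h y 1 by exact: du.
have ddh : derivable (derive1 h) x 1 by exact: ddu.
have [dw ddw] := derive_comp_pos (is_derive_Phi a D) (is_derive_dPhi a D) h0 dh ddh.
rewrite -[fun y => Phi a D (h y)]/w in dw ddw.
pose bx (y : R) : R := - (A0 / tau * om * sin (om * (y - y0))).
pose tx (y : R) : R := 2 * eta * expR (nu * t) * y.
pose gx (y : R) : R := g (y, t).
have dgx (y : R) : is_derive y 1 gx (dPhi a D (h y) * derive1 h y - bx y - tx y).
  rewrite /gx gE.
  exact (is_deriveB1 (is_deriveB1 (dw y) (is_derive_barrier_x A0 om y0 c0 lam n y t))
    (is_derive_tail_x eta nu y t)).
have gxE : derive1 gx = (fun y => derive1 w y - bx y - tx y).
  by apply/funext => y; rewrite (is_derive_derive1 (dgx y)) (is_derive_derive1 (dw y)).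
have ddgx : is_derive x 1 (derive1 gx)
    (derive1 (derive1 w) x - - (om ^+ 2 * A0 / tau * cos (om * (x - y0)))
     - 2 * eta * expR (nu * t)).
  rewrite gxE; rewrite (is_derive_derive1 ddw).
  exact (is_deriveB1 (is_deriveB1 ddw (is_derive_barrier_xx A0 om y0 n x t))
     (is_derive_tail_xx eta nu x t)).
have dgx1 (y : R) : derivable gx y 1 by case: (dgx y).
have gmax y : gx y <= gx x by rewrite /gx gxt gy.
have first0 := derive1_max_eq0 dgx1 gmax.
have second0 := derive2_max_le0 dgx1 (let: DeriveDef d _ := ddgx in d) gmax.
rewrite (is_derive_derive1 ddgx) in second0.
rewrite gxE in first0.
pose gt (s : R) : R := g (x, s).
have dut : is_derive t 1 (fun s => u (x, s)) (dt u (x, t)).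
  exact: derivable_is_derive dtu.
have dgt : is_derive t 1 gt (dPhi a D (u (x, t)) * dt u (x, t)
    - (tau^-1 * (- (n * B (x, t)) + A0 * lam / tau)) - nu * th).
  rewrite /gt gE.
  exact (is_deriveB1 (is_deriveB1 (is_derive_comp1 dut (is_derive_Phi a D u0))
    (is_derive_barrier_t A0 om y0 c0 lam x n0 tau0)) (is_derive_tail_t eta nu x t)).
have time0 : 0 <= derive1 gt t.
  have dgt1 : derivable gt t 1 by case: dgt.
  apply: (derive1_left_max_ge0 t0 dgt1).
  by move=> s /andP[s0 st]; rewrite /gt gxt ltW// gs// ltW.
rewrite (is_derive_derive1 dgt) in time0.
have main := transformed_pde_le a2 K0 DE fK upos du ddu pde erefl erefl.
have th0 : 0 < th.
  rewrite /th /tail/= !mulr_gt0 ?expR_gt0//.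
  by rewrite ltr_pwDl// sqr_ge0.
have ee0 : 0 < eta * expR (nu * t) by rewrite mulr_gt0 ?expR_gt0.
have thE : th = eta * expR (nu * t) * (1 + x ^+ 2) by rewrite /th /tail/=; ring.
have thx2 : (2 * eta * expR (nu * t) * x) ^+ 2 <= 4 * th.
  have -> : (2 * eta * expR (nu * t) * x) ^+ 2 =
     4 * ((eta * expR (nu * t)) * (eta * expR (nu * t) * x ^+ 2)) by ring.
  rewrite ler_wpM2l//.
  apply: (@le_trans _ _ (eta * expR (nu * t) * x ^+ 2)).
    by rewrite ler_piMl// mulr_ge0 ?sqr_ge0// ltW.
  by rewrite thE ler_wpM2l ?(ltW ee0)// lerDr.
have thxx2 : 2 * eta * expR (nu * t) <= 2 * th.
  rewrite thE -mulrA ler_wpM2l// ler_peMr ?(ltW ee0)// lerDl sqr_ge0//.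
have vM : v <= M `^ a.
  apply: ge0_ler_powR; rewrite ?nnegrE ?(ltW u0)// ?(ltW a0)//.
  exact: ltW (lt_le_trans u0 uM).
have uv : 1 <= u (x, t) -> u (x, t) <= v.
  by move=> u1; apply: le1r_powR; clear -u1 a2; lra.
have vE : v - D / v = B (x, t) + th.
  by move: gxt; rewrite gE /Phi powRN -/v -/th; clear; lra.
have r2' : 4^-1 <= u (x, t) \/ n * v * (1 + n * T) <= 1.
  have [?|u4] := leP 4^-1 (u (x, t)); [by left|right].
  apply: le_trans r2; rewrite ler_wpM2r//.
    by rewrite addr_ge0// mulr_ge0 ?(ltW n0)// (le_trans (ltW t0)).
  rewrite ler_wpM2l ?(ltW n0)//.
  by apply: ge0_ler_powR; rewrite ?nnegrE ?(ltW u0) ?(ltW u4) ?(ltW a0)// invr_ge0.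
have nT : n * t <= n * T by rewrite ler_wpM2l ?(ltW n0).
apply: (@touching_contradiction _ a K om D A0 tau (1 + n * T) n lam (level c0 lam n t) c0
  (cos (om * (x - y0))) (sin (om * (x - y0))) th (2 * eta * expR (nu * t) * x)
  (2 * eta * expR (nu * t)) nu (u (x, t)) v M (M `^ a) (a + 2) (B (x, t))) => //.
- by clear -a0; lra.
- by rewrite D0.
- by rewrite /tau; apply/andP; split; clear -nt0 nT; lra.
- by rewrite u0.
- by rewrite v0.
have step1 : tau^-1 * (- (n * B (x, t)) + A0 * lam / tau) + nu * th <=
    dPhi a D (u (x, t)) * dt u (x, t) by move: time0; clear; lra.
apply: (le_trans step1); apply: (le_trans main).
rewrite -/v -/w.
have -> : derive1 w x = - (A0 / tau * om * sin (om * (x - y0))) + 2 * eta * expR (nu * t) * x.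
  by move: first0; rewrite /bx /tx; clear; lra.
apply: lerD => //; apply: lerD => //.
apply: ler_wpM2l; first by rewrite !mulr_ge0 ?(ltW u0) ?(ltW v0)//; clear -a0; lra.
by move: second0; rewrite omK; clear; lra.
Qed.

End Comparison.

Section ClassicalComparison.
Context {R : realType}.

Lemma continuous_Phi (a D s : R) : 0 < s -> {for s, continuous (Phi a D)}.
Proof.
move=> s0; apply: differentiable_continuous; apply/derivable1_diffP.
by case: (is_derive_Phi a D s0).
Qed.

(** The barrier is periodic in [x] and [u] merely bounded, so the largest difference need not be
    attained. The quadratic growth of the tail repairs this; touching is excluded for every small
    amplitude [eta], and [eta] then tends to zero at a fixed point. *)
Lemma classical_le_barrier (f : R -> R) (a K om D A0 T n lam c0 y0 : R)
    (r : R -> R) (u : R * R -> R) :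
  2 <= a -> 0 < K -> om ^+ 2 = K -> D = (a + 2)^-1 `^ (2 * a) -> 1 <= A0 -> 0 < c0 ->
  n = K * A0 * c0 / 2 * (a + 2) / 4 -> A0 * lam = 8 * (A0 + 3) * A0 ^+ 2 * K + 2 ->
  (forall t, 0 <= t <= T -> c0 / 2 <= level c0 lam n t <= c0) ->
  2 * K * (a + 2) * (A0 + 2) * D * (1 + n * T) ^+ 2 <= 1 ->
  n * 4^-1 `^ a * (1 + n * T) <= 1 ->
  (forall p : R, 0 < p -> f p <= K * p) ->
  positive_classical_solution f (a + 2) r u ->
  (forall x, Phi a D (r x) <= barrier A0 om y0 c0 lam n (x, 0)) ->
  forall x t, 0 <= t <= T ->
    Phi a D (u (x, t)) <= barrier A0 om y0 c0 lam n (x, t).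
Proof.
move=> a2 K0 omK DE A01 c00 nE lamE clev r1 r2 fK [upos ubnd [ucont u0r] udiff updec] init x1 t1 t1T.
have T0 : 0 <= T by case/andP: t1T => /le_trans; exact.
have a0 : 0 < a by clear -a2; lra.
have n0 : 0 < n by rewrite nE !mulr_gt0 ?invr_gt0//; clear -a0 A01; lra.
have a20 : 0 < (a + 2)^-1 by rewrite invr_gt0; clear -a0; lra.
have D0 : 0 < D by rewrite DE powR_gt0.
have [M uM] := ubnd T.
have M0 : 0 < M.
  apply: lt_le_trans (uM (0, 0) _); first by apply: upos => /=.
  by rewrite /= lexx.
set nu := K * (a + 2) * M * M `^ a + 2 * (a + 2) * M * M `^ a + 8 * (4 * M + 4) + 8 * A0 ^+ 2 * K
    + 2 * K * (a + 2) * D * (1 + n * T) ^+ 2.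
have nu0 : 0 < nu.
  have Ma : 0 < M `^ a by exact: powR_gt0.
  have h1 : 0 <= K * (a + 2) * M * M `^ a by rewrite !mulr_ge0 ?ltW//; clear -a0; lra.
  have h2 : 0 <= 2 * (a + 2) * M * M `^ a by rewrite !mulr_ge0 ?ltW//; clear -a0; lra.
  have h3 : 0 <= 8 * A0 ^+ 2 * K by exact (mulr_ge0 (mulr_ge0 (ler0n _ 8) (sqr_ge0 A0)) (ltW K0)).
  have h4 : 0 <= 2 * K * (a + 2) * D * (1 + n * T) ^+ 2.
    have h5 : 0 <= a + 2 by clear -a0; lra.
    exact (mulr_ge0 (mulr_ge0 (mulr_ge0 (mulr_ge0 (ler0n _ 2) (ltW K0)) h5) (ltW D0)) (sqr_ge0 _)).
  by rewrite /nu; move: h1 h2 h3 h4; clear -M0; lra.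
have small (eta : R) : 0 < eta -> eta * expR (nu * T) <= 1 ->
    Phi a D (u (x1, t1)) - barrier A0 om y0 c0 lam n (x1, t1) < tail eta nu (x1, t1).
  move=> eta0 etae; rewrite ltNge; apply/negP => bad.
  pose g z := Phi a D (u z) - barrier A0 om y0 c0 lam n z - tail eta nu z.
  have th_ge x t : 0 <= t -> eta * (1 + x ^+ 2) <= tail eta nu (x, t).
    move=> t0; rewrite /tail/= ler_peMr//.
      by rewrite mulr_ge0 ?(ltW eta0)// addr_ge0 ?sqr_ge0.
    by rewrite -expR0 ler_expR mulr_ge0// ltW.
  have th_gt0 x t : 0 <= t -> 0 < tail eta nu (x, t).
    move=> t0; apply: lt_le_trans (th_ge x t t0).
    by rewrite mulr_gt0// ltr_pwDl// sqr_ge0.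
  have cg : {within [set z : R * R | 0 <= z.2], continuous g}.
    apply/subspace_continuousP => z /= z0.
    have tau0 : 0 < 1 + n * z.2 by rewrite ltr_pwDl// mulr_ge0// ltW.
    have cu : u @ within [set z : R * R | 0 <= z.2] (nbhs z) --> u z.
      by move/subspace_continuousP : ucont; exact.
    apply: cvgB; last by apply: cvg_within_filter; exact: continuous_tail.
    apply: cvgB; last by apply: cvg_within_filter; exact: continuous_barrier.
    apply: (cvg_comp _ _ cu); exact: continuous_Phi (upos _ z0).
  have g0 x : g (x, 0) < 0.
    rewrite /g u0r; have := init x; have := th_gt0 x 0 (lexx _); clear; lra.
  (* For [|x| >= X >= 1] one gets [eta x^2 >= eta + M^a + A0 (1 + c0)], more than the largest
     possible excess of [Phi u] over the barrier. *)
  set X := 1 + (M `^ a + A0 * (1 + c0)) / eta.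
  have Ma : 0 < M `^ a by exact: powR_gt0.
  have X1 : 1 <= X.
    rewrite /X lerDl divr_ge0 ?(ltW eta0)// addr_ge0 ?(ltW Ma)// mulr_ge0; clear -A01 c00; lra.
  have gX x t : 0 <= t <= T -> X <= `|x| -> g (x, t) < 0.
    move=> /andP[t0 tT] Xx.
    have clt : c0 / 2 <= level c0 lam n t <= c0 by apply: clev; rewrite t0.
    have clt0 : 0 <= level c0 lam n t <= c0.
      by move: clt => /andP[h ->]; rewrite andbT; clear -h c00; lra.
    have A00 : 0 <= A0 by clear -A01; lra.
    have b1 := @barrier_ge _ A0 om y0 c0 lam n x t A00 (ltW n0) t0 clt0.
    have up : 0 < u (x, t) by apply: upos.
    have v1 : Phi a D (u (x, t)) <= M `^ a.
      apply: (@le_trans _ _ (u (x, t) `^ a)).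
        by rewrite /Phi gerBl mulr_ge0 ?powR_ge0// ltW.
      apply: ge0_ler_powR; rewrite ?nnegrE ?(ltW up) ?(ltW M0) ?(ltW a0)//.
      by apply: uM; rewrite /= t0.
    have x2 : X <= x ^+ 2.
      rewrite -real_normK ?num_real//; apply: (le_trans Xx).
      by rewrite expr2 ler_peMr// (le_trans X1).
    have x3 : eta * X <= eta * x ^+ 2 by rewrite ler_wpM2l ?(ltW eta0).
    have x4 : eta * X = eta + (M `^ a + A0 * (1 + c0)).
      by rewrite /X; field; rewrite gt_eqF.
    have := th_ge x t t0; rewrite mulrDr mulr1 /g.
    by move: x3 b1 v1 eta0; rewrite x4; clear; lra.
  have [x0 [t0 [/andP[t00 t0T] gt0 gle glt]]] : exists x0 t0, [/\ 0 < t0 <= T, g (x0, t0) = 0,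
      forall x, g (x, t0) <= 0 & forall t, 0 <= t < t0 -> g (x0, t) < 0].
    apply: (first_touch cg g0 gX).
    by exists (x1, t1); split => //=; rewrite /g subr_ge0.
  have [[d1 d2 d3] _] := udiff (x0, t0) t00.
  apply: (@no_touching _ f a K om D A0 T n lam c0 y0 M nu eta u x0 t0 g
    a2 K0 omK DE A01 c00 nE lamE _ r1 r2 (lexx _) eta0 _ _ fK _ _ _ d3 d1 _ erefl gt0 gle glt).
  - by have /andP[] : c0 / 2 <= level c0 lam n t0 <= c0 by apply: clev; rewrite ltW.
  - apply: le_trans etae; rewrite ler_wpM2l ?(ltW eta0)// ler_expR.
    by rewrite ler_wpM2l// ltW.
  - by rewrite t00.
  - by move=> y; apply: upos; exact: ltW.
  - by apply: uM; rewrite /= t0T ltW.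
  - by move=> y; have [[_ d _] _] := udiff (y, t0) t00; exact: d.
  - exact: updec (x0, t0) t00.
apply/ler_addgt0Pl => e e0.
have Q0 : 0 < expR (nu * T) by exact: expR_gt0.
have P0 : 0 < 1 + x1 ^+ 2 by rewrite ltr_pwDl// sqr_ge0.
(* The first entry of the minimum keeps the gradient of the tail under control, the second makes the
   tail at most [e] at the point considered. *)
pose eta := Num.min 1 (e / (1 + x1 ^+ 2)) / expR (nu * T).
have eta0 : 0 < eta by rewrite divr_gt0// lt_min ltr01 divr_gt0.
have etaQ : eta * expR (nu * T) = Num.min 1 (e / (1 + x1 ^+ 2)).
  by rewrite /eta divfK// gt_eqF.
have /(small eta eta0) : eta * expR (nu * T) <= 1 by rewrite etaQ ge_min lexx.
have : tail eta nu (x1, t1) <= e.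
  rewrite /tail/= mulrAC.
  apply: (@le_trans _ _ (Num.min 1 (e / (1 + x1 ^+ 2)) * (1 + x1 ^+ 2))).
    rewrite ler_wpM2r ?(ltW P0)// -etaQ ler_wpM2l ?(ltW eta0)// ler_expR.
    by rewrite ler_wpM2l ?(ltW nu0)//; case/andP: t1T.
  by rewrite -ler_pdivlMr// ge_min lexx orbT.
by clear; lra.
Qed.

(** With [v = s^a] and [q = d^a] the hypothesis reads [v - q^2 / v <= b]; if [v > b + q], then
    [q^2 / v <= q], which is absurd. Undoing [Phi] thus costs only [d^a]. *)
Lemma powR_le_of_Phi_le (a d s b : R) : 0 < d -> 0 < s -> 0 <= b ->
  Phi a (d `^ (2 * a)) s <= b -> s `^ a <= b + d `^ a.
Proof.
move=> d0 s0 b0; rewrite /Phi powRN [2 * a]mulrC powRrM powR_mulrn ?powR_ge0//.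
have : 0 < s `^ a by exact: powR_gt0.
have : 0 < d `^ a by exact: powR_gt0.
move: (s `^ a) (d `^ a) => v q q0 v0 H.
rewrite leNgt; apply/negP => vb.
have : q ^+ 2 / v <= q by rewrite ler_pdivrMr// expr2 ler_wpM2l ?(ltW q0)//; lra.
lra.
Qed.

End ClassicalComparison.

(** * Smoothed Heaviside functions and bounds on mollified data *)

Section Mollifiers.
Context {R : realType}.
Implicit Types (e c L x y : R) (eta g E : R -> R).

Lemma smooth1_continuous g : smooth1 g -> continuous g.
Proof.
move=> /(_ 0%N) sg x; apply: differentiable_continuous; apply/derivable1_diffP.
exact: sg.
Qed.

Lemma integrable_continuous_support g e : continuous g ->
  (forall x, e < `|x| -> g x = 0) -> leb.-integrable setT (EFin \o g).
Proof.
move=> cg g0.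
have -> : EFin \o g = (EFin \o g) \_ `[- e, e].
  apply/funext => x; rewrite patchE; case: ifPn => // xe.
  rewrite /= g0// ltNge ler_norml; apply/negP => xe'; move/negP : xe; apply.
  by rewrite inE/= in_itv/=.
have [+ _] := @integrable_mkcond _ _ _ leb `[- e, e] (EFin \o g) (measurable_itv _).
apply; apply: continuous_compact_integrable; first exact: segment_compact.
exact: continuous_subspaceT.
Qed.

Lemma antiderivative g e : continuous g -> (forall x, x < - e -> g x = 0) ->
  let G := fun x : R => \int[leb]_(t in `]-oo, x]) g t in
  (forall x, is_derive x 1 G (g x)) /\ (forall x, x < - e -> G x = 0).
Proof.
move=> cg g0 G; split=> x.
  have xu : x < x + 1 by rewrite ltrDl.
  pose J : set (measurableTypeR R) := `]-oo, x + 1]%classic.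
  have i1 : leb.-integrable J (EFin \o g).
    have mJ : measurable J by exact: measurable_itv.
    have [_ +] := @integrable_mkcond _ _ _ leb J (EFin \o g) mJ; apply.
    have -> : (EFin \o g) \_ J = (EFin \o g) \_ `[- e, x + 1].
      apply/funext => y; rewrite !patchE !mem_setE /= !in_itv/=.
      have [yx|yx] := boolP (y <= x + 1); last by rewrite andbF.
      by rewrite andbT; case: leP => // ye; rewrite g0.
    have [+ _] := @integrable_mkcond _ _ _ leb `[- e, x + 1] (EFin \o g) (measurable_itv _).
    apply; apply: continuous_compact_integrable; first exact: segment_compact.
    exact: continuous_subspaceT.
  have [dG Gx] := @continuous_FTC1 R g -oo%O x (x + 1) xu i1 (ltNyr _) (cg x).
  by rewrite -Gx; exact: derivable_is_derive dG.
move=> xe; rewrite /G Rintegral_mkcond.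
have -> : g \_ `]-oo, x] = fun=> 0.
  apply/funext => y; rewrite patchE; case: ifPn => //.
  by rewrite inE/= in_itv/= => yx; apply: g0; exact: le_lt_trans xe.
by rewrite /Rintegral integral0.
Qed.

(** A smoothed Heaviside function. It serves to integrate translated mollifiers, and its translates
    are later the building blocks of the test functions. *)
Lemma mollifier_antiderivative e eta : 0 < e -> mollifier e eta ->
  exists E, [/\ forall x, is_derive x 1 E (eta x),
    forall x, x < - e -> E x = 0, forall x, e < x -> E x = 1 &
    forall x, 0 <= E x <= 1].
Proof.
move=> e0 [seta eta0 supp int1].
have ceta := smooth1_continuous seta.
have suppl x : x < - e -> eta x = 0.
  by move=> xe; apply: supp; rewrite ltrNr in xe; rewrite lter_normr xe orbT.
have [dE El] := antiderivative ceta suppl.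
set E := (fun x : R => _) in dE El.
have Er x : e < x -> E x = 1.
  move=> ex; rewrite -int1 /E Rintegral_mkcond; congr (Rintegral _ _ _).
  apply/funext => y; rewrite patchE; case: ifPn => //.
  rewrite notin_setE/= in_itv/= => /negP; rewrite -ltNge => xy.
  by rewrite supp// (lt_le_trans (lt_trans ex xy)) ?ler_norm.
have mono x y : x <= y -> E x <= E y.
  move=> xy; apply: (@ger0_derive1_ndecr _ E x y) => //.
  - by move=> z _; rewrite (is_derive_derive1 (dE z)).
  - apply: continuous_subspaceT => z; apply: differentiable_continuous.
    by apply/derivable1_diffP; case: (dE z).
exists E; split => // x; apply/andP; split.
  rewrite -(El (Num.min x (- e) - 1)); last first.
    have : Num.min x (- e) <= - e by rewrite ge_min lexx orbT.
    lra.
  by apply: mono; rewrite lerBlDr ge_min lerDl ler01.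
rewrite -(Er (Num.max x e + 1)); last by rewrite ltr_pwDr// le_max lexx orbT.
by apply: mono; rewrite ler_wpDr// le_max lexx.
Qed.

Lemma integral_mollifier_shift e eta x : 0 < e -> mollifier e eta ->
  (\int[leb]_y (eta (x - y))%:E = 1)%E.
Proof.
move=> e0 meta; have [E [dE El Er _]] := mollifier_antiderivative e0 meta.
have [seta eta0 supp int1] := meta.
have ceta := smooth1_continuous seta.
have cetax : continuous (fun y => eta (x - y)).
  move=> y; apply: (continuous_comp (f := fun y => x - y) (g := eta)); last exact: ceta.
  by apply: cvgB; [exact: cvg_cst|exact: cvg_id].
pose F y := - E (x - y).
have dF y : is_derive y 1 F (eta (x - y)).
  have d1 : is_derive y 1 (fun z => x - z) (0 - 1).
    exact (is_deriveB1 (is_derive_const x y) (is_derive_var y)).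
  have := is_deriveZ1 (-1) (is_derive_comp1 d1 (dE (x - y))).
  have -> : (fun y => -1 * E (x - y)) = F by apply/funext => z; rewrite mulN1r.
  by move=> /is_derive_eq; apply; ring.
have cF : continuous F.
  move=> y; apply: differentiable_continuous.
  by apply/derivable1_diffP; case: (dF y).
(* The margin [1] beyond [e] puts the endpoints strictly outside the support, where [E] is exactly
   [0] or [1]. *)
rewrite (_ : (fun y => (eta (x - y))%:E) =
   (fun y => (eta (x - y))%:E) \_ `[x - (e + 1), x + (e + 1)]); last first.
  apply/funext => y; rewrite patchE; case: ifPn => //.
  rewrite notin_setE/= in_itv/= => /negP ye; rewrite supp// ltNge.
  apply: contra ye; rewrite ler_norml => /andP[ye1 ye2].
  by apply/andP; split; lra.
rewrite -integral_mkcond.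
have ltx : x - (e + 1) < x + (e + 1) by lra.
rewrite /leb (continuous_FTC2 ltx (F := F)).
- have -> : F (x + (e + 1)) = 0 by rewrite /F El ?oppr0//; lra.
  have -> : F (x - (e + 1)) = - 1 by rewrite /F Er//; lra.
  by rewrite -EFinB; congr EFin; lra.
- exact: continuous_subspaceT.
- split.
  + by move=> y _; case: (dF y).
  + exact: cvg_at_right_filter (cF _).
  + exact: cvg_at_left_filter (cF _).
- by move=> y _; rewrite (is_derive_derive1 (dF y)).
Qed.

(** Averaging with mass one preserves the bound [c], and the support of [eta] reaches only [e]
    beyond []0, L[]. The second part is what makes [Phi] of the regularized data very negative away
    from the interval. *)
Lemma mollify_bounds e eta g c L : 0 < e -> mollifier e eta -> 0 <= c ->
  L1 leb setT g -> {ae leb, forall x, 0 <= g x <= c * \1_(`]0, L[) x} ->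
  (forall x, mollify eta g x <= c) /\
  (forall x, x <= - e \/ L + e <= x -> mollify eta g x <= 0).
Proof.
move=> e0 meta c0 ig gc.
have [seta eta0 supp int1] := meta.
have ceta := smooth1_continuous seta.
have cetax x : continuous (fun y => eta (x - y)).
  move=> y; apply: (continuous_comp (f := fun y => x - y) (g := eta)); last exact: ceta.
  by apply: cvgB; [exact: cvg_cst|exact: cvg_id].
(* A representative of [g] that satisfies the bounds at every point, so that integrands can be
   compared pointwise. *)
pose g' x := Num.min (Num.max (g x) 0) (c * \1_(`]0, L[) x).
have mg : measurable_fun setT g by apply/measurable_EFinP; case/integrableP: ig.
have mg' : measurable_fun setT g'.
  apply: measurable_minr; first exact: measurable_maxr.
  by apply: measurable_funM => //; exact: measurable_indic.
have g'0 x : 0 <= g' x.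
  by rewrite /g' le_min le_max lexx orbT mulr_ge0// indicE ler0n.
have g'c x : g' x <= c * \1_(`]0, L[) x by rewrite /g' ge_min lexx orbT.
have g'c1 x : g' x <= c by apply: (le_trans (g'c x)); rewrite ler_piMr// indicE lern1 leq_b1.
have mE x : measurable_fun setT (fun y => eta (x - y)) by exact: continuous_measurable_fun.
have molE x : mollify eta g x = fine (\int[leb]_y (eta (x - y) * g' y)%:E)%E.
  rewrite /mollify /Rintegral; congr fine; apply: ae_eq_integral => //.
  - apply/measurable_EFinP; exact (measurable_funM (mE x) mg).
  - apply/measurable_EFinP; exact (measurable_funM (mE x) mg').
  - apply: (aeW gc) => y /andP[gy0 gyc] _.
    by rewrite /g' max_l// min_l.
have le1 x (b : R -> R) : measurable_fun setT b -> (forall y, 0 <= b y) ->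
   (forall y, eta (x - y) * g' y <= b y) ->
   (\int[leb]_y (eta (x - y) * g' y)%:E <= \int[leb]_y (b y)%:E)%E.
  move=> mb b0 hb; apply: ge0_le_integral => //.
  - by move=> y _; rewrite lee_fin mulr_ge0.
  - apply/measurable_EFinP; exact (measurable_funM (mE x) mg').
  - by apply/measurable_EFinP.
  - by move=> y _; rewrite lee_fin.
have ge0 x : (0 <= \int[leb]_y (eta (x - y) * g' y)%:E)%E.
  by apply: integral_ge0 => y _; rewrite lee_fin mulr_ge0.
have up x : (\int[leb]_y (eta (x - y) * g' y)%:E <= c%:E)%E.
  apply: (@le_trans _ _ (\int[leb]_y (c * eta (x - y))%:E)%E).
    apply: le1; first exact (measurable_funM (measurable_cst c) (mE x)).
      by move=> y; rewrite mulr_ge0.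
    by move=> y; rewrite mulrC ler_wpM2r.
  under eq_integral do rewrite EFinM.
  rewrite ge0_integralZl//.
  - by rewrite (integral_mollifier_shift _ e0 meta) mule1.
  - apply/measurable_EFinP; exact (mE x).
  - by move=> y _; rewrite lee_fin.
split=> x.
  by rewrite molE -lee_fin fineK// ge0_fin_numE// (le_lt_trans (up x))// ltry.
move=> xout; rewrite molE.
rewrite integral0_eq// => y _.
have [y0|y0] := boolP (y \in `]0, L[).
  rewrite supp ?mul0r//.
  move: y0; rewrite in_itv/= => /andP[y0 yL].
  case: xout => [xe|xe].
    by rewrite lter_normr; apply/orP; right; lra.
  by rewrite lter_normr; apply/orP; left; lra.
suff -> : g' y = 0 by rewrite mulr0.
apply/eqP; rewrite eq_le g'0 andbT; apply: (le_trans (g'c y)).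
by rewrite indicE mem_setE (negbTE y0) mulr0.
Qed.

End Mollifiers.

(** * From the initial data to an almost everywhere bound on the density *)

Section SolutionBound.
Context {R : realType}.

Lemma density_le_of_pressure_le (m r p : R) : 1 < m -> 0 <= r -> 0 <= p ->
  pressure m r <= p -> r <= ((m - 1) / m * p) `^ (m - 1)^-1.
Proof.
move=> m2 r0 p0; rewrite /pressure => H.
have m10 : 0 < m - 1 by lra.
have m0 : 0 < m by lra.
have rE : r = (r `^ (m - 1)) `^ (m - 1)^-1.
  by rewrite -powRrM divff ?gt_eqF// powRr1.
rewrite [leLHS]rE; apply: ge0_ler_powR; rewrite ?nnegrE ?powR_ge0 ?invr_ge0 ?(ltW m10)//.
  by rewrite mulr_ge0// divr_ge0 ?ltW.
have -> : r `^ (m - 1) = (m - 1) / m * (m / (m - 1) * r `^ (m - 1)).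
  by field; rewrite !gt_eqF.
by rewrite ler_wpM2l// divr_ge0 ?ltW.
Qed.

Lemma initial_density_bound (m pM L : R) (g : R -> R) : 1 < m -> 0 < pM ->
  {ae leb, forall x, 0 <= g x} ->
  {ae leb, forall x, pressure m (g x) <= pM * \1_(`]0, L[) x} ->
  {ae leb, forall x, 0 <= g x <=
     ((m - 1) / m * pM) `^ (m - 1)^-1 * \1_(`]0, L[) x}.
Proof.
move=> m2 pM0 g0 gp; apply: (aeW (aeI g0 gp)) => x [gx0 gxp].
rewrite gx0 /=.
have m1 : (m - 1)^-1 != 0 by rewrite invr_eq0 gt_eqF//; lra.
move: gxp; rewrite indicE; case: (_ \in _) => /=; rewrite ?mulr1 ?mulr0 => gxp.
  exact: density_le_of_pressure_le (ltW pM0) gxp.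
by have := density_le_of_pressure_le m2 gx0 (lexx 0) gxp; rewrite mulr0 powR0.
Qed.

(** A bound free of the exponent, which keeps the constants uniform as [m] grows. *)
Lemma powR_le_add1 (q b : R) : 0 <= q -> 0 <= b <= 1 -> q `^ b <= q + 1.
Proof.
move=> q0 /andP[b0 b1]; have [q1|q1] := leP q 1.
  apply: (@le_trans _ _ (1 `^ b)); last by rewrite powR1 lerDr.
  by apply: ge0_ler_powR => //; rewrite nnegrE.
by apply: (le_trans (ler1_powR (ltW q1) b1)); rewrite lerDl.
Qed.

(** The heart is the ordering at time zero for large [k]. Near [[0, L]] the room comes from
    [pM + 2 <= A0 * c0]; elsewhere the data are at most [e k], so small that [Phi] falls below the
    minimum of the barrier. How large [k] must be depends on [a], which is harmless since [k] tends
    to infinity at fixed [a]. *)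
Lemma ae_solution_bound (f : R -> R) (a K om D A0 T n lam c0 L de pM : R)
    (g : R -> R) (rho : R * R -> R) :
  2 <= a -> 0 < K -> om ^+ 2 = K -> D = (a + 2)^-1 `^ (2 * a) -> 1 <= A0 -> 0 < c0 <= 1 ->
  n = K * A0 * c0 / 2 * (a + 2) / 4 -> A0 * lam = 8 * (A0 + 3) * A0 ^+ 2 * K + 2 ->
  (forall t, 0 <= t <= T -> c0 / 2 <= level c0 lam n t <= c0) ->
  2 * K * (a + 2) * (A0 + 2) * D * (1 + n * T) ^+ 2 <= 1 ->
  n * 4^-1 `^ a * (1 + n * T) <= 1 ->
  (forall p : R, 0 < p -> f p <= K * p) ->
  0 < de -> (forall x, - de <= x <= L + de -> 2 * c0 <= cos (om * (x - L / 2))) ->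
  0 < pM -> pM + 2 <= A0 * c0 ->
  {ae leb, forall x, 0 <= g x} -> L1 leb setT g ->
  {ae leb, forall x, pressure (a + 2) (g x) <= pM * \1_(`]0, L[) x} ->
  limit_of_positive_solutions f (a + 2) g rho ->
  {ae leb2, forall z, 0 < z.2 <= T ->
     0 <= rho z /\ rho z `^ a <= A0 / (1 + n * z.2) + (a + 2)^-1 `^ a}.
Proof.
move=> a2 K0 omK DE A01 /andP[c00 c01] nE lamE clev r1 r2 fK de0 cosde pM0 A0c g0 ig gp
  [r [u [[eta [e [ecvg meta rk]]] usol ucvg]]].
have a0 : 0 < a by clear -a2; lra.
have m2 : 1 < a + 2 by clear -a0; lra.
have n0 : 0 < n by rewrite nE !mulr_gt0 ?invr_gt0//; clear -a0 A01; lra.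
have a20 : 0 < (a + 2)^-1 by rewrite invr_gt0; clear -a0; lra.
have D0 : 0 < D by rewrite DE powR_gt0.
have A00 : 0 < A0 by clear -A01; lra.
pose q := (a + 2 - 1) / (a + 2) * pM.
have q0 : 0 < q by rewrite mulr_gt0 ?divr_gt0//; clear -a0; lra.
have qM : q <= pM by rewrite ler_piMl ?(ltW pM0)// ler_pdivrMr; clear -a0; lra.
pose c := q `^ (a + 2 - 1)^-1.
have c_gt0 : 0 < c by exact: powR_gt0.
have ca : c `^ a <= pM + 1.
  rewrite /c -powRrM; apply: (@le_trans _ _ (q + 1)); last by rewrite lerD2r.
  apply: powR_le_add1; first exact: ltW.
  rewrite mulrC divr_ge0 ?(ltW a0)//=; last by clear -a0; lra.
  by rewrite ler_pdivrMr; clear -a0; lra.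
have mol k := mollify_bounds (proj1 (meta k)) (proj2 (meta k)) (ltW c_gt0) ig
   (initial_density_bound m2 pM0 g0 gp).
have vcont : {for c, continuous (fun s => s `^ a)}.
  apply: differentiable_continuous; apply/derivable1_diffP.
  by case: (is_derive_powR a c_gt0).
(* If [0 < s^a <= v0], then [s^a <= 1] and [D s^(-a) >= 2 A0 + 1], so [Phi s <= - 2 A0]. The initial
   barrier never goes below that value, as [c0 <= 1]. *)
pose v0 := Num.min 1 (D / (2 * A0 + 1)).
have v00 : 0 < v0 by rewrite lt_min ltr01 divr_gt0//; clear -A00; lra.
have [d2 /= d20 Hd2] : exists2 d2 : R, 0 < d2 & forall s, `|c - s| < d2 -> s `^ a < c `^ a + 1.
  have /= [d2 d20 Hd] := cvgr_lt _ vcont (c `^ a + 1) (ltr_pwDr ltr01 (lexx _)).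
  by exists d2.
have [k0 Hk0] : exists k0 : nat, forall k, (k0 <= k)%N ->
    [/\ e k < de, e k < d2 & e k < v0 `^ a^-1].
  have e1 : \forall k \near \oo, e k < de by exact: (cvgr_lt _ ecvg).
  have e2 : \forall k \near \oo, e k < d2 by exact: (cvgr_lt _ ecvg).
  have e3 : \forall k \near \oo, e k < v0 `^ a^-1.
    by apply: (cvgr_lt _ ecvg); exact: powR_gt0.
  have [k0 _ H] := filterI e1 (filterI e2 e3).
  by exists k0 => k kk; have [h1 [h2 h3]] := H k kk; split.
have init k : (k0 <= k)%N ->
    forall x, Phi a D (r k x) <= barrier A0 om (L / 2) c0 lam n (x, 0).
  move=> kk x; have [e1 e2 e3] := Hk0 k kk.
  have [ek0 _] := meta k.
  have [_ /(_ x) [rge rm]] := rk k.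
  have rkx0 : 0 < r k x by apply: lt_le_trans rge; rewrite invr_gt0 ltr0n.
  have rle : r k x <= mollify (eta k) g x + e k.
    by move: rm; rewrite ler_distl => /andP[_]; clear; lra.
  have Brx : barrier A0 om (L / 2) c0 lam n (x, 0) = A0 * (cos (om * (x - L / 2)) - c0).
    by rewrite /barrier /level/= mulr0 addr0 ln1 mulr0 subr0 divr1.
  rewrite Brx.
  have [xin|xout] := boolP (- de <= x <= L + de).
    have rc : r k x <= c + e k by apply: (le_trans rle); rewrite lerD2r; exact: (mol k).1.
    have ra : r k x `^ a <= (c + e k) `^ a.
      by apply: ge0_ler_powR; rewrite ?nnegrE ?(ltW a0) ?(ltW rkx0) ?addr_ge0 ?(ltW c_gt0) ?(ltW ek0).
    have ra2 : (c + e k) `^ a < c `^ a + 1.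
      by apply: Hd2; rewrite opprD addNKr normrN gtr0_norm.
    have Pr : Phi a D (r k x) <= r k x `^ a.
      by rewrite /Phi gerBl mulr_ge0 ?powR_ge0// ltW.
    have : A0 * c0 <= A0 * (cos (om * (x - L / 2)) - c0).
      by rewrite ler_wpM2l ?(ltW A00)//; have := cosde x xin; clear; lra.
    by move: Pr ra ra2 A0c ca; clear; lra.
  have re : r k x <= e k.
    have xo : x <= - e k \/ L + e k <= x.
      move: xout; rewrite negb_and -!ltNge => /orP[xx|xx]; [left|right]; clear -xx ek0 e1; lra.
    by have := (mol k).2 x xo; clear -rle; lra.
  have vv : r k x `^ a <= v0.
    have -> : v0 = (v0 `^ a^-1) `^ a.
      by rewrite -powRrM mulVf ?gt_eqF// powRr1// ltW.
    apply: ge0_ler_powR; rewrite ?nnegrE ?powR_ge0 ?(ltW a0) ?(ltW rkx0)//.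
    by apply: (le_trans re); exact: ltW.
  have rka : 0 < r k x `^ a by exact: powR_gt0.
  have v1 : r k x `^ a <= 1 by apply: (le_trans vv); rewrite ge_min lexx.
  have v2 : 2 * A0 + 1 <= D * r k x `^ (- a).
    rewrite powRN ler_pdivlMr// mulrC -ler_pdivlMr; last by clear -A00; lra.
    by apply: (le_trans vv); rewrite ge_min lexx orbT.
  have : A0 * - 2 <= A0 * (cos (om * (x - L / 2)) - c0).
    by rewrite ler_wpM2l ?(ltW A00)//; have := cos_geN1 (om * (x - L / 2)); clear -c01; lra.
  by rewrite /Phi; move: v1 v2; clear; lra.
have ubd k z : (k0 <= k)%N -> 0 < z.2 <= T ->
    0 <= u k z /\ u k z <= (A0 / (1 + n * z.2) + (a + 2)^-1 `^ a) `^ a^-1.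
  case: z => x t /= kk /andP[t0 tT].
  have [upos _ _ _ _] := usol k.
  have up : 0 < u k (x, t) by apply: upos => /=; exact: ltW.
  split; first exact: ltW.
  have tT' : 0 <= t <= T by rewrite (ltW t0).
  have := @classical_le_barrier _ f a K om D A0 T n lam c0 (L / 2) (r k) (u k)
     a2 K0 omK DE A01 c00 nE lamE clev r1 r2 fK (usol k) (init k kk) x t tT'.
  have nt : 0 <= n * t by rewrite mulr_ge0// ltW.
  have tau0 : 0 < 1 + n * t by clear -nt; lra.
  have q1 : 0 < A0 / (1 + n * t) by rewrite divr_gt0.
  have Bb : barrier A0 om (L / 2) c0 lam n (x, t) <= A0 / (1 + n * t).
    rewrite /barrier/= ler_piMr ?(ltW q1)//.
    have /andP[] : c0 / 2 <= level c0 lam n t <= c0 by exact: clev.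
    by move=> lv _; have cs := cos_le1 (om * (x - L / 2)); clear -lv c00 cs; lra.
  move=> /le_trans /(_ Bb); rewrite DE => /(powR_le_of_Phi_le a20 up (ltW q1)) H.
  have -> : u k (x, t) = (u k (x, t) `^ a) `^ a^-1.
    by rewrite -powRrM divff ?gt_eqF// powRr1// ltW.
  apply: ge0_ler_powR; rewrite ?nnegrE ?powR_ge0 ?invr_ge0 ?(ltW a0)//.
  by rewrite addr_ge0 ?powR_ge0 ?(ltW q1).
apply: (aeW ucvg) => z cz zT.
have {}cz := cz (proj1 (andP zT)).
set b := A0 / (1 + n * z.2) + (a + 2)^-1 `^ a in ubd *.
have b0 : 0 <= b.
  rewrite addr_ge0 ?powR_ge0// divr_ge0 ?(ltW A00)// addr_ge0// mulr_ge0 ?(ltW n0)//.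
  by case/andP: zT => /ltW.
have rz0 : 0 <= rho z.
  rewrite -(cvg_lim (@Rhausdorff R) cz); apply: limr_ge; first exact: cvgP cz.
  by exists k0 => // k /= kk; exact: (ubd k z kk zT).1.
split=> //.
have rzb : rho z <= b `^ a^-1.
  rewrite -(cvg_lim (@Rhausdorff R) cz); apply: limr_le; first exact: cvgP cz.
  by exists k0 => // k /= kk; exact: (ubd k z kk zT).2.
have bE : b = (b `^ a^-1) `^ a.
  by rewrite -powRrM mulVf ?gt_eqF// powRr1.
rewrite [leRHS]bE.
by apply: ge0_ler_powR; rewrite ?nnegrE ?powR_ge0 ?(ltW a0).
Qed.

End SolutionBound.

(** * The smallness conditions hold for large exponents *)

Section LargeExponent.
Context {R : realType}.

(** Here [4^(-a) <= exp(-a) <= 4! / a^4]. A fourth power beats the quadratic growth in [m] of the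
    factor [n (1 + n T)]. *)
Lemma quarter_powR_le (a : R) : 0 < a -> 4^-1 `^ a <= 24 / a ^+ 4.
Proof.
move=> a0.
have e4 : (4^-1 : R) <= expR (-1).
  have h : (2^-1 : R) <= expR (- 2^-1).
    by apply: le_trans (expR_ge1Dx _); lra.
  have -> : (-1 : R) = - 2^-1 + - 2^-1 by lra.
  rewrite expRD; have -> : (4^-1 : R) = 2^-1 * 2^-1 by lra.
  by rewrite ler_pM// invr_ge0.
apply: (@le_trans _ _ (expR (-1) `^ a)).
  by apply: ge0_ler_powR; rewrite ?nnegrE ?invr_ge0 ?expR_ge0 ?(ltW a0).
rewrite /powR gt_eqF ?expR_gt0// expRK mulrN1 expRN ler_pdivlMr ?exprn_gt0//.
rewrite mulrC ler_pdivrMr ?expR_gt0// mulrC -ler_pdivrMr//.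
have := expR_ge1Dxn 3 (ltW a0).
have -> : ((4`!)%:R : R) = 24 by [].
by move=> H; apply: le_trans H; rewrite lerDr.
Qed.

Lemma ln_le_sqrt (x : R) : 0 < x -> ln x <= 2 * Num.sqrt x.
Proof.
move=> x0.
have s0 : 0 < Num.sqrt x by rewrite sqrtr_gt0.
rewrite -[in leLHS](sqr_sqrtr (ltW x0)) lnXn//.
by rewrite mulr_natl ler_wMn2r// ltW// ln_sublinear.
Qed.

(** The level drops by [lam / n * ln (1 + n * t)]. With [n] proportional to [m] and
    [ln x <= 2 sqrt x] this is of order [m^(-1/2)], and the lower bound on [m] makes it at most
    [c0 / 2]. *)
Lemma level_bounds (kap T lam c0 m t : R) : 0 < kap -> 0 < T -> 0 < lam -> 0 < c0 ->
  1 <= m -> (16 * lam * Num.sqrt (1 + kap * T / 4) / (kap * c0)) ^+ 2 <= m ->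
  0 <= t <= T -> c0 / 2 <= level c0 lam (kap * m / 4) t <= c0.
Proof.
move=> kap0 T0 lam0 c00 m1 mbig /andP[t0 tT].
have m0 : 0 < m by lra.
set n := kap * m / 4.
have n0 : 0 < n by rewrite /n !mulr_gt0 ?invr_gt0.
have nt : 0 <= n * t by rewrite mulr_ge0// ltW.
set s := Num.sqrt (1 + kap * T / 4) in mbig.
have kT : 0 < kap * T by rewrite mulr_gt0.
have s0 : 0 < s by rewrite sqrtr_gt0; lra.
have sm0 : 0 < Num.sqrt m by rewrite sqrtr_gt0.
have l0 : 0 <= ln (1 + n * t) by rewrite ln_ge0// lerDl.
have nT : 1 + n * t <= (1 + kap * T / 4) * m.
  have : n * t <= n * T by rewrite ler_wpM2l// ltW.
  have -> : n * T = kap * T / 4 * m by rewrite /n; lra.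
  lra.
have l1 : ln (1 + n * t) <= 2 * (s * Num.sqrt m).
  have p1 : 0 < 1 + n * t by lra.
  apply: (le_trans (ln_le_sqrt p1)); rewrite ler_wpM2l//.
  rewrite /s -sqrtrM; last by lra.
  exact: ler_wsqrtr.
have q0 : 0 <= 16 * lam * s / (kap * c0).
  by rewrite divr_ge0 ?mulr_ge0 ?(ltW lam0) ?(ltW s0) ?(ltW kap0) ?(ltW c00).
have sm : 16 * lam * s / (kap * c0) <= Num.sqrt m.
  have <- : Num.sqrt ((16 * lam * s / (kap * c0)) ^+ 2) = 16 * lam * s / (kap * c0).
    by rewrite sqrtr_sqr ger0_norm.
  exact: ler_wsqrtr.
have key : lam / n * (2 * (s * Num.sqrt m)) <= c0 / 2.
  have -> : lam / n * (2 * (s * Num.sqrt m)) = 8 * lam * s / kap * (Num.sqrt m / m).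
    by rewrite /n; field; rewrite !gt_eqF.
  have -> : Num.sqrt m / m = (Num.sqrt m)^-1.
    by rewrite -[X in _ / X](sqr_sqrtr (ltW m0)); field; rewrite gt_eqF.
  rewrite ler_pdivrMr//.
  have -> : 8 * lam * s / kap = c0 / 2 * (16 * lam * s / (kap * c0)).
    by field; rewrite !gt_eqF.
  by rewrite ler_wpM2l// divr_ge0 ?(ltW c00).
have ln0 : 0 <= lam / n by rewrite divr_ge0 ?(ltW lam0) ?(ltW n0).
have h1 : lam / n * ln (1 + n * t) <= lam / n * (2 * (s * Num.sqrt m)).
  by rewrite ler_wpM2l.
have h2 : 0 <= lam / n * ln (1 + n * t) by rewrite mulr_ge0.
by rewrite /level; apply/andP; split; move: h1 h2 key; clear; lra.
Qed.

Lemma large_exponent (K A0 kap T lam c0 : R) :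
  0 < K -> 0 < A0 -> 0 < kap -> 0 < T -> 0 < lam -> 0 < c0 ->
  exists m0 : R, 4 <= m0 /\ forall m, m0 <= m ->
    [/\ forall t, 0 <= t <= T -> c0 / 2 <= level c0 lam (kap * m / 4) t <= c0,
     2 * K * m * (A0 + 2) * m^-1 `^ (2 * (m - 2)) * (1 + kap * m / 4 * T) ^+ 2 <= 1 &
     kap * m / 4 * 4^-1 `^ (m - 2) * (1 + kap * m / 4 * T) <= 1].
Proof.
move=> K0 A00 kap0 T0 lam0 c00.
set b := 1 + kap * T / 4.
have kT : 0 < kap * T by rewrite mulr_gt0.
have b0 : 0 < b by rewrite /b; lra.
pose c1 := (16 * lam * Num.sqrt (1 + kap * T / 4) / (kap * c0)) ^+ 2.
pose c2 := 2 * K * (A0 + 2) * b ^+ 2.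
pose c3 := kap * b * 96.
exists (Num.max 4 (Num.max c1 (Num.max c2 c3))).
split; first by rewrite le_max lexx.
move=> m; rewrite !ge_max => /and4P[m4 mc1 mc2 mc3].
have m0 : 0 < m by lra.
have nT : 1 + kap * m / 4 * T <= b * m by rewrite /b; lra.
have nT0 : 0 <= 1 + kap * m / 4 * T.
  have : 0 <= kap * m / 4 * T by rewrite !mulr_ge0 ?invr_ge0 ?ltW.
  lra.
split.
- by move=> t; apply: level_bounds => //; lra.
(* [m >= 4] makes the exponent [2 (m - 2)] at least [4], enough against the cubic growth of the
   other factors. *)
- have D4 : m^-1 `^ (2 * (m - 2)) <= m^-1 ^+ 4.
    rewrite -powR_mulrn ?invr_ge0 ?(ltW m0)//.
    apply: ger_powR; last lra.
    by rewrite invr_gt0 m0 invf_le1//; lra.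
  have D0 : 0 <= m^-1 `^ (2 * (m - 2)) by exact: powR_ge0.
  have KA : 0 <= 2 * K * m * (A0 + 2).
    by rewrite !mulr_ge0 ?(ltW K0) ?(ltW m0)//; lra.
  apply: (@le_trans _ _ (2 * K * m * (A0 + 2) * m^-1 ^+ 4 * (b * m) ^+ 2)).
    apply: ler_pM; [exact: mulr_ge0|exact: sqr_ge0| |].
      exact: ler_wpM2l.
    by apply: lerXn2r; rewrite ?nnegrE// mulr_ge0 ?ltW.
  have -> : 2 * K * m * (A0 + 2) * m^-1 ^+ 4 * (b * m) ^+ 2 = c2 / m.
    by rewrite /c2; field; rewrite gt_eqF.
  by rewrite ler_pdivrMr// mul1r.
- have m2 : 0 < m - 2 by lra.
  have Q := quarter_powR_le m2.
  have mm : 24 / (m - 2) ^+ 4 <= 384 / m ^+ 4.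
    rewrite ler_pdivrMr ?exprn_gt0// mulrAC ler_pdivlMr ?exprn_gt0//.
    have : m ^+ 4 <= (2 * (m - 2)) ^+ 4.
      by apply: lerXn2r; rewrite ?nnegrE; lra.
    have -> : (2 * (m - 2)) ^+ 4 = 16 * (m - 2) ^+ 4 by ring.
    by clear; lra.
  have {}Q := le_trans Q mm.
  have k4 : 0 <= kap * m / 4 by rewrite !mulr_ge0 ?invr_ge0 ?ltW.
  apply: (@le_trans _ _ (kap * m / 4 * (384 / m ^+ 4) * (b * m))).
    apply: ler_pM => //; first by rewrite mulr_ge0// powR_ge0.
    exact: ler_wpM2l.
  have -> : kap * m / 4 * (384 / m ^+ 4) * (b * m) = c3 / m / m.
    by rewrite /c3; field; rewrite gt_eqF.
  rewrite ler_pdivrMr// mul1r ler_pdivrMr//.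
  apply: (le_trans mc3); rewrite ler_peMl ?(ltW m0)//; lra.
Qed.

End LargeExponent.

(** * Choice of the constants and decay of the pressure *)

Section VanishingPressure.
Context {R : realType}.

Lemma reaction_le_maxK (f : R -> R) (pM : R) :
  [lipschitz f p | p in `[0, +oo[] -> 0 < pM -> bistable f pM \/ monostable f pM ->
  0 < maxK f /\ forall p, 0 < p -> f p <= maxK f * p.
Proof.
move=> fL pM0 fr; have [_ ub] := growth_ratios_has_sup fL pM0 fr.
have le p : 0 < p -> f p / p <= maxK f.
  by move=> p0; apply: (ub_le_sup ub); exists p.
split; last by move=> p p0; rewrite -ler_pdivrMr// le.
have [p p0 fp] : exists2 p, 0 < p & 0 < f p.
  case: fr => [[al [/andP[al0 alM] pos _]]|[_ pos _]].
    exists ((al + pM) / 2); first lra.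
    by apply: pos; apply/andP; split; lra.
  exists (pM / 2); first lra.
  by apply: pos; apply/andP; split; lra.
by apply: lt_le_trans (le p p0); rewrite divr_gt0.
Qed.

(** The bound on the length enters here: [om * L / 2 < pi / 2], and this survives an enlargement of
    the interval on both sides by [de], a quarter of the gap [pi / om - L]. The number [al] is the
    phase at the enlarged ends, and [c0] is half of its cosine. *)
Lemma cos_lower_bound (om L : R) : 0 < om -> 0 <= L -> L < pi / om ->
  exists de c0 : R, [/\ 0 < de, 0 < c0 <= 1 &
    forall x, - de <= x <= L + de -> 2 * c0 <= cos (om * (x - L / 2))].
Proof.
move=> om0 L0 Lpi.
have pi0 : 0 < (pi : R) by exact: pi_gt0.
pose al := om * (L / 4 + pi / om / 4).
have alE : al = om * L / 4 + pi / 4 by rewrite /al; field; rewrite gt_eqF.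
have omL : om * L < pi by rewrite mulrC -ltr_pdivlMr.
have omL0 : 0 <= om * L by rewrite mulr_ge0// ltW.
have cal : 0 < cos al by apply: cos_gt0_pihalf; rewrite alE; apply/andP; split; lra.
exists ((pi / om - L) / 4), (cos al / 2); split.
- lra.
- by have := cos_le1 al; lra.
move=> x /andP[x1 x2]; rewrite mulrC divfK//.
rewrite -(cos_norm (om * _)).
have xl : `|om * (x - L / 2)| <= al.
  rewrite normrM (gtr0_norm om0) /al ler_wpM2l ?(ltW om0)// ler_norml.
  by apply/andP; split; lra.
have [->//|ne] := eqVneq `|om * (x - L / 2)| al.
apply: ltW; rewrite ltr_cos.
- by rewrite lt_neqAle ne.
- rewrite in_itv/= normr_ge0 /=; apply: (le_trans xl); rewrite alE; lra.
- by rewrite in_itv/= alE; apply/andP; split; lra.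
Qed.

(** The order of the choices avoids a circle: [c0] comes from the geometry, [A0] from [c0] and [pM],
    [lam] and [kap] from [A0]; only the threshold on [m] is adapted to [T]. *)
Lemma vanishing_pressure (f : R -> R) (pM L : R) (rho_in : R -> R -> R)
    (rho : R -> R * R -> R) :
  [lipschitz f p | p in `[0, +oo[] -> 0 < pM -> bistable f pM \/ monostable f pM ->
  L < Lstar f ->
  (forall m, 1 < m -> {ae leb, forall x, 0 <= rho_in m x}) ->
  (forall m, 1 < m -> L1 leb setT (rho_in m)) ->
  (forall m, 1 < m -> {ae leb, forall x, pressure m (rho_in m x) <= pM * \1_(`]0, L[) x}) ->
  (forall m, 1 < m -> limit_of_positive_solutions f m (rho_in m) (rho m)) ->
  exists C ka : R, [/\ 0 < C, 0 < ka & forall T, 0 < T -> exists m0, forall m, m0 <= m ->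
    {ae leb2, forall z, 0 < z.2 <= T -> 0 <= rho m z <= C /\
       pressure m (rho m z) <= C * ((1 + ka * m * z.2)^-1 + m^-1)}].
Proof.
move=> fL pM0 fr LL g0 ig gp sol.
have [K0 fK] := reaction_le_maxK fL pM0 fr.
set K := maxK f in K0 fK.
pose om := Num.sqrt K.
have om0 : 0 < om by rewrite sqrtr_gt0.
have omK : om ^+ 2 = K by rewrite sqr_sqrtr// ltW.
(* [L] may be negative, where the cosine bound does not apply; the interval is then empty, and
   enlarging it preserves the hypothesis on the data. *)
pose L' := Num.max 0 L.
have L'0 : 0 <= L' by rewrite le_max lexx.
have L'pi : L' < pi / om.
  by rewrite gt_max LL andbT divr_gt0// pi_gt0.
have [de [c0 [de0 c01 cosde]]] := cos_lower_bound om0 L'0 L'pi.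
have c00 : 0 < c0 by case/andP: c01.
pose A0 := (pM + 2) / c0.
have A0c : A0 * c0 = pM + 2 by rewrite /A0 divfK// gt_eqF.
have A01 : 1 <= A0.
  rewrite /A0 ler_pdivlMr// mul1r; case/andP: c01 => _ c1; lra.
have A00 : 0 < A0 by lra.
have A10 : 0 < A0 + 1 by lra.
pose lam := (8 * (A0 + 3) * A0 ^+ 2 * K + 2) / A0.
have lamE : A0 * lam = 8 * (A0 + 3) * A0 ^+ 2 * K + 2.
  by rewrite /lam mulrC divfK// gt_eqF.
have lam0 : 0 < lam.
  have A3 : 0 <= 8 * (A0 + 3) by lra.
  have B0 : 0 <= 8 * (A0 + 3) * A0 ^+ 2 * K.
    exact (mulr_ge0 (mulr_ge0 A3 (sqr_ge0 A0)) (ltW K0)).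
  by rewrite divr_gt0// ltr_wpDl.
pose kap := K * A0 * c0 / 2.
have kap0 : 0 < kap by rewrite /kap divr_gt0 //; exact (mulr_gt0 (mulr_gt0 K0 A00) c00).
(* The pressure is [m / (m - 1) <= 2] times the density, at most [A0 + 1], times
   [rho^a <= A0 / (1 + n t) + 1 / m]. The rate is [n / m = kap / 4]. *)
exists (2 * (A0 + 1) ^+ 2), (kap / 4); split.
- by rewrite mulr_gt0 // exprn_gt0.
- by rewrite divr_gt0.
move=> T T0.
have [m0 [m04 Hm0]] := large_exponent K0 A00 kap0 T0 lam0 c00.
exists m0 => m mm0; have m4 : 4 <= m by exact: le_trans mm0.
have m1 : 1 < m by clear -m4; lra.
have [clev r1 r2] := Hm0 m mm0.
pose a := m - 2.
have am : m = a + 2 by rewrite /a subrK.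
have a2 : 2 <= a by rewrite /a; clear -m4; lra.
have a0 : 0 < a by clear -a2; lra.
have gp' : {ae leb, forall x, pressure (a + 2) (rho_in m x) <= pM * \1_(`]0, L'[) x}.
  rewrite -am; apply: (aeW (gp m m1)) => x /le_trans; apply.
  rewrite ler_wpM2l ?(ltW pM0)// !indicE ler_nat.
  case: (boolP (x \in `]0, L[%classic)) => //.
  rewrite inE/= in_itv/= => /andP[x0 xL].
  suff -> : (x \in `]0, L'[%classic) = true by [].
  by apply/mem_set; rewrite /= in_itv/= x0 /= lt_max xL orbT.
have solm : limit_of_positive_solutions f (a + 2) (rho_in m) (rho m).
  by rewrite -am; exact: sol.
have nE : kap * m / 4 = K * A0 * c0 / 2 * (a + 2) / 4 by rewrite -am.
have r1' : 2 * K * (a + 2) * (A0 + 2) * (a + 2)^-1 `^ (2 * a)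
    * (1 + kap * m / 4 * T) ^+ 2 <= 1 by rewrite -am.
have := @ae_solution_bound R f a K om _ A0 T (kap * m / 4) lam c0 L' de pM (rho_in m) (rho m)
  a2 K0 omK erefl A01 c01 nE lamE clev r1' r2 fK de0 cosde pM0.
rewrite A0c => /(_ (lexx _) (g0 m m1) (ig m m1) gp' solm) H.
apply: (aeW H) => z Hz zT; have [rz0 rza] := Hz zT.
have z0 : 0 <= z.2 by case/andP: zT => /ltW.
have m0' : 0 < m by exact: lt_trans m1.
have tE : kap * m / 4 * z.2 = kap / 4 * m * z.2 by ring.
rewrite tE -am in rza.
have nz : 0 <= kap / 4 * m * z.2.
  by rewrite mulr_ge0// mulr_ge0 ?(ltW m0')// divr_ge0 ?(ltW kap0).
have va' : a = m - 2 by [].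
clear Hz H gp' solm nE r1' r1 r2 clev tE.
move: (kap / 4 * m * z.2) a nz am a2 a0 rza va' rz0.
move: (rho m z) => r tt a nz am a2 a0 rza aE r0.
have q0 : 0 < (1 + tt)^-1 by rewrite invr_gt0 ltr_wpDr.
have q1 : (1 + tt)^-1 <= 1 by rewrite invf_le1 ?ltr_wpDr// lerDl.
have mi0 : 0 < m^-1 by rewrite invr_gt0.
have mi1 : m^-1 <= 1 by rewrite invf_le1// ltW.
move: rza; rewrite -[A0 / (1 + tt)]/(A0 * (1 + tt)^-1).
move: (1 + tt)^-1 q0 q1 => q q0 q1 rza.
have mia : m^-1 `^ a <= m^-1.
  by apply: ge1r_powR; [rewrite mi0|clear -a2; lra].
have va : r `^ a <= A0 * q + m^-1 by clear -rza mia; lra.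
have Aq : A0 * q <= A0 by rewrite ler_piMr// ltW.
have rA : r <= A0 + 1.
  have [r1z|r1z] := leP r 1; first by clear -r1z A00; lra.
  have a1 : 1 <= a by clear -a2; lra.
  have := le1r_powR (ltW r1z) a1.
  by clear -va Aq mi1; lra.
have mm1 : m / (m - 1) <= 2.
  by rewrite ler_pdivrMr; clear -m4; lra.
have mm10 : 0 <= m / (m - 1) by rewrite divr_ge0; clear -m4; lra.
have A1' : A0 + 1 <= (A0 + 1) * (A0 + 1).
  by rewrite ler_peMl ?(ltW A10)//; clear -A00; lra.
split.
  by rewrite r0 /= (le_trans rA)// expr2; clear -A1' A10; lra.
rewrite /pressure.
have -> : r `^ (m - 1) = r * r `^ a.
  rewrite -(mulr_powRB1 r0); last by clear -m4; lra.
  by congr (_ * _ `^ _); rewrite aE; clear; lra.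
have s1 : r * r `^ a <= (A0 + 1) * ((A0 + 1) * (q + m^-1)).
  apply: ler_pM => //; first exact: powR_ge0.
  have : 0 <= A0 * m^-1 by rewrite mulr_ge0 ?(ltW mi0) ?(ltW A00).
  by clear -va q0; lra.
have s0 : 0 <= r * r `^ a by rewrite mulr_ge0 ?powR_ge0.
have -> : 2 * (A0 + 1) ^+ 2 * (q + m^-1) = 2 * ((A0 + 1) * ((A0 + 1) * (q + m^-1))).
  by ring.
exact: ler_pM.
Qed.

End VanishingPressure.

(** * Weak-* limits *)

Section DominatedRintegral.
Context d (T : measurableType d) (R : realType) (mu : {measure set T -> \bar R}).
Implicit Types (D B : set T) (f g h l : T -> R).

Lemma Rintegral_ae_eq D f g : measurable D -> measurable_fun D f -> measurable_fun D g ->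
  {ae mu, forall z, D z -> f z = g z} -> Rintegral mu D f = Rintegral mu D g.
Proof.
move=> mD mf mg fg; congr fine; apply: ae_eq_integral => //.
- exact/measurable_EFinP.
- exact/measurable_EFinP.
- by apply: (aeW fg) => z H Dz /=; rewrite H.
Qed.

Lemma ae_integrable_le D f g : measurable D -> measurable_fun D f ->
  mu.-integrable D (EFin \o g) -> {ae mu, forall z, D z -> `|f z| <= g z} ->
  mu.-integrable D (EFin \o f).
Proof.
move=> mD mf ig fg.
have mg : measurable_fun D g by apply/measurable_EFinP; case/integrableP: ig.
apply/integrableP; split; first exact/measurable_EFinP.
have /integrableP[_ igoo] := ig.
apply: le_lt_trans igoo; apply: ae_ge0_le_integral => //=.
- by apply: measurableT_comp => //; apply: measurableT_comp.
- by apply: measurableT_comp => //; apply: measurableT_comp.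
- apply: (aeW fg) => z H Dz; rewrite lee_fin (le_trans (H Dz))//.
  exact: ler_norm.
Qed.

(** Domination is asked only from an index [N] on, because the bounds on the solutions hold for
    large exponents. *)
Lemma Rintegral_dominated D (h : nat -> T -> R) l g N : measurable D ->
  (forall n, measurable_fun D (h n)) -> measurable_fun D l ->
  {ae mu, forall z, D z -> h n z @[n --> \oo] --> l z} ->
  mu.-integrable D (EFin \o g) ->
  (forall n, (N <= n)%N -> {ae mu, forall z, D z -> `|h n z| <= g z}) ->
  Rintegral mu D (h n) @[n --> \oo] --> Rintegral mu D l.
Proof.
move=> mD mh ml hl ig hg.
rewrite -(cvg_shiftn N).
have ae1 : {ae mu, forall x, D x -> (fun n => ((h (n + N)%N x)%:E)) @ \oo --> (l x)%:E}.
  apply: (aeW hl) => z H Dz; apply: cvg_EFin; first by apply: nearW.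
  move: (H Dz); rewrite -(cvg_shiftn N) => H'.
  exact: H'.
have ae2 : {ae mu, forall x n, D x -> (`|((h (n + N)%N x)%:E)| <= (g x)%:E)%E}.
  have := ae_forall (fun n => hg (n + N)%N (leq_addl _ _)).
  by move=> H; apply: (aeW H) => z Hz n Dz; rewrite lee_fin; exact: Hz.
have mh' n : measurable_fun D (fun x => (h (n + N)%N x)%:E) by exact/measurable_EFinP.
have ml' : measurable_fun D (fun x => (l x)%:E) by exact/measurable_EFinP.
have [il _ cv] := dominated_convergence mD mh' ml' ae1 ig ae2.
have fl := integrable_fin_num mD il.
by have := fine_cvg (cvg_trans cv _ : _ --> (fine (\int[mu]_(x in D) (l x)%:E)%E)%:E); rewrite fineK//; apply.
Qed.

Lemma Rintegral_ge0_eq0 D f : measurable D -> mu.-integrable D (EFin \o f) ->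
  (forall z, D z -> 0 <= f z) -> Rintegral mu D f = 0 ->
  {ae mu, forall z, D z -> f z = 0}.
Proof.
move=> mD fi f0 If.
have mf : measurable_fun D (EFin \o f) by case/integrableP: fi.
have fin := integrable_fin_num mD fi.
have I0 : (\int[mu]_(x in D) `|(EFin \o f) x| = 0)%E.
  rewrite (eq_integral (EFin \o f)); first by rewrite -(fineK fin) -[fine _]/(Rintegral mu D f) If.
  by move=> z; rewrite inE => Dz /=; rewrite ger0_norm// f0.
have /(_ I0) H := (ae_eq_integral_abs mu mD mf).1.
by apply: (aeW H) => z Hz Dz; have /= := Hz Dz; case.
Qed.

Lemma integrable_cst_indic D B (c : R) : measurable D -> measurable B -> (mu B < +oo)%E ->
  mu.-integrable D (EFin \o (fun z => c * \1_B z)).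
Proof.
move=> mD mB Boo; apply: (@integrableS _ _ _ _ setT) => //.
have -> : EFin \o (fun z => c * \1_B z) = (EFin \o (fun=> c)) \_ B.
  apply/funext => z; rewrite /= patchE indicE; case: ifPn => _; by rewrite ?mulr1 ?mulr0.
have [+ _] := @integrable_mkcond _ _ _ mu B (EFin \o (fun=> c)) mB; apply.
apply: measurable_bounded_integrable => //.
by exists `|c|; split; [exact: num_real|move=> y cy z _ /=; exact: ltW].
Qed.

(** The test function is [v] itself, cut off to [B]: the integrals tend to zero by dominated
    convergence, and to the integral of [v^2] over the part of [B] in [D] by weak convergence. *)
Lemma weak_star_null D (u : nat -> T -> R) (v : T -> R) B (C : R) (N : nat) :
  measurable D -> measurable B -> (mu B < +oo)%E -> weak_star_cvg mu D u v ->
  (forall n, (N <= n)%N -> {ae mu, forall z, D z -> B z -> `|u n z| <= C}) ->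
  {ae mu, forall z, D z -> B z -> u n z @[n --> \oo] --> (0 : R)} ->
  {ae mu, forall z, D z -> B z -> v z = 0}.
Proof.
move=> mD mB Boo [uL [mv [M vM]] uv] uC u0.
pose g z := v z * \1_B z.
have mg : measurable_fun D g by apply: measurable_funM => //; exact: measurable_indic.
have gM : {ae mu, forall z, D z -> `|g z| <= `|M| * \1_B z}.
  apply: (aeW vM) => z H Dz; rewrite /g normrM (ger0_norm (_ : 0 <= \1_B z)).
    by rewrite ler_wpM2r// (le_trans (H Dz))// ler_norm.
  by rewrite indicE.
have ig : L1 mu D g.
  exact: (ae_integrable_le mD mg (integrable_cst_indic _ mD mB Boo) gM).
have c1 := uv g ig.
have c2 : Rintegral mu D (fun z => u n z * g z) @[n --> \oo] --> Rintegral mu D (fun=> 0).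
  apply: (@Rintegral_dominated D _ (fun=> 0) (fun z => (`|C| * `|M|) * \1_B z) N) => //.
  - by move=> n; apply: measurable_funM => //; have [] := uL n.
  - apply: (aeW u0) => z H Dz.
    have [Bz|Bz] := pselect (B z).
      rewrite -[X in _ --> X](mul0r (g z)).
      by apply: cvgM; [exact: H|exact: cvg_cst].
    have -> : (fun n => u n z * g z) = fun=> 0.
      by apply/funext => n; rewrite /g indicE memNset// mulr0 mulr0.
    exact: cvg_cst.
  - exact: integrable_cst_indic.
  - move=> n nN; apply: (aeW (aeI (uC n nN) gM)) => z [H1 H2] Dz.
    rewrite normrM; have [Bz|Bz] := pselect (B z).
      rewrite -mulrA ler_pM//; last exact: H2.
      by rewrite (le_trans (H1 Dz Bz))// ler_norm.
    by rewrite /g indicE memNset// !mulr0 normr0 mulr0.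
have I0 : Rintegral mu D (fun z => v z * g z) = 0.
  have z0 : Rintegral mu D (fun=> 0) = 0 by rewrite /Rintegral integral0_eq.
  by rewrite z0 in c2; exact: cvg_unique c1 c2.
have vg : {ae mu, forall z, D z -> v z * g z = 0}.
  apply: Rintegral_ge0_eq0 => //.
  - have mvg : measurable_fun D (fun z => v z * g z) by exact: measurable_funM.
    apply: (ae_integrable_le mD mvg (integrable_cst_indic (`|M| * `|M|) mD mB Boo)).
    apply: (aeW (aeI vM gM)) => z [H1 H2] Dz; rewrite normrM -mulrA ler_pM//; last exact: H2.
    by rewrite (le_trans (H1 Dz))// ler_norm.
  - by move=> z _; rewrite /g mulrA mulr_ge0 ?indicE// -expr2 sqr_ge0.
apply: (aeW vg) => z H Dz Bz; move: (H Dz); rewrite /g indicE mem_set// mulr1.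
by move/eqP; rewrite mulf_eq0 orbb => /eqP.
Qed.

End DominatedRintegral.

(** * Density: from a generating pi-system to all integrable test functions *)

Section WeaklyNull.
Import HBSimple.
Context d (T : measurableType d) (R : realType) (mu : {measure set T -> \bar R}).
Implicit Types (f g h : T -> R) (A S : set T).

Definition null_against (u : nat -> T -> R) g : Prop := L1 mu setT g /\
  Rintegral mu setT (fun z => u n z * g z) @[n --> \oo] --> (0 : R).

Context (u : nat -> T -> R) (C : R).
Context (mu_ : forall n, measurable_fun setT (u n)).
Context (uC : forall n z, `|u n z| <= C).

Let C0 : 0 <= C.
Proof. by apply: le_trans (uC 0%N point). Qed.

Lemma L1_measurable g : L1 mu setT g -> measurable_fun setT g.
Proof. by move=> ig; apply/measurable_EFinP; case/integrableP: ig. Qed.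

Lemma L1_mul_bounded n g : L1 mu setT g -> L1 mu setT (fun z => u n z * g z).
Proof.
move=> ig; have mg := L1_measurable ig.
have iCg : mu.-integrable setT (EFin \o (fun z => C * `|g z|)).
  have -> : EFin \o (fun z => C * `|g z|) = (fun z => (C%:E * `|(g z)%:E|)%E) by [].
  by apply: integrableZl => //; exact: integrable_abse ig.
apply: (ae_integrable_le measurableT _ iCg); first exact: measurable_funM.
by apply: nearW => z _; rewrite normrM ler_wpM2r.
Qed.

Lemma L1_abs g : L1 mu setT g -> L1 mu setT (fun z => `|g z|).
Proof. exact: integrable_abse. Qed.

Lemma L1D f g : L1 mu setT f -> L1 mu setT g -> L1 mu setT (fun z => f z + g z).
Proof. by move=> fi gi; exact: integrableD fi gi. Qed.

Lemma L1B f g : L1 mu setT f -> L1 mu setT g -> L1 mu setT (fun z => f z - g z).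
Proof. by move=> fi gi; exact: integrableB fi gi. Qed.

Lemma L1Z c g : L1 mu setT g -> L1 mu setT (fun z => c * g z).
Proof. by move=> gi; exact: integrableZl gi. Qed.

Lemma null_against0 : null_against u (fun=> 0).
Proof.
split; first exact: integrable0.
have -> : (fun n => Rintegral mu setT (fun z => u n z * 0)) = fun=> 0.
  by apply/funext => n; rewrite /Rintegral integral0_eq// => z _; rewrite mulr0.
exact: cvg_cst.
Qed.

Lemma null_againstD f g : null_against u f -> null_against u g ->
  null_against u (fun z => f z + g z).
Proof.
move=> [fi f0] [gi g0]; split; first exact: L1D.
have -> : (fun n => Rintegral mu setT (fun z => u n z * (f z + g z))) =
    (fun n => Rintegral mu setT (fun z => u n z * f z) +
              Rintegral mu setT (fun z => u n z * g z)).
  apply/funext => n; rewrite -RintegralD//; last 2 first.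
    exact: L1_mul_bounded.
    exact: L1_mul_bounded.
  by congr Rintegral; apply/funext => z; rewrite mulrDr.
by rewrite -[X in _ --> X]addr0; exact: cvgD.
Qed.

Lemma null_againstZ c g : null_against u g -> null_against u (fun z => c * g z).
Proof.
move=> [gi g0]; split; first exact: L1Z.
have -> : (fun n => Rintegral mu setT (fun z => u n z * (c * g z))) =
    (fun n => c * Rintegral mu setT (fun z => u n z * g z)).
  apply/funext => n; rewrite -RintegralZl//; last exact: L1_mul_bounded.
  by congr Rintegral; apply/funext => z; rewrite mulrCA.
by rewrite -[X in _ --> X](mulr0 c); apply: cvgM => //; exact: cvg_cst.
Qed.

Lemma null_against_sum (I : Type) (s : seq I) (F : I -> T -> R) :
  (forall i, null_against u (F i)) -> null_against u (fun z => \sum_(i <- s) F i z).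
Proof.
move=> F0; elim: s => [|i s IH].
  have -> : (fun z => \sum_(i <- [::]) F i z) = fun=> 0.
    by apply/funext => z; rewrite big_nil.
  exact: null_against0.
have -> : (fun z => \sum_(i <- i :: s) F i z) = (fun z => F i z + \sum_(i <- s) F i z).
  by apply/funext => z; rewrite big_cons.
exact: null_againstD.
Qed.

(** Since [|u n| <= C], replacing [g] by [f j] changes the integral by at most [C] times their
    distance in mean, uniformly in [n]. *)
Lemma null_against_closed (f : nat -> T -> R) g : (forall j, null_against u (f j)) ->
  L1 mu setT g ->
  Rintegral mu setT (fun z => `|f j z - g z|) @[j --> \oo] --> (0 : R) ->
  null_against u g.
Proof.
move=> f0 gi fg; split=> //.
apply/cvgr0Pnorm_le => e e0.
have e2 : 0 < e / 2 by rewrite divr_gt0.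
have C1 : 0 < C + 1 by rewrite ltr_wpDl.
have e3 : 0 < e / 2 / (C + 1) by rewrite divr_gt0.
have [j _ Hj] := cvgr0_norm_le _ fg _ e3.
have {Hj} := Hj j (leqnn j).
have [fi fj0] := f0 j.
have ifg := L1B fi gi.
rewrite ger0_norm ?Rintegral_ge0// => Hj.
have [N _ HN] := cvgr0_norm_le _ fj0 _ e2.
exists N => // n /HN /= Hn.
have -> : Rintegral mu setT (fun z => u n z * g z) =
    Rintegral mu setT (fun z => u n z * f j z) -
    Rintegral mu setT (fun z => u n z * (f j z - g z)).
  rewrite -RintegralB//; last 2 first.
    exact: L1_mul_bounded.
    exact: L1_mul_bounded.
  by congr Rintegral; apply/funext => z; ring.
apply: (le_trans (ler_normB _ _)); rewrite [leRHS]splitr; apply: lerD => //.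
apply: (le_trans (le_normr_Rintegral _ _)) => //; first exact: L1_mul_bounded.
apply: (@le_trans _ _ (C * Rintegral mu setT (fun z => `|f j z - g z|))).
  rewrite -RintegralZl//; last exact: L1_abs.
  apply: le_Rintegral => //.
  - exact/L1_abs/L1_mul_bounded.
  - exact/L1Z/L1_abs.
  - by move=> z _; rewrite normrM ler_wpM2r.
apply: (@le_trans _ _ ((C + 1) * Rintegral mu setT (fun z => `|f j z - g z|))).
  by rewrite ler_wpM2r ?lerDl// Rintegral_ge0.
by rewrite mulrC -ler_pdivlMr.
Qed.

Lemma null_against_dominated (f : nat -> T -> R) g h : (forall j, null_against u (f j)) ->
  measurable_fun setT g -> L1 mu setT h ->
  {ae mu, forall z, f j z @[j --> \oo] --> g z} -> (forall j z, `|f j z| <= h z) ->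
  null_against u g.
Proof.
move=> f0 mg ih fg fh.
have gh : {ae mu, forall z, setT z -> `|g z| <= h z}.
  apply: (aeW fg) => z fgz _.
  have H : `|f j z| @[j --> \oo] --> `|g z| by apply: cvg_norm; exact: fgz.
  rewrite -(cvg_lim (@Rhausdorff R) H); apply: limr_le; first exact: cvgP H.
  by apply: nearW => j /=; exact: fh.
have ig : L1 mu setT g.
  exact: (ae_integrable_le measurableT mg ih gh).
apply: (null_against_closed f0 ig).
have z0 : Rintegral mu setT (fun=> 0) = 0 by rewrite /Rintegral integral0_eq.
rewrite -[X in _ --> X]z0.
apply: (@Rintegral_dominated _ _ _ mu setT _ (fun=> 0) (fun z => h z + h z) 0%N) => //.
- move=> n; apply: measurableT_comp => //; apply: measurable_funB => //.
  exact: L1_measurable (f0 n).1.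
- apply: (aeW fg) => z fgz _.
  rewrite -[X in _ --> X](normr0 R) -[X in `|X|](subrr (g z)).
  by apply: cvg_norm; apply: cvgB; [exact: fgz|exact: cvg_cst].
- exact: L1D.
- move=> n _; apply: (aeW gh) => z ghz _; rewrite normr_id.
  by apply: (le_trans (ler_normB _ _)); apply: lerD => //; exact: ghz.
Qed.

Lemma L1_indic A : measurable A -> (mu A < +oo)%E -> L1 mu setT (\1_A).
Proof.
move=> mA Aoo; have := integrable_cst_indic 1 measurableT mA Aoo.
by congr (mu.-integrable _ _); apply/funext => z /=; rewrite mul1r.
Qed.

Context (G : set (set T)) (E : nat -> set T).
Context (GI : setI_closed G) (Ggen : @measurable _ T = <<s G >>).
Context (Gfin : forall A, G A -> (mu A < +oo)%E) (EG : forall i, G (E i)).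
Context (Encr : forall z, exists i0, forall i, (i0 <= i)%N -> E i z).
Context (G0 : forall A, G A -> null_against u (\1_A)).

Lemma generator_measurable A : G A -> measurable A.
Proof. by move=> GA; rewrite Ggen; exact: sub_sigma_algebra. Qed.

(** Cutting by [E i], of finite measure, keeps all indicators integrable: complements become
    differences with [\1_(E i)], and countable disjoint unions are dominated limits of finite
    ones. *)
Lemma null_against_indic i S : measurable S -> null_against u (\1_(S `&` E i)).
Proof.
have mE : measurable (E i) by exact: generator_measurable.
have indicI A z : \1_(A `&` E i) z = \1_A z * \1_(E i) z :> R.
  by rewrite !indicE in_setI; case: (z \in A); case: (z \in E i); rewrite /= ?mulr1 ?mulr0.
have IE : L1 mu setT (\1_(E i)) by apply: L1_indic => //; exact: Gfin.
rewrite Ggen => mS; move: S mS.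
apply: (@dynkin_induction _ T G (fun S => null_against u (\1_(S `&` E i)))) => //.
- by rewrite setTI; exact: G0.
- by move=> A GA; apply: G0; exact: GI.
- move=> S mS SP.
  have -> : \1_(~` S `&` E i) = (fun z => \1_(E i) z + (-1) * \1_(S `&` E i) z) :> (T -> R).
    apply/funext => z; rewrite !indicI !indicE in_setC.
    by case: (z \in S); case: (z \in E i); rewrite /=; lra.
  by apply: null_againstD; [exact: G0|exact: null_againstZ].
- move=> F mF tF FP.
  pose W k := \big[setU/set0]_(j < k) F j.
  have mW k : measurable (W k) by apply: bigsetU_measurable => j _; exact: mF.
  have WP k : null_against u (\1_(W k `&` E i)).
    elim: k => [|k IH].
      have -> : \1_(W 0%N `&` E i) = (fun=> 0) :> (T -> R).
        by apply/funext => z; rewrite /W big_ord0 set0I indic0.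
      exact: null_against0.
    have -> : \1_(W k.+1 `&` E i) = (fun z => \1_(W k `&` E i) z + \1_(F k `&` E i) z) :> (T -> R).
      apply/funext => z; rewrite !indicI /W big_ord_recr/= -mulrDl; congr (_ * _).
      have disj : z \in \big[setU/set0]_(j < k) F j -> z \in F k -> False.
        rewrite !inE -bigcup_mkord => -[j /= jk Fjz] Fkz.
        have := tF j k I I (ex_intro _ z (conj Fjz Fkz)) => jE.
        by move: jk; rewrite jE ltnn.
      rewrite !indicE in_setU.
      move: disj; case: (z \in \big[setU/set0]_(j < k) F j); case: (z \in F k) => //= H;
        rewrite ?addr0 ?add0r//.
      by case: (H isT isT).
    exact: null_againstD.
  apply: (null_against_dominated WP _ IE).
  + apply: measurable_indic; apply: measurableI => //; exact: bigcup_measurable.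
  + apply: nearW => z.
    have [[k _ Fkz]|nF] := pselect ((\bigcup_k F k) z).
      apply: cvg_near_cst; exists k.+1 => // j /= kj.
      rewrite !indicI; congr (_ * _); rewrite !indicE !mem_set//; first by exists k.
      by rewrite /W -bigcup_mkord; exists k.
    apply: cvg_near_cst; exists 0%N => // j _.
    rewrite !indicI; congr (_ * _); rewrite !indicE !memNset//.
    by rewrite /W -bigcup_mkord => -[k _ Fkz]; apply: nF; exists k.
  + move=> k z; rewrite indicI normrM !ger0_norm ?indicE// ler_piMl//.
    by rewrite lern1 leq_b1.
Qed.

(* The generating pi-system reaches indicators by Dynkin's lemma, and these
   reach integrable functions because the [u n] are uniformly bounded. *)
Lemma null_against_integrable g : L1 mu setT g -> null_against u g.
Proof.
move=> ig; have mg := L1_measurable ig.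
have mE i : measurable (E i) by exact: generator_measurable.
have i1 z i : `|\1_(E i) z| <= 1 :> R by rewrite ger0_norm ?indicE// lern1 leq_b1.
suff cut i : null_against u (fun z => g z * \1_(E i) z).
  apply: (null_against_dominated cut mg (L1_abs ig)).
  - apply: nearW => z; have [i0 Hi0] := Encr z.
    apply: cvg_near_cst; exists i0 => // i /= ii; rewrite indicE mem_set ?mulr1//.
    exact: Hi0.
  - by move=> i z; rewrite normrM ler_piMr.
have igE : L1 mu setT (fun z => g z * \1_(E i) z).
  apply: (ae_integrable_le measurableT _ (L1_abs ig)).
    by apply: measurable_funM => //; exact: measurable_indic.
  by apply: nearW => z _; rewrite normrM ler_piMr.
have [s [si _ scv]] := approximation_sfun_integrable measurableT igE.
have sE j : null_against u (fun z => s j z * \1_(E i) z).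
  have [r rE] : exists r : seq R,
      forall z, s j z = \sum_(y <- r) (y * \1_(s j @^-1` [set y]) z).
    by eexists => z; rewrite [in LHS]fimfunE fsbig_finite.
  have -> : (fun z => s j z * \1_(E i) z) =
     (fun z => \sum_(y <- r) (y * \1_(s j @^-1` [set y] `&` E i) z)).
    apply/funext => z; rewrite rE mulr_suml.
    apply: eq_bigr => y _; rewrite -mulrA; congr (_ * _).
    rewrite !indicE in_setI.
    by case: (_ \in _); case: (_ \in _); rewrite /= ?mulr1 ?mulr0.
  apply: null_against_sum => y; apply: null_againstZ; apply: null_against_indic.
  by rewrite -[X in measurable X]setTI; exact: (measurable_funP (s j)).
apply: (null_against_closed sE igE).
have le0 j : 0 <= Rintegral mu setT (fun z => `|s j z * \1_(E i) z - g z * \1_(E i) z|)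
    <= fine (\int[mu]_z `|(g z * \1_(E i) z)%:E - (s j z)%:E|)%E.
  have ids : L1 mu setT (fun z => g z * \1_(E i) z - s j z).
    exact (L1B igE (si j)).
  have ism : L1 mu setT (fun z => s j z * \1_(E i) z - g z * \1_(E i) z).
    exact (L1B (sE j).1 igE).
  rewrite Rintegral_ge0//=.
  apply: (@le_Rintegral _ _ _ mu setT _ (fun z => `|g z * \1_(E i) z - s j z|)) => //.
  - exact: L1_abs.
  - exact: L1_abs.
  - move=> z _; rewrite indicE; case: (_ \in _); rewrite /= ?mulr1 ?mulr0.
      by rewrite distrC.
    by rewrite subrr normr0.
apply: (@squeeze_cvgr _ _ _ _ (fun=> 0) (fun j => fine (\int[mu]_z `|(g z * \1_(E i) z)%:E - (s j z)%:E|)%E)).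
- by apply: nearW => j.
- exact: cvg_cst.
- exact: (fine_cvg scv).
Qed.

End WeaklyNull.

(** * Rectangles that generate the product sigma-algebra *)

Section SpaceTimeMeasure.
Context {R : realType}.
Local Notation mR := (measurableTypeR R).
Implicit Types (a w : R -> R) (r : R * R -> R) (A B : set R).

Lemma leb2_rectangle (A B : set mR) : measurable A -> measurable B ->
  (leb2 (A `*` B) = lebesgue_measure A * lebesgue_measure B)%E.
Proof. by move=> mA mB; rewrite /leb2; exact: product_measure1E. Qed.

Lemma leb2_rectangle_fin (A B : set mR) : measurable A -> measurable B ->
  (lebesgue_measure A < +oo)%E -> (lebesgue_measure B < +oo)%E ->
  (leb2 (A `*` B) < +oo)%E.
Proof.
move=> mA mB Aoo Boo; rewrite leb2_rectangle//.
by apply: lte_mul_pinfty => //; rewrite ge0_fin_numE.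
Qed.

Lemma lebesgue_itv_fin (i : interval R) (x y : R) :
  [set` i] `<=` `[x, y]%classic -> (lebesgue_measure [set` i] < +oo)%E.
Proof.
move=> ixy; apply: (@le_lt_trans _ _ (lebesgue_measure `[x, y]%classic)).
  by apply: le_measure => //; rewrite inE; exact: measurable_itv.
by rewrite lebesgue_measure_itv; case: ifPn => _; rewrite ltry.
Qed.

Definition square (X : R) : set (mR * mR) := `[- X, X]%classic `*` `[- X, X]%classic.

Lemma measurable_square X : measurable (square X).
Proof. by apply: measurableX; exact: measurable_itv. Qed.

Lemma square_fin X : (leb2 (square X) < +oo)%E.
Proof.
pose J : set mR := `[- X, X]%classic.
have I : (lebesgue_measure J < +oo)%E by exact: (@lebesgue_itv_fin _ (- X) X).
by apply: leb2_rectangle_fin => //; exact: measurable_itv.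
Qed.

Lemma measurable_halfplane : measurable (halfplane : set (mR * mR)).
Proof.
have -> : halfplane = (setT : set mR) `*` (`]0, +oo[%classic : set mR).
  by apply/seteqP; split => -[x t] /=; rewrite in_itv/= andbT; tauto.
by apply: measurableX => //; exact: measurable_itv.
Qed.

Definition oc_rectangles : set (set (mR * mR)) :=
  [set A `*` B | A in (@ocitv R) & B in (@ocitv R)].

Lemma oc_rectangles_setI : setI_closed oc_rectangles.
Proof.
move=> _ _ [A mA [B mB <-]] [A' mA' [B' mB' <-]].
exists (A `&` A'); first exact: ocitvI.
by exists (B `&` B'); [exact: ocitvI|rewrite setXI].
Qed.

Lemma ocitv_exhaust : (setT : set R) = \bigcup_n `]- n%:R, n%:R]%classic.
Proof.
apply/esym/seteqP; split => // x _.
exists (Num.truncn `|x|).+1 => //=; rewrite in_itv/=.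
have := truncnS_gt `|x|; rewrite ltr_norml => /andP[-> /ltW ->] //.
Qed.

(** Cylinders over a Borel set are reached by exhausting the free factor with the intervals []-n,
    n]], and a measurable rectangle is the intersection of two cylinders. Half-open intervals are
    chosen because their rectangles have finite measure and are stable under intersection. *)
Lemma measurable_oc_rectangles :
  @measurable _ (mR * mR)%type = <<s oc_rectangles >>.
Proof.
rewrite eqEsubset; split; last first.
  apply: smallest_sub; first exact: sigma_algebra_measurable.
  by move=> _ [A mA [B mB <-]]; apply: measurableX; exact: sub_sigma_algebra.
rewrite measurable_prod_measurableType.
apply: smallest_sub; first exact: smallest_sigma_algebra.
have sig : sigma_algebra setT <<s oc_rectangles >> by exact: smallest_sigma_algebra.
have [s0 sC sU] := sig.
have sCo (S : set (mR * mR)) : <<s oc_rectangles >> S -> <<s oc_rectangles >> (~` S).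
  by move=> /sC; rewrite setTD.
have left A : @measurable _ mR A -> <<s oc_rectangles >> (A `*` (setT : set mR)).
  move: A; apply: smallest_sub; first split.
  - by rewrite set0X.
  - move=> A mA; rewrite setTD.
    have -> : ~` A `*` setT = ~` (A `*` (setT : set mR)) :> set (mR * mR).
      by apply/seteqP; split => -[x y] /=; tauto.
    exact: sCo.
  - move=> F mF.
    have -> : (\bigcup_k F k) `*` (setT : set mR) = \bigcup_k (F k `*` (setT : set mR)).
      apply/seteqP; split => -[x y] /=; first by move=> [[k _ Fk] _]; exists k.
      by move=> [k _ [Fk _]]; split => //; exists k.
    exact: sU.
  - move=> A mA.
    have -> : A `*` (setT : set mR) = \bigcup_n (A `*` (`]- n%:R, n%:R]%classic : set mR)).
      rewrite (ocitv_exhaust : (setT : set mR) = _).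
      apply/seteqP; split => -[x y] /=; first by move=> [Ax [n _ yn]]; exists n.
      by move=> [n _ [Ax yn]]; split => //; exists n.
    apply: sU => n; apply: sub_sigma_algebra; exists A => //.
    by exists `]- n%:R, n%:R]%classic => //; exact: is_ocitv.
have right A : @measurable _ mR A -> <<s oc_rectangles >> ((setT : set mR) `*` A).
  move: A; apply: smallest_sub; first split.
  - by rewrite setX0.
  - move=> A mA; rewrite setTD.
    have -> : setT `*` ~` A = ~` ((setT : set mR) `*` A) :> set (mR * mR).
      by apply/seteqP; split => -[x y] /=; tauto.
    exact: sCo.
  - move=> F mF.
    have -> : (setT : set mR) `*` (\bigcup_k F k) = \bigcup_k ((setT : set mR) `*` F k).
      apply/seteqP; split => -[x y] /=; first by move=> [_ [k _ Fk]]; exists k.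
      by move=> [k _ [_ Fk]]; split => //; exists k.
    exact: sU.
  - move=> A mA.
    have -> : (setT : set mR) `*` A = \bigcup_n ((`]- n%:R, n%:R]%classic : set mR) `*` A).
      rewrite (ocitv_exhaust : (setT : set mR) = _).
      apply/seteqP; split => -[x y] /=; first by move=> [[n _ yn] Ax]; exists n.
      by move=> [n _ [yn Ax]]; split => //; exists n.
    apply: sU => n; apply: sub_sigma_algebra; exists `]- n%:R, n%:R]%classic; first exact: is_ocitv.
    by exists A.
move=> _ [A mA [B mB <-]].
have -> : A `*` B = ~` (~` (A `*` (setT : set mR)) `|` ~` ((setT : set mR) `*` B)).
  by rewrite setCU !setCK; apply/seteqP; split => -[x y] /=; tauto.
apply: (sCo _); rewrite -bigcup2E; apply: sU => -[|[|k]] /=.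
- by apply: sCo; exact: left.
- by apply: sCo; exact: right.
- exact: s0.
Qed.

End SpaceTimeMeasure.

(** * Test functions of the form a(x) b(t) *)

Section SmoothFunctions.
Context {R : realType}.
Implicit Types (a b c g E : R -> R) (x y : R).

Definition bounded_support (X : R) g : Prop := forall x, X < `|x| -> g x = 0.

Lemma smooth1_derivable g x : smooth1 g -> derivable g x 1.
Proof. by move=> sg; exact: (sg 0%N x). Qed.
Arguments smooth1_derivable {g} x _.

Lemma smooth1_derive g : smooth1 g -> smooth1 (derive1 g).
Proof. by move=> sg n x; rewrite -derive1Sn; exact: (sg n.+1 x). Qed.

Lemma smooth1_ext_derive g dg : (forall x : R, is_derive x 1 g (dg x)) -> smooth1 dg -> smooth1 g.
Proof.
move=> gd sd [|n] x; first by case: (gd x).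
rewrite derive1Sn.
have -> : derive1 g = dg by apply/funext => y; exact: is_derive_derive1.
exact: sd.
Qed.

Lemma smooth1D a b : smooth1 a -> smooth1 b -> smooth1 (fun x => a x + b x).
Proof.
move=> sa sb n; elim: n a b sa sb => [|n IH] a b sa sb x.
  by apply: derivableD; exact: smooth1_derivable.
rewrite derive1Sn.
have -> : derive1 (fun x => a x + b x) = (fun x => derive1 a x + derive1 b x).
  apply/funext => y; apply: is_derive_derive1.
  exact (is_deriveD1 (derivable_is_derive (smooth1_derivable y sa))
    (derivable_is_derive (smooth1_derivable y sb))).
by apply: IH; exact: smooth1_derive.
Qed.

Lemma smooth1Z k a : smooth1 a -> smooth1 (fun x => k * a x).
Proof.
move=> sa n; elim: n a sa => [|n IH] a sa x.
  by apply: derivableZ; exact: smooth1_derivable.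
rewrite derive1Sn.
have -> : derive1 (fun x => k * a x) = (fun x => k * derive1 a x).
  apply/funext => y; apply: is_derive_derive1.
  exact (is_deriveZ1 k (derivable_is_derive (smooth1_derivable y sa))).
by apply: IH; exact: smooth1_derive.
Qed.

Lemma is_derive_shift1 a x y da : is_derive (x - y) 1 a da ->
  is_derive x 1 (fun z => a (z - y)) da.
Proof.
move=> ad; have d1 : is_derive x 1 (fun z => z - y) (1 - 0).
  exact (is_deriveB1 (is_derive_var x) (is_derive_const y x)).
have := is_derive_comp1 d1 ad.
by move=> /is_derive_eq; apply; ring.
Qed.

Lemma smooth1_shift a y : smooth1 a -> smooth1 (fun x => a (x - y)).
Proof.
move=> sa n; elim: n a sa => [|n IH] a sa x.
  have := is_derive_shift1 (derivable_is_derive (smooth1_derivable (x - y) sa)).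
  by case.
rewrite derive1Sn.
have -> : derive1 (fun x => a (x - y)) = (fun x => derive1 a (x - y)).
  apply/funext => z; apply: is_derive_derive1; apply: is_derive_shift1.
  exact: derivable_is_derive (smooth1_derivable _ sa).
by apply: IH; exact: smooth1_derive.
Qed.

Lemma is_derive_expM lam a x da : is_derive x 1 a da ->
  is_derive x 1 (fun z => expR (lam * z) * a z) (expR (lam * x) * (da + lam * a x)).
Proof.
move=> ad; have d1 : is_derive x 1 (fun z => lam * z) (lam * 1).
  exact (is_deriveZ1 lam (is_derive_var x)).
have := is_deriveM1 (is_derive_comp1 d1 (is_derive_expR _)) ad.
by move=> /is_derive_eq; apply; ring.
Qed.

Lemma smooth1_expM lam a : smooth1 a -> smooth1 (fun x => expR (lam * x) * a x).
Proof.
move=> sa n; elim: n a sa => [|n IH] a sa x.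
  by have [] := is_derive_expM lam (derivable_is_derive (smooth1_derivable x sa)).
rewrite derive1Sn.
have -> : derive1 (fun x => expR (lam * x) * a x) =
    (fun x => expR (lam * x) * (derive1 a x + lam * a x)).
  apply/funext => y; apply: is_derive_derive1; apply: is_derive_expM.
  exact: derivable_is_derive (smooth1_derivable _ sa).
by apply: IH; apply: smooth1D; [exact: smooth1_derive|exact: smooth1Z].
Qed.

Lemma bounded_support_derive X g : smooth1 g -> bounded_support X g ->
  bounded_support X (derive1 g).
Proof.
move=> sg g0 x Xx.
have n0 : \forall y \near x, (fun=> 0 : R) y = g y.
  have c : {for x, continuous (fun y : R => `|y|)} by exact: norm_continuous.
  have [d /= d0 Hd] := cvgr_gt _ c _ Xx.
  by exists d => // y /Hd /= Xy; rewrite g0.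
have := near_eq_is_derive n0 (is_derive_const 0 x).
exact: is_derive_derive1.
Qed.

(** Products of this form are stable under [dx] and [dt], so induction on the word of derivatives
    shows that every iterated derivative is again such a product. *)
Lemma smooth2_tensor a b : smooth1 a -> smooth1 b ->
  smooth2 (fun z : R * R => a z.1 * b z.2).
Proof.
move=> sa sb w.
have [a' [b' [sa' sb' ->]]] : exists a' b', [/\ smooth1 a', smooth1 b' &
    foldr (fun d : bool => if d then dt else dx) (fun z : R * R => a z.1 * b z.2) w =
      (fun z : R * R => a' z.1 * b' z.2)].
  elim: w => [|d w [a' [b' [sa' sb' /= ->]]]]; first by exists a, b.
  case: d.
    exists a', (derive1 b'); split; [exact: sa'|exact: smooth1_derive|].
    apply/funext => z; apply: is_derive_derive1.
    exact (is_deriveZ1 (a' z.1) (derivable_is_derive (smooth1_derivable z.2 sb'))).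
  exists (derive1 a'), b'; split; [exact: smooth1_derive|exact: sb'|].
  apply/funext => z; apply: is_derive_derive1.
  have := is_deriveM1 (derivable_is_derive (smooth1_derivable z.1 sa')) (is_derive_const (b' z.2) z.1).
  by move=> /is_derive_eq; apply; ring.
split=> [z|z].
  have ca := smooth1_continuous sa'; have cb := smooth1_continuous sb'.
  have c1 : z'.1 @[z' --> z] --> z.1 by exact: cvg_fst.
  have c2 : z'.2 @[z' --> z] --> z.2 by exact: cvg_snd.
  apply: cvgM.
    exact: (cvg_comp _ _ c1 (ca _)).
  exact: (cvg_comp _ _ c2 (cb _)).
split; rewrite /derivable_x /derivable_t /=.
  have := is_deriveM1 (derivable_is_derive (smooth1_derivable z.1 sa')) (is_derive_const (b' z.2) z.1).
  by case.
have := is_deriveZ1 (a' z.1) (derivable_is_derive (smooth1_derivable z.2 sb')).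
by case.
Qed.

Lemma dt_tensor a b (z : R * R) : smooth1 b ->
  dt (fun z : R * R => a z.1 * b z.2) z = a z.1 * derive1 b z.2.
Proof.
move=> sb; apply: is_derive_derive1.
exact (is_deriveZ1 (a z.1) (derivable_is_derive (smooth1_derivable z.2 sb))).
Qed.

Lemma dx_tensor a b : smooth1 a ->
  dx (fun z : R * R => a z.1 * b z.2) = (fun z => derive1 a z.1 * b z.2).
Proof.
move=> sa; apply/funext => z; apply: is_derive_derive1.
have := is_deriveM1 (derivable_is_derive (smooth1_derivable z.1 sa)) (is_derive_const (b z.2) z.1).
by move=> /is_derive_eq; apply; ring.
Qed.

Lemma test_function_tensor X a b : smooth1 a -> smooth1 b ->
  bounded_support X a -> bounded_support X b ->
  test_function (fun z : R * R => a z.1 * b z.2).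
Proof.
move=> sa sb a0 b0; split; first exact: smooth2_tensor.
have cK : compact (`[- X, X]%classic `*` `[- X, X]%classic : set (R * R)).
  by apply: compact_setX; exact: segment_compact.
apply: (subclosed_compact _ cK); first exact: closed_closure.
have clK : closed (`[- X, X]%classic `*` `[- X, X]%classic : set (R * R)).
  by apply: compact_closed => //; exact: norm_hausdorff.
rewrite [Y in _ `<=` Y](closure_id _).1//.
apply: closureS => -[x t] /=; rewrite mulf_eq0 negb_or => /andP[ax bt].
rewrite !in_itv/= -!ler_norml; split; rewrite leNgt; apply/negP => H.
  by move: ax; rewrite a0// eqxx.
by move: bt; rewrite b0// eqxx.
Qed.

Lemma smooth1_bounded X g : continuous g -> bounded_support X g ->
  exists2 M : R, 0 <= M & forall x, `|g x| <= M.
Proof.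
move=> cg g0.
pose X' := Num.max 0 X.
have X'0 : - X' <= X' by rewrite -subr_ge0 opprK addr_ge0// le_max lexx.
have [c _ Hc] := @EVT_max R (fun x => `|g x|) (- X') X' X'0
  (continuous_subspaceT (fun x => continuous_comp (@cg x) (@norm_continuous _ _ _))).
exists `|g c| => // x.
have [xX|xX] := leP `|x| X'; first by apply: Hc; rewrite in_itv/= -ler_norml.
by rewrite g0 ?normr0// (le_lt_trans _ xX)// le_max lexx orbT.
Qed.

End SmoothFunctions.
Arguments smooth1Z {R} k {a} _.
Arguments smooth1_shift {R a} y _.

(** A difference of two translated smoothed Heaviside functions approximates the indicator of []s1,
    s2]] off its endpoints. In time it is the derivative of the test function that must be such a
    step; asking this for [t > 0] only leaves negative times free to make the primitive compactly
    supported. The last clause provides a profile with value [1] at [0]. *)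
Lemma smooth_steps (R : realType) (e : nat -> R) (eta : nat -> R -> R) :
  e n @[n --> \oo] --> (0 : R) -> (forall k, 0 < e k /\ mollifier (e k) (eta k)) ->
  exists S : nat -> R -> R -> R -> R,
  [/\ forall k s1 s2, smooth1 (S k s1 s2),
      forall k s1 s2, exists X, bounded_support X (S k s1 s2),
      forall k s1 s2 x, `|S k s1 s2 x| <= 1,
      forall s1 s2, exists X, forall k x, X < `|x| -> S k s1 s2 x = 0 &
      forall s1 s2 x, s1 < s2 -> x != s1 -> x != s2 ->
        S k s1 s2 x @[k --> \oo] --> (\1_(`]s1, s2]) x : R)] /\
  (forall k s1 s2, exists c X, [/\ smooth1 c, bounded_support X c &
      forall t, 0 < t -> derive1 c t = S k s1 s2 t]) /\
  (exists s1 s2, S 0%N s1 s2 0 = 1).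
Proof.
move=> e0 meta.
have HE (k : nat) : exists E : R -> R, [/\ forall x : R, is_derive x 1 E (eta k x),
    forall x, x < - e k -> E x = 0, forall x, e k < x -> E x = 1 &
    forall x, 0 <= E x <= 1].
  by have [ek mk] := meta k; exact: mollifier_antiderivative ek mk.
have [E HE'] := choice HE.
have dE (k : nat) := let: And4 h _ _ _ := HE' k in h.
have El (k : nat) := let: And4 _ h _ _ := HE' k in h.
have Er (k : nat) := let: And4 _ _ h _ := HE' k in h.
have E01 (k : nat) := let: And4 _ _ _ h := HE' k in h.
have sE k : smooth1 (E k).
  by apply: (smooth1_ext_derive (dE k)); have [_ []] := meta k.
pose S k s1 s2 x := E k (x - s1) - E k (x - s2).
have sS k s1 s2 : smooth1 (S k s1 s2).
  have -> : S k s1 s2 = (fun x => E k (x - s1) + (-1) * E k (x - s2)).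
    by apply/funext => x; rewrite /S mulN1r.
  exact (smooth1D (smooth1_shift s1 (sE k)) (smooth1Z (-1) (smooth1_shift s2 (sE k)))).
have supS k s1 s2 x : e k + `|s1| + `|s2| < `|x| -> S k s1 s2 x = 0.
  move=> H; have [ek _] := meta k.
  have := ler_norm s1; have := ler_norm s2; have := ler_norm (- s1); have := ler_norm (- s2).
  rewrite !normrN => h1 h2 h3 h4.
  have p1 := normr_ge0 s1; have p2 := normr_ge0 s2.
  move: H; rewrite lter_normr => /orP[H|H].
    by rewrite /S !Er ?subrr//; clear -H h1 h2 h3 h4 p1 p2 ek; lra.
  by rewrite /S !El ?subrr//; clear -H h1 h2 h3 h4 p1 p2 ek; lra.
(* A common bound on the radii makes the supports uniform in [k], as dominated convergence will
   require. *)
have [N eN] : exists N, forall k, e k <= N.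
  have bd : bounded_fun e by apply: cvg_seq_bounded; apply: cvgP e0.
  have [M [Mr HM]] := bd.
  exists (M + 1) => k; apply: (le_trans (ler_norm _)).
  by apply: (HM (M + 1)) => //; rewrite ltrDl.
exists S; split; [split|split].
- exact: sS.
- by move=> k s1 s2; exists (e k + `|s1| + `|s2|) => x; exact: supS.
- move=> k s1 s2 x; rewrite /S ler_norml.
  have /andP[b1 b2] := E01 k (x - s1); have /andP[b3 b4] := E01 k (x - s2).
  by apply/andP; split; move: b1 b2 b3 b4; clear; lra.
- move=> s1 s2; exists (N + `|s1| + `|s2|) => k x H; apply: supS.
  by apply: le_lt_trans H; rewrite !lerD2r.
- move=> s1 s2 x s12 x1 x2.
  have d0 : 0 < Num.min `|x - s1| `|x - s2|.
    by rewrite lt_min !normr_gt0 !subr_eq0 x1 x2.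
  have [K _ HK] := cvgr_lt _ e0 _ d0.
  apply: cvg_near_cst; exists K => // k /HK /=; rewrite lt_min => /andP[k1 k2].
  have [ek _] := meta k.
  move: k1 k2; rewrite !lter_normr indicE mem_setE /= in_itv/= /S.
  case/orP => k1; case/orP => k2.
  + have x2' : (x <= s2) = false by apply/negbTE; rewrite -ltNge; clear -k2 ek; lra.
    by rewrite !Er// subrr x2' andbF.
  + have h1 : x - s2 < - e k by clear -k2; lra.
    have h2 : s1 < x by clear -k1 ek; lra.
    have h3 : x <= s2 by clear -k2 ek; lra.
    by rewrite Er// El// h2 h3 subr0.
  + by exfalso; clear -k1 k2 s12 ek; lra.
  + have h1 : x - s2 < - e k by clear -k2; lra.
    have h2 : x - s1 < - e k by clear -k1; lra.
    have h3 : (s1 < x) = false by apply/negbTE; rewrite -leNgt; clear -k1 ek; lra.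
    by rewrite !El// subrr h3.
- move=> k s1 s2; have [ek _] := meta k.
  have cE := smooth1_continuous (sE k).
  have [G [dG Gl]] : exists G : R -> R, (forall x : R, is_derive x 1 G (E k x)) /\
      (forall x, x < - e k -> G x = 0).
    by eexists; exact: antiderivative cE (El k).
  have cG : continuous G.
    by move=> x; apply: differentiable_continuous; apply/derivable1_diffP; case: (dG x).
  have Gr x y : e k < x -> e k < y -> G x - G y = x - y.
    wlog xy : x y / y <= x => [H|].
      move=> hx hy; have [yx|/ltW yx] := leP y x; first exact: H.
      by move: (H y x yx hy hx); clear; lra.
    move=> hx hy; move: xy; rewrite le_eqVlt => /predU1P[->|yx]; first by rewrite !subrr.
    have [c] := MVT yx (fun z _ => dG z) (continuous_subspaceT cG).
    by rewrite in_itv/= => /andP[yc _] ->; rewrite Er ?mul1r// (lt_trans hy).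
  have sG : smooth1 G := smooth1_ext_derive dG (sE k).
  have [Y [Y1 Y2]] : exists Y, e k + `|s1| + 1 <= Y /\ e k + `|s2| + 1 <= Y.
    exists (e k + 1 + `|s1| + `|s2|).
    by have p1 := normr_ge0 s1; have p2 := normr_ge0 s2; split; lra.
  (* The translate by [- Y] lives at negative times and cancels the constant that
     the primitive of the step would keep for large [t]. *)
  pose c t := (G (t - s1) + (-1) * G (t - s2)) + ((-1) * G (t - (s1 - Y)) + G (t - (s2 - Y))).
  have := ler_norm s1; have := ler_norm s2; have := ler_norm (- s1); have := ler_norm (- s2).
  rewrite !normrN => h1 h2 h3 h4.
  have p1 := normr_ge0 s1; have p2 := normr_ge0 s2.
  exists c, (e k + `|s1| + `|s2| + Y); split.
  + exact (smooth1D
      (smooth1D (smooth1_shift s1 sG) (smooth1Z (-1) (smooth1_shift s2 sG)))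
      (smooth1D (smooth1Z (-1) (smooth1_shift (s1 - Y) sG)) (smooth1_shift (s2 - Y) sG))).
  + move=> t; rewrite lter_normr => /orP[H|H]; rewrite /c.
      have q1 : e k < t - s1 by clear -H h1 h2 h3 h4 p1 p2 Y1 Y2 ek; lra.
      have q2 : e k < t - s2 by clear -H h1 h2 h3 h4 p1 p2 Y1 Y2 ek; lra.
      have q3 : e k < t - (s1 - Y) by clear -H h1 h2 h3 h4 p1 p2 Y1 Y2 ek; lra.
      have q4 : e k < t - (s2 - Y) by clear -H h1 h2 h3 h4 p1 p2 Y1 Y2 ek; lra.
      by move: (Gr _ _ q1 q2) (Gr _ _ q3 q4); clear; lra.
    have q1 : t - s1 < - e k by clear -H h1 h2 h3 h4 p1 p2 Y1 Y2 ek; lra.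
    have q2 : t - s2 < - e k by clear -H h1 h2 h3 h4 p1 p2 Y1 Y2 ek; lra.
    have q3 : t - (s1 - Y) < - e k by clear -H h1 h2 h3 h4 p1 p2 Y1 Y2 ek; lra.
    have q4 : t - (s2 - Y) < - e k by clear -H h1 h2 h3 h4 p1 p2 Y1 Y2 ek; lra.
    by rewrite !Gl// mulr0 !addr0.
  + move=> t t0.
    have := is_deriveD1
      (is_deriveD1 (is_derive_shift1 (dG (t - s1)))
         (is_deriveZ1 (-1) (is_derive_shift1 (dG (t - s2)))))
      (is_deriveD1 (is_deriveZ1 (-1) (is_derive_shift1 (dG (t - (s1 - Y)))))
         (is_derive_shift1 (dG (t - (s2 - Y))))).
    move=> /is_derive_derive1 ->.
    rewrite (Er k (t - (s1 - Y))); last by clear -t0 h1 h2 h3 h4 p1 p2 Y1 Y2 ek; lra.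
    rewrite (Er k (t - (s2 - Y))); last by clear -t0 h1 h2 h3 h4 p1 p2 Y1 Y2 ek; lra.
    by rewrite /S; clear; lra.
- have [ek _] := meta 0%N.
  exists (- (e 0%N + 1)), (e 0%N + 1); rewrite /S Er; last by clear -ek; lra.
  by rewrite El ?subr0//; clear -ek; lra.
Qed.

Section WeakNullInstances.
Context {R : realType}.
Local Notation mR := (measurableTypeR R).

Lemma ocitv_fin (A : set mR) : (@ocitv R) A -> (lebesgue_measure A < +oo)%E.
Proof. by move=> [[x y] _ <-]; apply: (@lebesgue_itv_fin _ _ x y) => z /=; rewrite !in_itv/= => /andP[/ltW -> ->]. Qed.

Lemma ocitv_measurable (A : set mR) : (@ocitv R) A -> measurable A.
Proof. by move=> oA; exact: sub_sigma_algebra. Qed.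

Lemma eventually_in_oc (x : R) : exists i0, forall i, (i0 <= i)%N ->
  (`]- i%:R, i%:R]%classic : set R) x.
Proof.
exists (Num.truncn `|x|).+1 => i ii /=; rewrite in_itv/=.
have : `|x| < i%:R by apply: lt_le_trans (truncnS_gt _) _; rewrite ler_nat.
by rewrite ltr_norml => /andP[-> /ltW ->].
Qed.

Lemma indic_rectangle (A B : set R) (z : R * R) :
  \1_(A `*` B) z = \1_A z.1 * \1_B z.2 :> R.
Proof.
rewrite !indicE; have [h|h] := pselect ((A `*` B) z).
  by case: (h) => h1 h2; rewrite !mem_set// mulr1.
rewrite (memNset h); have [h1|h1] := pselect (A z.1); last by rewrite (memNset h1) mul0r.
have [h2|h2] := pselect (B z.2); last by rewrite (memNset h2) mulr0.
by exfalso; apply: h; split.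
Qed.

Lemma null_against_line (u : nat -> mR -> R) (C : R) :
  (forall n, measurable_fun setT (u n)) -> (forall n z, `|u n z| <= C) ->
  (forall x y, x < y -> null_against leb u (\1_(`]x, y]%classic : set R))) ->
  forall g, L1 leb setT g -> null_against leb u g.
Proof.
move=> mu_ uC H g; apply: (@null_against_integrable _ mR R leb u C mu_ uC (@ocitv R)
  (fun i => `]- i%:R, i%:R]%classic)) => //.
- exact: ocitvI.
- by move=> A; exact: ocitv_fin.
- by move=> i; exact: is_ocitv.
- exact: eventually_in_oc.
- move=> A /ocitvP[->|[[x y] /= xy ->]]; last exact: H.
  have -> : \1_set0 = (fun=> 0) :> (mR -> R) by apply/funext => z; rewrite indic0.
  exact: null_against0.
Qed.

Lemma null_against_plane (u : nat -> mR * mR -> R) (C : R) :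
  (forall n, measurable_fun setT (u n)) -> (forall n z, `|u n z| <= C) ->
  (forall x y s t, x < y -> s < t ->
    null_against leb2 u (fun z => \1_(`]x, y]%classic : set R) z.1 * \1_(`]s, t]%classic : set R) z.2)) ->
  forall g, L1 leb2 setT g -> null_against leb2 u g.
Proof.
move=> mu_ uC H g; apply: (@null_against_integrable _ (mR * mR)%type R leb2 u C mu_ uC
  oc_rectangles (fun i => `]- i%:R, i%:R]%classic `*` `]- i%:R, i%:R]%classic)) => //.
- exact: oc_rectangles_setI.
- exact: measurable_oc_rectangles.
- move=> _ [A oA [B oB <-]]; apply: leb2_rectangle_fin; [exact: ocitv_measurable|
    exact: ocitv_measurable|exact: ocitv_fin|exact: ocitv_fin].
- move=> i; exists `]- i%:R, i%:R]%classic; first exact: is_ocitv.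
  by exists `]- i%:R, i%:R]%classic; first exact: is_ocitv.
- move=> [x t]; have [i1 H1] := eventually_in_oc x; have [i2 H2] := eventually_in_oc t.
  exists (maxn i1 i2) => i; rewrite geq_max => /andP[h1 h2].
  by split; [exact: H1|exact: H2].
- move=> _ [A oA [B oB <-]].
  have -> : \1_(A `*` B) = (fun z => \1_A z.1 * \1_B z.2) :> (mR * mR -> R).
    by apply/funext => z; exact: indic_rectangle.
  case: (ocitvP A).1 => // [->|[[x y] /= xy ->]].
    have -> : (fun z => \1_set0 z.1 * \1_B z.2) = (fun=> 0) :> (mR * mR -> R).
      by apply/funext => z; rewrite indic0 mul0r.
    exact: null_against0.
  case: (ocitvP B).1 => // [->|[[s t] /= st ->]]; last exact: H.
  have -> : (fun z => \1_(`]x, y]%classic : set R) z.1 * \1_set0 z.2) = (fun=> 0) :> (mR * mR -> R).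
    by apply/funext => z; rewrite indic0 mulr0.
  exact: null_against0.
Qed.

(** Testing against [s] itself, cut off to growing squares, shows that the integral of [s^2] over
    each square is zero. *)
Lemma null_cst_ae_eq0 (s : mR * mR -> R) (C : R) : measurable_fun setT s ->
  (forall z, `|s z| <= C) ->
  (forall g, L1 leb2 setT g -> null_against leb2 (fun=> s) g) ->
  {ae leb2, forall z, s z = 0}.
Proof.
move=> ms sC H.
suff main j : {ae leb2, forall z, square j%:R z -> s z = 0}.
  apply: (aeW (ae_forall main)) => -[x t] Hz.
  have [i1 H1] := eventually_in_oc x; have [i2 H2] := eventually_in_oc t.
  apply: (Hz (maxn i1 i2)); split => /=.
    by have := H1 _ (leq_maxl i1 i2); rewrite /= !in_itv/= => /andP[/ltW -> ->].
  by have := H2 _ (leq_maxr i1 i2); rewrite /= !in_itv/= => /andP[/ltW -> ->].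
set B := square j%:R.
have mB : measurable B by exact: measurable_square.
have mg : measurable_fun setT (fun z => s z * \1_B z).
  by apply: measurable_funM => //; exact: measurable_indic.
have C0 : 0 <= C by apply: le_trans (sC point).
have gC : {ae leb2, forall z, setT z -> `|s z * \1_B z| <= C * \1_B z}.
  apply: nearW => z _; rewrite normrM (ger0_norm (_ : 0 <= \1_B z)) ?indicE//.
  by rewrite ler_wpM2r.
have iB c : L1 leb2 setT (fun z => c * \1_B z).
  by apply: integrable_cst_indic => //; exact: square_fin.
have ig : L1 leb2 setT (fun z => s z * \1_B z).
  exact: (ae_integrable_le measurableT mg (iB C) gC).
have [_ cv] := H _ ig.
have I0 : Rintegral leb2 setT (fun z => s z * (s z * \1_B z)) = 0.
  have c1 : (fun=> Rintegral leb2 setT (fun z => s z * (s z * \1_B z))) @ \oo -->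
      Rintegral leb2 setT (fun z => s z * (s z * \1_B z)) by exact: cvg_cst.
  exact: (cvg_unique (@Rhausdorff R) c1 cv).
have := Rintegral_ge0_eq0 measurableT _ _ I0.
have h1 : leb2.-integrable setT (EFin \o (fun z => s z * (s z * \1_B z))).
  apply: (ae_integrable_le measurableT _ (iB (C * C))); first exact: measurable_funM.
  apply: nearW => z _; rewrite !normrM (ger0_norm (_ : 0 <= \1_B z)) ?indicE//.
  by rewrite mulrA ler_wpM2r// ler_pM.
have h2 z : setT z -> 0 <= s z * (s z * \1_B z).
  by move=> _; rewrite mulrA mulr_ge0 ?indicE// -expr2 sqr_ge0.
move=> /(_ h1 h2) K; apply: (aeW K) => z /(_ I) + Bz.
by rewrite indicE mem_set// mulr1 => /eqP; rewrite mulf_eq0 orbb => /eqP.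
Qed.

Lemma ae_line_neq (c : R) : {ae leb, forall x, x != c}.
Proof.
exists [set c]; split; first exact: measurable_set1.
  exact: lebesgue_measure_set1.
by move=> x /= /negP; rewrite negbK => /eqP.
Qed.

Lemma ae_plane_neq (c : R) : {ae leb2, forall z, z.1 != c /\ z.2 != c}.
Proof.
have mc : @measurable _ mR [set c] by exact: measurable_set1.
apply: aeI.
  exists ([set c] `*` setT); split; first exact: measurableX.
    by rewrite leb2_rectangle// lebesgue_measure_set1 mul0e.
  by move=> z /= /negP; rewrite negbK => /eqP.
exists (setT `*` [set c]); split; first exact: measurableX.
  by rewrite leb2_rectangle// lebesgue_measure_set1 mule0.
by move=> z /= /negP; rewrite negbK => /eqP.
Qed.

(* The factors need only be bounded with bounded support, so that the tensor
   product is integrable although [r] is merely bounded. *)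
Lemma Rintegral_tensor (r : mR * mR -> R) (a w : mR -> R) (M Ca Cw X : R) :
  measurable_fun setT r -> (forall z, `|r z| <= M) ->
  measurable_fun setT a -> (forall x, `|a x| <= Ca) -> bounded_support X a ->
  measurable_fun setT w -> (forall x, `|w x| <= Cw) -> bounded_support X w ->
  Rintegral leb setT (fun x => Rintegral leb setT (fun t => r (x, t) * w t) * a x) =
  Rintegral leb2 setT (fun z => r z * (a z.1 * w z.2)) /\
  (exists H : R, forall x, `|Rintegral leb setT (fun t => r (x, t) * w t)| <= H).
Proof.
move=> mr rM ma aC a0 mw wC w0.
have M0 : 0 <= M by apply: le_trans (rM point).
have Ca0 : 0 <= Ca by apply: le_trans (aC point).
have Cw0 : 0 <= Cw by apply: le_trans (wC point).
pose J : set mR := `[- X, X]%classic.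
have mJ : measurable J by exact: measurable_itv.
have Joo : (leb J < +oo)%E by exact: (@lebesgue_itv_fin _ _ (- X) X).
have wJ t : `|w t| <= Cw * \1_J t.
  rewrite indicE mem_setE /J /= in_itv/= -ler_norml.
  have [H|H] := leP `|t| X; first by rewrite mulr1.
  by rewrite w0// normr0 /= mulr0.
have aJ t : `|a t| <= Ca * \1_J t.
  rewrite indicE mem_setE /J /= in_itv/= -ler_norml.
  have [H|H] := leP `|t| X; first by rewrite mulr1.
  by rewrite a0// normr0 /= mulr0.
have mrx x : measurable_fun setT (fun t => r (x, t)).
  by apply: (measurableT_comp mr); exact: measurable_pair1.
have irx x : leb.-integrable setT (EFin \o (fun t => r (x, t) * w t)).
  apply: (ae_integrable_le measurableT _ (integrable_cst_indic (M * Cw) measurableT mJ Joo)).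
    by apply: measurable_funM => //; exact: mrx.
  by apply: nearW => t _; rewrite normrM -mulrA ler_pM.
split.
  have mPhi : measurable_fun setT (fun z : mR * mR => r z * (a z.1 * w z.2)).
    apply: measurable_funM => //; apply: measurable_funM.
      by apply: (measurableT_comp ma); exact: measurable_fst.
    by apply: (measurableT_comp mw); exact: measurable_snd.
  have iPhi : (lebesgue_measure \x lebesgue_measure)%E.-integrable setT
      (EFin \o (fun z : mR * mR => r z * (a z.1 * w z.2))).
    have iS := integrable_cst_indic (M * (Ca * Cw)) measurableT
      (measurable_square X) (square_fin X).
    apply: (ae_integrable_le measurableT mPhi iS); apply: nearW => z _.
    rewrite !normrM -mulrA ler_pM// ?mulr_ge0//.
    have -> : \1_(square X) z = \1_J z.1 * \1_J z.2 :> R by exact: indic_rectangle.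
    by rewrite mulrACA ler_pM.
  have := integral12_prod_meas1 iPhi; rewrite /Rintegral => E.
  congr fine; refine (eq_trans _ E).
  apply: eq_integral => x _; rewrite /fubini_F /= EFinM fineK; last exact (integrable_fin_num measurableT (irx x)).
  rewrite -(integralZr measurableT (irx x)).
  by apply: eq_integral => t _; rewrite -EFinM; congr EFin; ring.
exists (Rintegral leb setT (fun t => M * Cw * \1_J t)) => x.
have iM := integrable_cst_indic (M * Cw) measurableT mJ Joo.
apply: (le_trans (le_normr_Rintegral measurableT (irx x))).
apply: le_Rintegral => //; first exact: integrable_abse (irx x).
by move=> t _; rewrite normrM -mulrA ler_pM.
Qed.

(** Tonelli's theorem gives measurability for non-negative integrands, so positive and negative
    parts are integrated separately. *)
Lemma measurable_partial_integral (r : mR * mR -> R) (w : mR -> R) (M Cw X : R) :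
  measurable_fun setT r -> (forall z, `|r z| <= M) ->
  measurable_fun setT w -> (forall x, `|w x| <= Cw) -> bounded_support X w ->
  measurable_fun setT (fun x => Rintegral leb setT (fun t => r (x, t) * w t)).
Proof.
move=> mr rM mw wC w0.
have mf : measurable_fun setT (fun z : mR * mR => (r z * w z.2)%:E).
  apply/measurable_EFinP; apply: measurable_funM => //.
  by apply: (measurableT_comp mw); exact: measurable_snd.
apply: measurableT_comp => //=.
under eq_fun do rewrite integralE.
apply: emeasurable_funB.
  pose fp := ((fun z : mR * mR => (r z * w z.2)%:E)^\+)%E.
  have H : measurable_fun setT (fubini_F (@lebesgue_measure R) fp).
    apply: measurable_fun_fubini_tonelli_F; [exact (measurable_funepos mf)|move=> z; exact: funepos_ge0].
  rewrite (_ : (fun x => _) = fubini_F (@lebesgue_measure R) fp)//.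
  by apply/funext => x; apply: eq_integral => t _; rewrite /fp !funeposE.
pose fn := ((fun z : mR * mR => (r z * w z.2)%:E)^\-)%E.
have H : measurable_fun setT (fubini_F (@lebesgue_measure R) fn).
  apply: measurable_fun_fubini_tonelli_F; [exact (measurable_funeneg mf)|move=> z; exact: funeneg_ge0].
rewrite (_ : (fun x => _) = fubini_F (@lebesgue_measure R) fn)//.
by apply/funext => x; apply: eq_integral => t _; rewrite /fn !funenegE.
Qed.

End WeakNullInstances.

(** * Limit of the weak formulation *)

Section LimitEquation.
Context {R : realType}.
Local Notation mR := (measurableTypeR R).

Lemma lipschitz_le (f : R -> R) : [lipschitz f p | p in `[0, +oo[] ->
  exists2 K : R, 0 <= K &
    forall p q, 0 <= p -> 0 <= q -> `|f p - f q| <= K * `|p - q|.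
Proof.
move=> [M [_ /(_ (Num.max 0 M + 1))]].
have M0 : 0 <= Num.max 0 M + 1 by rewrite addr_ge0// le_max lexx.
rewrite ltr_pwDr// ?le_max ?lexx ?orbT// => /(_ isT) fM.
exists (Num.max 0 M + 1) => // p q p0 q0.
by apply: (fM (p, q)); rewrite /= !in_itv/= p0 q0.
Qed.

Lemma pressure_ge0 (m r : R) : 1 < m -> 0 <= pressure m r.
Proof. by move=> m1; rewrite mulr_ge0 ?powR_ge0// divr_ge0; lra. Qed.

(** Since [r^m = r * r^(m-1)] and [m / (m - 1) >= 1]. This is how the diffusion term vanishes
    together with the pressure. *)
Lemma powR_pressure (m r : R) : 1 < m -> 0 <= r ->
  0 <= r `^ m <= r * pressure m r.
Proof.
move=> m1 r0; rewrite powR_ge0/= -mulr_powRB1//; last lra.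
rewrite ler_wpM2l// /pressure ler_peMl ?powR_ge0//.
by rewrite ler_pdivlMr; lra.
Qed.

Lemma measurable_pressure (D : set (mR * mR)) (m : R) (u : mR * mR -> R) :
  measurable_fun D u -> measurable_fun D (fun z => pressure m (u z)).
Proof.
move=> mu; apply: measurable_funM; first exact: measurable_cst.
exact: (measurableT_comp (measurable_powR _) mu).
Qed.

Lemma measurable_reaction (f : R -> R) (D : set (mR * mR)) (m : R) (u : mR * mR -> R) :
  [lipschitz f p | p in `[0, +oo[] -> 1 < m -> measurable_fun D u ->
  measurable_fun D (fun z => f (pressure m (u z))).
Proof.
move=> /lipschitz_le[K K0 fK] m1 mu.
(* [f] is Lipschitz on the non-negative half-line only; composed with the positive part it is
   continuous everywhere and unchanged at pressures. *)
pose fbar (p : R) : R := f (Num.max 0 p).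
have cf : continuous fbar.
  move=> p; apply/(@cvgrPdist_le _ _ _ _ (nbhs_filter p)) => e e0.
  exists (e / (K + 1)); first by rewrite /= divr_gt0// ltr_wpDl.
  move=> q /= pq.
  have h1 : `|fbar p - fbar q| <= K * `|p - q|.
    apply: (le_trans (fK _ _ _ _)); rewrite ?le_max ?lexx//.
    rewrite ler_wpM2l// .
    have [p0|p0] := leP 0 p; have [q0|q0] := leP 0 q; rewrite ?subrr ?normr0 ?normr_ge0//.
      by rewrite !ger0_norm; lra.
    by rewrite !ler0_norm; lra.
  apply: (le_trans h1); apply: (@le_trans _ _ ((K + 1) * `|p - q|)).
    by rewrite ler_wpM2r// lerDl.
  by rewrite mulrC -ler_pdivlMr ?ltr_wpDl// ltW.
have mf : measurable_fun setT (fbar : mR -> mR) by exact: continuous_measurable_fun.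
have -> : (fun z => f (pressure m (u z))) = fbar \o (fun z => pressure m (u z)).
  by apply/funext => z; rewrite /fbar /= max_r// pressure_ge0.
by apply: (measurableT_comp mf); exact: measurable_pressure.
Qed.

Context (f : R -> R) (rho_in : R -> R -> R) (rho : R -> R * R -> R)
  (ms : nat -> R) (C ka : R).
Context (C0 : 0 < C) (ka0 : 0 < ka) (ms1 : forall n, 1 < ms n)
  (ms_oo : ms n @[n --> \oo] --> +oo).
Context (vanish : forall T, 0 < T -> exists m0, forall m, m0 <= m ->
    {ae leb2, forall z, 0 < z.2 <= T -> 0 <= rho m z <= C /\
       pressure m (rho m z) <= C * ((1 + ka * m * z.2)^-1 + m^-1)}).

Lemma bounded_along T : 0 < T -> exists N : nat, forall n, (N <= n)%N ->
  {ae leb2, forall z, 0 < z.2 <= T -> 0 <= rho (ms n) z <= C /\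
     0 <= pressure (ms n) (rho (ms n) z) <= 2 * C}.
Proof.
move=> T0; have [m0 Hm0] := vanish T0.
have [N _ HN] := (cvgryPge ms).1 ms_oo m0.
exists N => n /HN /= nm; apply: (aeW (Hm0 _ nm)) => z Hz zT.
have [-> pz] := Hz zT; split => //; rewrite pressure_ge0//=.
apply: (le_trans pz); rewrite mulrC ler_wpM2r ?(ltW C0)//.
have m1 := ms1 n.
have h : 0 <= ka * ms n * z.2.
  by case/andP: zT => /ltW z0 _; rewrite !mulr_ge0 ?(ltW ka0)//; lra.
have -> : 2 = 1 + 1 :> R by [].
by rewrite lerD// invf_le1; lra.
Qed.

(** At fixed [t > 0] both terms of the decay bound are of order [1/m], with a factor [1 / (ka t)]
    that blows up at [t = 0]. The convergence is therefore pointwise only, and is paired with the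
    uniform bound of [bounded_along]. *)
Lemma pressure_cvg0_along :
  {ae leb2, forall z, 0 < z.2 -> pressure (ms n) (rho (ms n) z) @[n --> \oo] --> (0 : R)}.
Proof.
suff main (j : nat) : {ae leb2, forall z, 0 < z.2 <= j.+1%:R ->
    pressure (ms n) (rho (ms n) z) @[n --> \oo] --> (0 : R)}.
  apply: (aeW (ae_forall main)) => z Hz z0.
  by apply: (Hz (Num.truncn z.2)); rewrite z0 ltW// truncnS_gt.
have [m0 Hm0] := vanish (ltr0Sn R j).
have [N _ HN] := (cvgryPge ms).1 ms_oo m0.
have aeN : {ae leb2, forall z, forall n, (N <= n)%N -> 0 < z.2 <= j.+1%:R ->
    pressure (ms n) (rho (ms n) z) <= C * ((1 + ka * ms n * z.2)^-1 + (ms n)^-1)}.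
  apply: ae_forall => n.
  have [nN|nN] := leqP N n; last by apply: nearW => z.
  by apply: (aeW (Hm0 _ (HN n nN))) => z Hz _ zT; have [] := Hz zT.
apply: (aeW aeN) => z Hz zT; have z0 : 0 < z.2 by case/andP: zT.
have q0 : 0 < ka * z.2 by rewrite mulr_gt0.
apply: (@squeeze_cvgr _ _ _ _ (fun=> 0) (fun n => C * ((ka * z.2)^-1 + 1) * (ms n)^-1)).
- exists N => // n /= nN; rewrite pressure_ge0//=.
  apply: (le_trans (Hz n nN zT)); rewrite -[leRHS]mulrA ler_wpM2l ?(ltW C0)// mulrDl mul1r lerD2r.
  have m1 := ms1 n; have m0' : 0 < ms n by lra.
  rewrite -invfM; rewrite lef_pV2 ?posrE ?mulr_gt0//.
    by rewrite [ka * ms n * _]mulrAC lerDr.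
  by rewrite ltr_pwDl// ltW// mulr_gt0// mulr_gt0.
- exact: cvg_cst.
- rewrite -[X in _ --> X](mulr0 (C * ((ka * z.2)^-1 + 1))).
  apply: cvgM; first exact: cvg_cst.
  by apply/(gtr0_cvgV0 _).2 => //; apply: nearW => n; apply: lt_trans (ms1 n).
Qed.

Lemma L1_tensor (D : set (mR * mR)) (a b : R -> R) X : measurable D ->
  continuous a -> continuous b -> bounded_support X a -> bounded_support X b ->
  L1 leb2 D (fun z => a z.1 * b z.2).
Proof.
move=> mD ca cb a0 b0.
have [Ma Ma0 aM] := smooth1_bounded ca a0.
have [Mb Mb0 bM] := smooth1_bounded cb b0.
have mab : measurable_fun D (fun z : mR * mR => a z.1 * b z.2).
  apply: measurable_funTS; apply: measurable_funM.
    by apply: (measurableT_comp _ (@measurable_fst _ _ _ _)); exact: continuous_measurable_fun.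
  by apply: (measurableT_comp _ (@measurable_snd _ _ _ _)); exact: continuous_measurable_fun.
apply: (ae_integrable_le mD mab
  (integrable_cst_indic (Ma * Mb) mD (measurable_square X) (square_fin X))).
apply: nearW => z _; rewrite normrM indicE.
have [zs|zs] := pselect (square X z).
  by rewrite mem_set// mulr1 ler_pM.
rewrite memNset// mulr0.
suff : a z.1 * b z.2 = 0 by move=> /(congr1 Num.norm); rewrite normrM normr0 => ->.
have [h|h] := leP `|z.1| X; last by rewrite a0// mul0r.
have [h'|h'] := leP `|z.2| X; last by rewrite b0// mulr0.
by exfalso; apply: zs; split; rewrite /= in_itv/= -ler_norml.
Qed.

(** Splitting off the linear reaction [f 0] leaves the error [h n], made of diffusion and of
    [f(p) - f 0]. It is at most density times pressure times a fixed integrable function, hence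
    vanishes by dominated convergence, while the linear part passes to the weak limit. *)
Lemma weak_formulation_limit (rho_oo : R * R -> R) (a b : R -> R) X :
  [lipschitz f p | p in `[0, +oo[] ->
  (forall m, 1 < m -> weak_solution f m (rho_in m) (rho m)) ->
  weak_star_cvg leb2 halfplane (fun n => rho (ms n)) rho_oo ->
  smooth1 a -> smooth1 b -> bounded_support X a -> bounded_support X b ->
  Rintegral leb setT (fun x => rho_in (ms n) x * (a x * b 0)) @[n --> \oo] -->
  - Rintegral leb2 halfplane (fun z => rho_oo z * (a z.1 * (derive1 b z.2 + f 0 * b z.2))).
Proof.
move=> fL sol [rL _ rcv] sa sb a0 b0.
have [K K0 fK] := lipschitz_le fL.
have mH := @measurable_halfplane R.
have ca := smooth1_continuous sa; have cb := smooth1_continuous sb.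
have sda := smooth1_derive sa; have sdb := smooth1_derive sb.
have sdda := smooth1_derive sda.
have cda := smooth1_continuous sda; have cdb := smooth1_continuous sdb.
have cdda := smooth1_continuous sdda.
have da0 := bounded_support_derive sa a0.
have dda0 := bounded_support_derive sda da0.
have db0 := bounded_support_derive sb b0.
have cw : continuous (fun t => derive1 b t + f 0 * b t).
  exact: (smooth1_continuous (smooth1D sdb (smooth1Z (f 0) sb))).
have w0 : bounded_support X (fun t => derive1 b t + f 0 * b t).
  by move=> t Xt; rewrite db0// b0// mulr0 addr0.
pose g1 (z : mR * mR) := a z.1 * (derive1 b z.2 + f 0 * b z.2).
pose g2 (z : mR * mR) := derive1 (derive1 a) z.1 * b z.2.
pose g3 (z : mR * mR) := a z.1 * b z.2.
have i1 : L1 leb2 halfplane g1 by exact: (L1_tensor mH ca cw a0 w0).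
have i2 : L1 leb2 halfplane g2 by exact: (L1_tensor mH cdda cb dda0 b0).
have i3 : L1 leb2 halfplane g3 by exact: (L1_tensor mH ca cb a0 b0).
have L1m g : L1 leb2 halfplane g -> measurable_fun (halfplane : set (mR * mR)) g.
  by move=> ig; apply/measurable_EFinP; case/integrableP: ig.
pose h n (z : mR * mR) := rho (ms n) z `^ ms n * g2 z +
  rho (ms n) z * (f (pressure (ms n) (rho (ms n) z)) - f 0) * g3 z.
have mr n : measurable_fun (halfplane : set (mR * mR)) (rho (ms n)) by have [] := rL n.
have mh n : measurable_fun (halfplane : set (mR * mR)) (h n).
  apply: measurable_funD; apply: measurable_funM.
  - exact (measurableT_comp (measurable_powR _) (mr n)).
  - exact: L1m.
  - apply: measurable_funM; first exact: mr.
    apply: measurable_funB; last exact: measurable_cst.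
    exact: measurable_reaction.
  - exact: L1m.
(* The bounds on the solutions concern bounded time intervals; after time [X] the factor [b]
   vanishes. *)
pose T := Num.max X 1.
have T0 : 0 < T by rewrite lt_max ltr01 orbT.
have [N HN] := bounded_along T0.
pose g (z : mR * mR) := `|g2 z| + K * `|g3 z|.
have g_ge0 z : 0 <= g z by rewrite addr_ge0// mulr_ge0.
have hle n : (N <= n)%N -> {ae leb2, forall z, halfplane z ->
    `|h n z| <= C * pressure (ms n) (rho (ms n) z) * g z /\ `|h n z| <= C * (2 * C) * g z}.
  move=> nN; apply: (aeW (HN n nN)) => z Hz Hz0.
  have [zT|zT] := leP z.2 T; last first.
    have zX : X < `|z.2|.
      by apply: lt_le_trans (ler_norm _); apply: le_lt_trans zT; rewrite le_max lexx.
    by rewrite /h /g /g2 /g3 b0// !mulr0 !normr0 mulr0 !addr0 !mulr0 normr0.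
  have zT' : 0 < z.2 <= T by rewrite zT andbT.
  have [/andP[r0 rC] /andP[p0 pC]] := Hz zT'.
  have le1 : `|h n z| <= C * pressure (ms n) (rho (ms n) z) * g z.
    rewrite /h /g [leRHS]mulrDr; apply: (le_trans (ler_normD _ _)); apply: lerD.
      rewrite normrM ler_wpM2r//.
      have /andP[q0 q1] := powR_pressure (ms1 n) r0.
      by rewrite ger0_norm// (le_trans q1)// ler_wpM2r.
    rewrite normrM [leRHS]mulrA ler_wpM2r// normrM (ger0_norm r0) -mulrA ler_pM//.
    by have := fK _ _ p0 (lexx 0); rewrite subr0 (ger0_norm p0) mulrC.
  split => //; apply: (le_trans le1); rewrite ler_wpM2r//.
  by rewrite ler_wpM2l// ltW.
have iZ (k : R) (l : mR * mR -> R) : L1 leb2 halfplane l -> L1 leb2 halfplane (fun z => k * `|l z|).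
  by move=> il; exact (integrableZl mH k (integrable_abse il)).
have ig : L1 leb2 halfplane (fun z => C * (2 * C) * g z).
  have ig' : L1 leb2 halfplane g.
    exact (integrableD mH (integrable_abse i2) (iZ K _ i3)).
  exact (integrableZl mH (C * (2 * C)) ig').
have B0 : Rintegral leb2 halfplane (h n) @[n --> \oo] --> (0 : R).
  have z0 : Rintegral leb2 halfplane (fun=> 0 : R) = 0 by rewrite /Rintegral integral0_eq.
  rewrite -[X in _ --> X]z0.
  apply: (@Rintegral_dominated _ _ _ leb2 halfplane h (fun=> 0) (fun z => C * (2 * C) * g z) N) => //.
  - have aeN : {ae leb2, forall z, forall n, (N <= n)%N -> halfplane z ->
        `|h n z| <= C * pressure (ms n) (rho (ms n) z) * g z}.
      apply: ae_forall => n; have [nN|nN] := leqP N n; last by apply: nearW.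
      by apply: (aeW (hle n nN)) => z Hz _ zH; have [] := Hz zH.
    apply: (aeW (aeI aeN pressure_cvg0_along)) => z [H1 H2] zH.
    apply/norm_cvg0P.
    apply: (@squeeze_cvgr _ _ _ _ (fun=> 0) (fun n => C * pressure (ms n) (rho (ms n) z) * g z)).
    + by exists N => // n /= nN; rewrite normr_ge0 H1.
    + exact: cvg_cst.
    + rewrite -[X in _ --> X](mul0r (g z)) -[X in X * _](mulr0 C).
      apply: cvgM; last exact: cvg_cst.
      by apply: cvgM; [exact: cvg_cst|exact: H2].
  - by move=> n nN; apply: (aeW (hle n nN)) => z Hz zH; have [] := Hz zH.
have -> : - Rintegral leb2 halfplane (fun z => rho_oo z * (a z.1 * (derive1 b z.2 + f 0 * b z.2))) =
   - (Rintegral leb2 halfplane (fun z => rho_oo z * g1 z) + 0) by rewrite addr0.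
have cv : - (Rintegral leb2 halfplane (fun z => rho (ms n) z * g1 z) +
      Rintegral leb2 halfplane (h n)) @[n --> \oo] -->
    - (Rintegral leb2 halfplane (fun z => rho_oo z * g1 z) + 0).
  by apply: cvgN; apply: cvgD B0; exact: rcv.
refine (cvg_trans (near_eq_cvg _) cv).
exists N => // n /= nN.
have ir : L1 leb2 halfplane (fun z => rho (ms n) z * g1 z).
  have [_ [M HM]] := rL n.
  have mrg : measurable_fun (halfplane : set (mR * mR)) (fun z => rho (ms n) z * g1 z).
    by apply: measurable_funM => //; exact: L1m.
  have iM : L1 leb2 halfplane (fun z => M * `|g1 z|) by exact: iZ.
  apply: (ae_integrable_le mH mrg iM); apply: (aeW HM) => z Hz zH.
  by rewrite normrM ler_wpM2r// Hz.
have ih : L1 leb2 halfplane (h n).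
  apply: (ae_integrable_le mH (mh n) ig).
  by apply: (aeW (hle n nN)) => z Hz zH; have [] := Hz zH.
have [_ _ /(_ _ (test_function_tensor sa sb a0 b0)) /=] := sol _ (ms1 n).
move=> /eqP; rewrite addrC addr_eq0 => /eqP ->; congr (- _).
rewrite -RintegralD//; congr Rintegral; apply/funext => z.
rewrite dt_tensor// dx_tensor// dx_tensor// /g1 /h /g2 /g3; ring.
Qed.

Lemma limit_pressure_eq0 (p_oo : R * R -> R) :
  weak_star_cvg leb2 halfplane (fun n z => pressure (ms n) (rho (ms n) z)) p_oo ->
  {ae leb2, forall z, halfplane z -> p_oo z = 0}.
Proof.
move=> pcv.
suff main (j : nat) : {ae leb2, forall z, halfplane z -> square j.+1%:R z -> p_oo z = 0}.
  apply: (aeW (ae_forall main)) => z Hz zH.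
  have [i1 H1] := eventually_in_oc z.1; have [i2 H2] := eventually_in_oc z.2.
  apply: (Hz (maxn i1 i2)) => //; split => /=.
    by have := H1 _ (leqW (leq_maxl i1 i2)); rewrite /= !in_itv/= => /andP[/ltW -> ->].
  by have := H2 _ (leqW (leq_maxr i1 i2)); rewrite /= !in_itv/= => /andP[/ltW -> ->].
have [N HN] := bounded_along (ltr0Sn R j).
apply: (weak_star_null (@measurable_halfplane R) (measurable_square _) (square_fin _)
  pcv (C := 2 * C) (N := N)).
- move=> n nN; apply: (aeW (HN n nN)) => z Hz zH [_ /=]; rewrite in_itv/= => /andP[_ zj].
  have [|_ /andP[p0 pC]] := Hz; first by rewrite zj andbT.
  by rewrite ger0_norm.
- by apply: (aeW pressure_cvg0_along) => z Hz zH _; exact: Hz.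
Qed.

End LimitEquation.

(** * Bounded representatives and the initial term as a space-time integral *)

Section Identification.
Context {R : realType}.
Local Notation mR := (measurableTypeR R).

(** Clamping and extension by zero turn a bound almost everywhere on [D] into one at every point of
    the space, the form used by the density argument and by Fubini's theorem. *)
Lemma bounded_representative d (T : measurableType d) (mu : {measure set T -> \bar R})
    (D : set T) (u : T -> R) (M : R) : measurable D -> measurable_fun D u -> 0 <= M ->
  {ae mu, forall z, D z -> `|u z| <= M} ->
  exists r : T -> R, [/\ measurable_fun setT r, forall z, `|r z| <= M,
    forall z, ~ D z -> r z = 0 & {ae mu, forall z, D z -> r z = u z}].
Proof.
move=> mD mu' M0 uM.
exists (fun z => Num.max (- M) (Num.min M ((u \_ D) z))); split.
- apply: measurable_maxr; first exact: measurable_cst.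
  apply: measurable_minr; first exact: measurable_cst.
  exact/(measurable_restrictT _ mD).1.
- by move=> z; rewrite ler_norml le_max lexx/= ge_max ge_min lexx/= andbT; lra.
- move=> z nD; rewrite patchE memNset//.
  by rewrite -[point]/(0 : R) min_r ?max_r//; lra.
- apply: (aeW uM) => z uMz Dz; move: (uMz Dz); rewrite ler_norml => /andP[u1 u2].
  by rewrite patchE mem_set// min_r// max_r.
Qed.

Lemma Rintegral_half_line (c : R -> R) X : smooth1 c -> bounded_support X c ->
  Rintegral leb setT (fun t => \1_(`]0, +oo[%classic : set R) t * derive1 c t) = - c 0.
Proof.
move=> sc c0.
have sdc := smooth1_derive sc.
have cdc := smooth1_continuous sdc.
have dc0 := bounded_support_derive sc c0.
pose Y := Num.max X 0 + 1.
have Y0 : 0 < Y by rewrite ltr_pwDr// le_max lexx orbT.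
have YX : X < Y by rewrite ltr_pwDr// le_max lexx.
have FTC : (\int[leb]_(t in `[0%R, Y]) (derive1 c t)%:E = (c Y)%:E - (c 0)%:E)%E.
  apply: continuous_FTC2 => //.
  - by apply: continuous_subspaceT; exact: cdc.
  - split.
    + by move=> x _; exact: smooth1_derivable.
    + by apply: cvg_at_right_filter; exact: (smooth1_continuous sc).
    + by apply: cvg_at_left_filter; exact: (smooth1_continuous sc).
have cY : c Y = 0 by rewrite c0// ger0_norm// ltW.
pose J : set mR := `[0, Y]%classic.
have mJ : measurable J by exact: measurable_itv.
have -> : - c 0 = Rintegral leb setT (derive1 c \_ J).
  by rewrite -Rintegral_mkcond /Rintegral FTC cY -EFinB/= sub0r.
have mdc : measurable_fun setT (derive1 c : mR -> R) by exact: continuous_measurable_fun.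
apply: Rintegral_ae_eq => //.
- apply: measurable_funM => //; apply: measurable_indic; exact: measurable_itv.
- exact (proj1 (measurable_restrictT (derive1 c) mJ) (measurable_funTS mdc)).
- apply: (aeW (ae_line_neq 0)) => t t0 _.
  rewrite patchE indicE !mem_setE /J/= !in_itv/= andbT lt_neqAle eq_sym t0/=.
  have [t0'|] := leP 0 t; last by rewrite mul0r.
  have [tY|tY] := leP t Y; first by rewrite mul1r.
  by rewrite dc0 ?mulr0// gtr0_norm; lra.
Qed.

(** As [c'] integrates to [- c 0] over positive times, the initial term becomes an integral over the
    half-plane and can be subtracted from the one with the limit density. *)
Lemma Rintegral_line_tensor (h a c : R -> R) (H X : R) :
  measurable_fun setT (h : mR -> R) -> (forall x, `|h x| <= H) ->
  smooth1 a -> smooth1 c -> bounded_support X a -> bounded_support X c ->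
  Rintegral leb2 setT (fun z =>
    (h z.1 * \1_(`]0, +oo[%classic : set R) z.2) * (a z.1 * derive1 c z.2)) =
  - Rintegral leb setT (fun x => h x * (a x * c 0)).
Proof.
move=> mh hH sa sc a0 c0.
have ca := smooth1_continuous sa.
have cdc := smooth1_continuous (smooth1_derive sc).
have dc0 := bounded_support_derive sc c0.
have [Ma Ma0 aM] := smooth1_bounded ca a0.
have [Mc Mc0 cM] := smooth1_bounded cdc dc0.
pose J : set mR := `]0, +oo[%classic.
have mJ : measurable J by exact: measurable_itv.
have J1 t : `|\1_J t| <= 1 :> R by rewrite ger0_norm ?indicE// lern1 leq_b1.
have mi : measurable_fun setT (\1_J : mR -> R) by exact: measurable_indic.
pose r (z : mR * mR) := h z.1 * \1_J z.2.
have mr : measurable_fun setT r.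
  apply: measurable_funM; first exact (measurableT_comp mh measurable_fst).
  exact (measurableT_comp mi measurable_snd).
have rH z : `|r z| <= H by rewrite normrM -[leRHS]mulr1 ler_pM.
have ma : measurable_fun setT (a : mR -> R) by exact: continuous_measurable_fun.
have mc : measurable_fun setT (derive1 c : mR -> R) by exact: continuous_measurable_fun.
have [<- _] := Rintegral_tensor mr rH ma aM a0 mc cM dc0.
have ic : L1 leb setT (fun t => \1_J t * derive1 c t).
  have idc : L1 leb setT (derive1 c) by exact: (integrable_continuous_support cdc dc0).
  exact (L1_mul_bounded (fun=> mi) (fun=> J1) 0%N idc).
have inner x : Rintegral leb setT (fun t => r (x, t) * derive1 c t) = h x * - c 0.
  rewrite -(Rintegral_half_line sc c0) -RintegralZl//.
  by congr Rintegral; apply/funext => t; rewrite /r/= mulrA.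
have ia : L1 leb setT (fun x => h x * (a x * c 0)).
  have iac : L1 leb setT (fun x => c 0 * a x).
    exact (L1Z (c 0) (integrable_continuous_support ca a0)).
  have := L1_mul_bounded (fun=> mh) (fun=> hH) 0%N iac.
  by congr L1; apply/funext => x; rewrite [c 0 * _]mulrC.
have -> : - Rintegral leb setT (fun x => h x * (a x * c 0)) =
   -1 * Rintegral leb setT (fun x => h x * (a x * c 0)) by rewrite mulN1r.
rewrite -RintegralZl//; congr Rintegral; apply/funext => x.
by rewrite inner; ring.
Qed.

End Identification.

(** * Smooth steps as a determining class of test functions *)

Section Separation.
Context {R : realType}.
Local Notation mR := (measurableTypeR R).
Context (S : nat -> R -> R -> R -> R).
Context (sS : forall k s1 s2, smooth1 (S k s1 s2)).
Context (suppS : forall k s1 s2, exists X, bounded_support X (S k s1 s2)).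
Context (S1 : forall k s1 s2 x, `|S k s1 s2 x| <= 1).
Context (usuppS : forall s1 s2, exists X, forall k x, X < `|x| -> S k s1 s2 x = 0).
Context (cvgS : forall s1 s2 x, s1 < s2 -> x != s1 -> x != s2 ->
  S k s1 s2 x @[k --> \oo] --> (\1_(`]s1, s2]) x : R)).

Let mS k s1 s2 : measurable_fun setT (S k s1 s2 : mR -> R).
Proof. by apply: continuous_measurable_fun; exact: smooth1_continuous. Qed.

Lemma null_against_steps (u : nat -> mR -> R) (C : R) :
  (forall n, measurable_fun setT (u n)) -> (forall n z, `|u n z| <= C) ->
  (forall a X, smooth1 a -> bounded_support X a -> null_against leb u a) ->
  forall g, L1 leb setT g -> null_against leb u g.
Proof.
move=> mu uC H; apply: (null_against_line mu uC) => x y xy.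
have [X HX] := usuppS x y.
pose J : set mR := `[- X, X]%classic.
have mJ : measurable J by exact: measurable_itv.
have Joo : (leb J < +oo)%E by exact: (@lebesgue_itv_fin _ _ (- X) X).
apply: (null_against_dominated mu uC (f := fun k => S k x y) (h := \1_J)).
- by move=> k; have [Y HY] := suppS k x y; exact: H HY.
- by apply: measurable_indic; exact: measurable_itv.
- exact: L1_indic.
- apply: (aeW (aeI (ae_line_neq x) (ae_line_neq y))) => z [zx zy]; exact: cvgS.
- move=> k z; rewrite indicE mem_setE /J/= in_itv/= -ler_norml.
  have [zX|zX] := leP `|z| X; first exact: S1.
  by rewrite HX// normr0.
Qed.

Lemma rectangles_of_steps (tau : mR * mR -> R) : measurable_fun setT tau ->
  (forall X : R, exists C : R, forall z, square X z -> `|tau z| <= C) ->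
  (forall k x y s t, Rintegral leb2 setT (fun z => tau z * (S k x y z.1 * S k s t z.2)) = 0) ->
  forall x y s t, x < y -> s < t ->
  Rintegral leb2 setT (fun z => tau z *
    (\1_(`]x, y]%classic : set R) z.1 * \1_(`]s, t]%classic : set R) z.2)) = 0.
Proof.
move=> mt tC H x y s t xy st.
have [X1 HX1] := usuppS x y; have [X2 HX2] := usuppS s t.
pose X := Num.max X1 X2.
have [C HC] := tC X.
have cv : Rintegral leb2 setT (fun z => tau z * (S k x y z.1 * S k s t z.2)) @[k --> \oo] -->
    Rintegral leb2 setT (fun z => tau z *
    (\1_(`]x, y]%classic : set R) z.1 * \1_(`]s, t]%classic : set R) z.2)).
  apply: (@Rintegral_dominated _ _ _ leb2 setT _ _ (fun z => C * \1_(square X) z) 0%N) => //.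
  - move=> k; apply: measurable_funM => //; apply: measurable_funM.
      exact (measurableT_comp (mS k x y) measurable_fst).
    exact (measurableT_comp (mS k s t) measurable_snd).
  - apply: measurable_funM => //; apply: measurable_funM.
      have mi : measurable_fun setT (\1_(`]x, y]%classic : set mR) : mR -> R).
        by apply: measurable_indic; exact: measurable_itv.
      exact (measurableT_comp mi measurable_fst).
    have mi : measurable_fun setT (\1_(`]s, t]%classic : set mR) : mR -> R).
      by apply: measurable_indic; exact: measurable_itv.
    exact (measurableT_comp mi measurable_snd).
  - apply: (aeW (aeI (aeI (ae_plane_neq x) (ae_plane_neq y))
      (aeI (ae_plane_neq s) (ae_plane_neq t)))) => z [[[zx _] [zy _]] [[_ zs] [_ zt]]] _.
    apply: cvgM; first exact: cvg_cst.
    by apply: cvgM; exact: cvgS.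
  - by apply: integrable_cst_indic => //; [exact: measurable_square|exact: square_fin].
  - move=> k _; apply: nearW => z _; rewrite indicE.
    have [zX|zX] := pselect (square X z).
      rewrite mem_set// mulr1 -[leRHS]mulr1 normrM ler_pM//; first exact: HC.
      by rewrite normrM -[leRHS]mulr1 ler_pM.
    rewrite memNset// mulr0 normr_le0; apply/eqP.
    have [h1|h1] := leP `|z.1| X; last first.
      by rewrite HX1 ?mul0r ?mulr0// (le_lt_trans _ h1)// le_max lexx.
    have [h2|h2] := leP `|z.2| X; last first.
      by rewrite HX2 ?mulr0// (le_lt_trans _ h2)// le_max lexx orbT.
    by exfalso; apply: zX; split; rewrite /= in_itv/= -ler_norml.
have c0 : Rintegral leb2 setT (fun z => tau z * (S k x y z.1 * S k s t z.2)) @[k --> \oo] --> (0 : R).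
  by under eq_fun do rewrite H; exact: cvg_cst.
exact: (cvg_unique (@Rhausdorff R) cv c0).
Qed.

(** In the application [tau] contains an exponential in time and is bounded on bounded times only.
    Cutting at [t <= j] restores boundedness, and a rectangle so cut is again a rectangle, with
    upper end [Num.min t j], or empty. *)
Lemma ae_eq0_of_steps (tau : mR * mR -> R) : measurable_fun setT tau ->
  (forall X : R, exists C : R, forall z, z.2 <= X -> `|tau z| <= C) ->
  (forall k x y s t, Rintegral leb2 setT (fun z => tau z * (S k x y z.1 * S k s t z.2)) = 0) ->
  {ae leb2, forall z, tau z = 0}.
Proof.
move=> mt tC H.
have tC' (X : R) : exists C : R, forall z, square X z -> `|tau z| <= C.
  have [C HC] := tC X; exists C => z [_ /=]; rewrite in_itv/= => /andP[_]; exact: HC.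
have rect := rectangles_of_steps mt tC' H.
suff main (j : nat) : {ae leb2, forall z, tau z * \1_(`]-oo, j%:R]%classic : set R) z.2 = 0}.
  apply: (aeW (ae_forall main)) => z Hz.
  have [i Hi] := eventually_in_oc z.2.
  have := Hz i; rewrite indicE mem_set ?mulr1//.
  by have := Hi i (leqnn i); rewrite /= !in_itv/= => /andP[_ ->].
have [C HC] := tC j%:R.
pose J : set mR := `]-oo, j%:R]%classic.
have mi : measurable_fun setT (\1_J : mR -> R).
  by apply: measurable_indic; exact: measurable_itv.
have mj : measurable_fun setT (fun z : mR * mR => tau z * \1_J z.2).
  by apply: measurable_funM => //; exact (measurableT_comp mi measurable_snd).
have jC z : `|tau z * \1_J z.2| <= Num.max 0 C.
  rewrite normrM indicE mem_setE /J/= in_itv/=.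
  have [h|h] := leP z.2 j%:R; last by rewrite normr0 mulr0 le_max lexx.
  by rewrite normr1 mulr1 (le_trans (HC z h))// le_max lexx orbT.
apply: (null_cst_ae_eq0 mj jC).
apply: (null_against_plane (fun=> mj) (fun=> jC)) => x y s t xy st; split.
  have := L1_indic (mu := leb2) (A := (`]x, y]%classic : set mR) `*` (`]s, t]%classic : set mR)).
  have -> : \1_((`]x, y]%classic : set mR) `*` (`]s, t]%classic : set mR)) =
     (fun z => \1_(`]x, y]%classic : set R) z.1 * \1_(`]s, t]%classic : set R) z.2) :> (mR * mR -> R).
    by apply/funext => z; exact: indic_rectangle.
  have oxy : (@ocitv R) `]x, y]%classic by exact: is_ocitv.
  have ost : (@ocitv R) `]s, t]%classic by exact: is_ocitv.
  apply.
    by apply: measurableX; exact: ocitv_measurable.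
  by apply: leb2_rectangle_fin; [exact: ocitv_measurable|exact: ocitv_measurable|
    exact: ocitv_fin|exact: ocitv_fin].
suff -> : Rintegral leb2 setT (fun z => tau z * \1_J z.2 *
    (\1_(`]x, y]%classic : set R) z.1 * \1_(`]s, t]%classic : set R) z.2)) = 0 by exact: cvg_cst.
have E z : \1_J z.2 * \1_(`]s, t]%classic : set R) z.2 =
    \1_(`]s, Num.min t j%:R]%classic : set R) z.2 :> R.
  rewrite !indicE !mem_setE /J/= !in_itv/= le_min.
  by case: (s < z.2); case: (z.2 <= t); case: (z.2 <= j%:R); rewrite /= ?mulr1 ?mulr0.
have [sj|sj] := ltP s (Num.min t j%:R).
  rewrite -(rect x y s _ xy sj); congr Rintegral; apply/funext => z.
  by rewrite -E; ring.
rewrite /Rintegral integral0_eq// => z _.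
suff E0 : \1_J z.2 * \1_(`]s, t]%classic : set R) z.2 = 0 :> R.
  by rewrite [_ * \1_(`]s, t]%classic : set R) z.2]mulrC mulrA -(mulrA (tau z)) E0 mulr0 mul0r.
rewrite E indicE mem_setE /= in_itv/=.
by case: ltP => // sz; rewrite leNgt (le_lt_trans sj sz).
Qed.

End Separation.

(** * Separation of variables and the limit of the data *)

Section LimitIdentification.
Context {R : realType}.
Local Notation mR := (measurableTypeR R).
Context (S : nat -> R -> R -> R -> R).
Context (sS : forall k s1 s2, smooth1 (S k s1 s2)).
Context (suppS : forall k s1 s2, exists X, bounded_support X (S k s1 s2)).
Context (S1 : forall k s1 s2 x, `|S k s1 s2 x| <= 1).
Context (usuppS : forall s1 s2, exists X, forall k x, X < `|x| -> S k s1 s2 x = 0).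
Context (cvgS : forall s1 s2 x, s1 < s2 -> x != s1 -> x != s2 ->
  S k s1 s2 x @[k --> \oo] --> (\1_(`]s1, s2]) x : R)).
Context (primS : forall k s1 s2, exists c X, [/\ smooth1 c, bounded_support X c &
  forall t, 0 < t -> derive1 c t = S k s1 s2 t]).
Context (S01 : exists s1 s2, S 0%N s1 s2 0 = 1).

Lemma bounded_support_le X Y (a : R -> R) : X <= Y -> bounded_support X a -> bounded_support Y a.
Proof. by move=> XY a0 x Yx; apply: a0; exact: le_lt_trans Yx. Qed.

(** With [c] a primitive of a step in time and [a] a step in space, the assumed identity says that
    the difference [tau] of the two sides integrates to zero against every product of steps, so
    [tau] vanishes. *)
Lemma separated_variables (lam M H : R) (r : mR * mR -> R) (h : mR -> R) :
  measurable_fun setT r -> (forall z, `|r z| <= M) -> (forall z, ~ halfplane z -> r z = 0) ->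
  measurable_fun setT h -> (forall x, `|h x| <= H) ->
  (forall a c X, smooth1 a -> smooth1 c -> bounded_support X a -> bounded_support X c ->
    Rintegral leb2 setT (fun z => r z * (a z.1 * (expR (lam * z.2) * derive1 c z.2))) =
    - Rintegral leb setT (fun x => h x * (a x * c 0))) ->
  {ae leb2, forall z, halfplane z -> r z * expR (lam * z.2) = h z.1}.
Proof.
move=> mr rM r0 mh hH rh.
pose J : set mR := `]0, +oo[%classic.
have mi : measurable_fun setT (\1_J : mR -> R).
  by apply: measurable_indic; exact: measurable_itv.
have JE (t : R) : \1_J t = (0 < t)%R%:R :> R.
  by rewrite indicE mem_setE /J /= in_itv/= andbT.
have cexp : continuous (fun t : R => expR (lam * t)).
  move=> t; apply: (continuous_comp (f := fun t => lam * t) (g := expR)).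
    by apply: cvgM; [exact: cvg_cst|exact: cvg_id].
  exact: continuous_expR.
have mexp : measurable_fun setT (fun t : mR => expR (lam * t)).
  exact: continuous_measurable_fun.
pose h' (z : mR * mR) := h z.1 * \1_J z.2.
have mh' : measurable_fun setT h'.
  apply: measurable_funM; first exact (measurableT_comp mh measurable_fst).
  exact (measurableT_comp mi measurable_snd).
have h'H z : `|h' z| <= H.
  by rewrite normrM -[leRHS]mulr1 ler_pM// ger0_norm ?indicE// lern1 leq_b1.
pose tau (z : mR * mR) := r z * expR (lam * z.2) - h' z.
have mt : measurable_fun setT tau.
  apply: measurable_funB => //; apply: measurable_funM => //.
  exact (measurableT_comp mexp measurable_snd).
have tau0 z : z.2 <= 0 -> tau z = 0.
  by move=> z0; rewrite /tau /h' JE r0 /halfplane/= ?ltNge ?z0// mul0r mulr0 subrr.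
have M0 : 0 <= M by apply: le_trans (rM point).
have tC X : exists C : R, forall z, z.2 <= X -> `|tau z| <= C.
  exists (M * expR (`|lam| * `|X|) + H) => z zX.
  apply: (le_trans (ler_normB _ _)); apply: lerD => //.
  have [z0|z0] := leP z.2 0.
    by rewrite r0 /halfplane/= ?ltNge ?z0// mul0r normr0 mulr_ge0// expR_ge0.
  rewrite normrM ler_pM// (ger0_norm (expR_ge0 _)) ler_expR.
  apply: (le_trans (ler_norm _)); rewrite normrM ler_wpM2l// (gtr0_norm z0).
  by apply: (le_trans zX); exact: ler_norm.
suff main k x y s t :
    Rintegral leb2 setT (fun z => tau z * (S k x y z.1 * S k s t z.2)) = 0.
  apply: (aeW (ae_eq0_of_steps sS S1 usuppS cvgS mt tC main)) => z.
  move=> /eqP + z0; rewrite /tau /h' JE z0 mulr1 subr_eq0 => /eqP; exact.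
have [X1 HX1] := suppS k x y; have [c [X2 [sc HX2 cE]]] := primS k s t.
pose a := S k x y; have sa : smooth1 a by exact: sS.
pose X := Num.max X1 X2.
have a0 : bounded_support X a by apply: bounded_support_le HX1; rewrite le_max lexx.
have c0 : bounded_support X c by apply: bounded_support_le HX2; rewrite le_max lexx orbT.
have ca := smooth1_continuous sa.
have cdc := smooth1_continuous (smooth1_derive sc).
have dc0 := bounded_support_derive sc c0.
have -> : (fun z => tau z * (S k x y z.1 * S k s t z.2)) =
    (fun z => r z * (a z.1 * (expR (lam * z.2) * derive1 c z.2)) -
       h' z * (a z.1 * derive1 c z.2)).
  apply/funext => z; have [z0|z0] := leP z.2 0.
    by rewrite tau0// /h' JE ltNge z0 r0 /halfplane/= ?ltNge ?z0//= mulr0 !mul0r subrr.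
  by rewrite -cE// /tau /a; ring.
have i1 : L1 leb2 setT (fun z => r z * (a z.1 * (expR (lam * z.2) * derive1 c z.2))).
  apply: (L1_mul_bounded (fun=> mr) (fun=> rM) 0%N).
  apply: (@L1_tensor R setT a (fun t => expR (lam * t) * derive1 c t) X) => //.
    by move=> u; apply: cvgM; [exact: cexp|exact: cdc].
  by move=> u /dc0 ->; rewrite mulr0.
have i2 : L1 leb2 setT (fun z => h' z * (a z.1 * derive1 c z.2)).
  apply: (L1_mul_bounded (fun=> mh') (fun=> h'H) 0%N).
  exact: (@L1_tensor R setT a (derive1 c) X).
rewrite RintegralB// (rh _ _ _ sa sc a0 c0) (Rintegral_line_tensor mh hH sa sc a0 c0).
by rewrite subrr.
Qed.

(** One fixed time profile [c] with [c(0) = 1] forces the limit of the data to be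
    [h(x) = - int w(x,t) exp(-f0 t) c'(t) dt], and this along the whole sequence. Letting the
    profile vary with [h] already known then separates the variables. *)
Lemma identify_limit (f0 C : R) (N : nat) (v : nat -> R -> R) (w : R * R -> R) :
  (forall n, Linfty leb setT (v n)) ->
  (forall n, (N <= n)%N -> {ae leb, forall x, `|v n x| <= C}) ->
  Linfty leb2 halfplane w ->
  (forall a b X, smooth1 a -> smooth1 b -> bounded_support X a -> bounded_support X b ->
    Rintegral leb setT (fun x => v n x * (a x * b 0)) @[n --> \oo] -->
    - Rintegral leb2 halfplane (fun z => w z * (a z.1 * (derive1 b z.2 + f0 * b z.2)))) ->
  exists h : R -> R, weak_star_cvg leb setT v h /\
    {ae leb2, forall z, halfplane z -> w z = h z.1 * expR (f0 * z.2)}.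
Proof.
move=> vL vC [mw [M wM]] cv.
have mH := @measurable_halfplane R.
have wM' : {ae leb2, forall z, halfplane z -> `|w z| <= `|M|}.
  by apply: (aeW wM) => z Hz zH; apply: (le_trans (Hz zH)); exact: ler_norm.
have [r [mr rM r0 rw]] := bounded_representative mH mw (normr_ge0 M) wM'.
have cv' a b X : smooth1 a -> smooth1 b -> bounded_support X a -> bounded_support X b ->
    Rintegral leb setT (fun x => v n x * (a x * b 0)) @[n --> \oo] -->
    - Rintegral leb2 setT (fun z => r z * (a z.1 * (derive1 b z.2 + f0 * b z.2))).
  move=> sa sb a0 b0; have := cv a b X sa sb a0 b0.
  suff -> : Rintegral leb2 halfplane (fun z => w z * (a z.1 * (derive1 b z.2 + f0 * b z.2))) =
     Rintegral leb2 setT (fun z => r z * (a z.1 * (derive1 b z.2 + f0 * b z.2))) by [].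
  have ca := smooth1_continuous sa.
  have cw : continuous (fun t => derive1 b t + f0 * b t).
    by apply: smooth1_continuous; apply: smooth1D; [exact: smooth1_derive|exact: smooth1Z].
  have mg : measurable_fun setT (fun z : mR * mR => a z.1 * (derive1 b z.2 + f0 * b z.2)).
    apply: measurable_funM.
      by apply: (measurableT_comp _ measurable_fst); exact: (continuous_measurable_fun ca).
    have mc : measurable_fun setT ((fun t => derive1 b t + f0 * b t) : mR -> R).
      exact: continuous_measurable_fun.
    exact (measurableT_comp mc measurable_snd).
  have -> : (fun z => r z * (a z.1 * (derive1 b z.2 + f0 * b z.2))) =
      (fun z => r z * (a z.1 * (derive1 b z.2 + f0 * b z.2))) \_ halfplane.
    apply/funext => z; rewrite patchE; case: ifPn => // /negP zH.
    by rewrite r0 ?mul0r// => zH'; apply: zH; exact: mem_set.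
  rewrite -Rintegral_mkcond; apply: Rintegral_ae_eq => //.
  - by apply: measurable_funM => //; exact: measurable_funTS.
  - by apply: measurable_funTS; exact: measurable_funM.
  - by apply: (aeW rw) => z Hz zH; rewrite Hz.
(* The weight [exp(-f0 t)] is the integrating factor that removes the growth term [f0 * b]. *)
have expE (c : R -> R) t : smooth1 c ->
    derive1 (fun t => expR (- f0 * t) * c t) t + f0 * (expR (- f0 * t) * c t) =
    expR (- f0 * t) * derive1 c t.
  move=> sc.
  have := is_derive_expM (- f0) (derivable_is_derive (@smooth1_derivable R c t sc)).
  by move=> /is_derive_derive1 ->; ring.
have cvc a c X : smooth1 a -> smooth1 c -> bounded_support X a -> bounded_support X c ->
    Rintegral leb setT (fun x => v n x * (a x * c 0)) @[n --> \oo] -->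
    - Rintegral leb2 setT (fun z => r z * (a z.1 * (expR (- f0 * z.2) * derive1 c z.2))).
  move=> sa sc a0 c0.
  have b0 : bounded_support X (fun t => expR (- f0 * t) * c t).
    by move=> t /c0 ->; rewrite mulr0.
  have := cv' a _ X sa (@smooth1_expM R (- f0) c sc) a0 b0.
  rewrite mulr0 expR0 mul1r.
  have -> // : (fun z : R * R => r z * (a z.1 *
      (derive1 (fun t => expR (- f0 * t) * c t) z.2 + f0 * (expR (- f0 * z.2) * c z.2)))) =
    (fun z => r z * (a z.1 * (expR (- f0 * z.2) * derive1 c z.2))).
  by apply/funext => z; rewrite expE.
have [s1 [s2 S0E]] := S01.
pose c := S 0%N s1 s2.
have [X0 c0] := suppS 0%N s1 s2.
have sc : smooth1 c by exact: sS.
have cdc := smooth1_continuous (smooth1_derive sc).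
have dc0 := bounded_support_derive sc c0.
pose q (t : mR) := - (expR (- f0 * t) * derive1 c t).
have cq : continuous q.
  move=> t; apply: cvgN; apply: cvgM; last exact: cdc.
  apply: (continuous_comp (f := fun t => - f0 * t) (g := expR)).
    by apply: cvgM; [exact: cvg_cst|exact: cvg_id].
  exact: continuous_expR.
have q0 X : X0 <= X -> bounded_support X q.
  by move=> XX t Xt; rewrite /q dc0 ?mulr0 ?oppr0//; exact: le_lt_trans Xt.
have [Mq Mq0 qM] := smooth1_bounded cq (q0 X0 (lexx _)).
have mq : measurable_fun setT q by exact: continuous_measurable_fun.
pose h (x : mR) := Rintegral leb setT (fun t => r (x, t) * q t).
have mh : measurable_fun setT h.
  exact: (measurable_partial_integral mr rM mq qM (q0 X0 (lexx _))).
have tens a X : smooth1 a -> bounded_support X a ->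
    Rintegral leb setT (fun x => h x * a x) =
    - Rintegral leb2 setT (fun z => r z * (a z.1 * (expR (- f0 * z.2) * derive1 c z.2))) /\
    exists H, forall x, `|h x| <= H.
  move=> sa a0; have ca := smooth1_continuous sa.
  pose Y := Num.max X X0.
  have a0' : bounded_support Y a by apply: bounded_support_le a0; rewrite le_max lexx.
  have qY : bounded_support Y q by apply: q0; rewrite le_max lexx orbT.
  have [Ma Ma0 aM] := smooth1_bounded ca a0'.
  have ma : measurable_fun setT (a : mR -> R) by exact: continuous_measurable_fun.
  have [E HH] := Rintegral_tensor mr rM ma aM a0' mq qM qY.
  split => //; rewrite [LHS]E -mulN1r.
  have ig : L1 leb2 setT (fun z => a z.1 * q z.2) by exact: (L1_tensor _ ca cq a0' qY).
  have i : L1 leb2 setT (fun z => r z * (a z.1 * (expR (- f0 * z.2) * derive1 c z.2))).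
    have := L1Z (-1) (L1_mul_bounded (fun=> mr) (fun=> rM) 0%N ig).
    by congr L1; apply/funext => z; rewrite /q; ring.
  by rewrite -RintegralZl//; congr Rintegral; apply/funext => z; rewrite /q; ring.
have [H hH] := (tens _ _ sc c0).2.
have lim_h a X : smooth1 a -> bounded_support X a ->
    Rintegral leb setT (fun x => v n x * a x) @[n --> \oo] -->
    Rintegral leb setT (fun x => h x * a x).
  move=> sa a0; rewrite (tens a X sa a0).1.
  pose Y := Num.max X X0.
  have a0' : bounded_support Y a by apply: bounded_support_le a0; rewrite le_max lexx.
  have c0' : bounded_support Y c by apply: bounded_support_le c0; rewrite le_max lexx orbT.
  have -> // : (fun n => Rintegral leb setT (fun x => v n x * a x)) =
      (fun n => Rintegral leb setT (fun x => v n x * (a x * c 0))).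
    by apply/funext => n; congr Rintegral; apply/funext => x; rewrite /c S0E mulr1.
  exact: cvc sa sc a0' c0'.
have C0 : 0 <= `|C| by [].
(* The data are bounded by [C] almost everywhere and from the index [N] on; shifted, clamped
   representatives meet the pointwise bounds of the density argument. *)
have /choice[vb Hvb] : forall n, exists vb : mR -> R, [/\ measurable_fun setT vb,
    forall z, `|vb z| <= `|C| & {ae leb, forall z, vb z = v (n + N)%N z}].
  move=> n; have [mv _] := vL (n + N)%N.
  have vCn : {ae leb, forall z, setT z -> `|v (n + N)%N z| <= `|C|}.
    apply: (aeW (vC _ (leq_addl n N))) => z Hz _; apply: (le_trans Hz); exact: ler_norm.
  have [vb [h1 h2 _ h4]] := bounded_representative measurableT mv C0 vCn.
  by exists vb; split => //; apply: (aeW h4) => z; exact.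
have vbE n g : L1 leb setT g -> Rintegral leb setT (fun x => vb n x * g x) =
    Rintegral leb setT (fun x => v (n + N)%N x * g x).
  move=> ig; have mg := L1_measurable ig; have [h1 h2 h3] := Hvb n.
  apply: Rintegral_ae_eq => //.
  - exact: measurable_funM.
  - by apply: measurable_funM => //; exact: (vL _).1.
  - by apply: (aeW h3) => z Hz _; rewrite Hz.
pose u n (x : mR) := vb n x - h x.
have mu n : measurable_fun setT (u n).
  by apply: measurable_funB => //; have [] := Hvb n.
have uC n x : `|u n x| <= `|C| + H.
  by apply: (le_trans (ler_normB _ _)); apply: lerD => //; have [_ h2 _] := Hvb n; exact: h2.
have split_u g : L1 leb setT g ->
    (fun n => Rintegral leb setT (fun x => u n x * g x)) =
    (fun n => Rintegral leb setT (fun x => v (n + N)%N x * g x) -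
              Rintegral leb setT (fun x => h x * g x)).
  move=> ig; apply/funext => n; rewrite -vbE//; have [h1 h2 _] := Hvb n.
  rewrite -RintegralB//; last 2 first.
  - exact (L1_mul_bounded (fun=> h1) (fun=> h2) 0%N ig).
  - exact (L1_mul_bounded (fun=> mh) (fun=> hH) 0%N ig).
  by congr Rintegral; apply/funext => x; rewrite /u mulrBl.
have null g : L1 leb setT g -> null_against leb u g.
  apply: (null_against_steps sS suppS S1 usuppS cvgS mu uC) => a X sa a0.
  have ia : L1 leb setT a.
    exact: (integrable_continuous_support (smooth1_continuous sa) a0).
  split => //; rewrite split_u// -[X in _ --> X](subrr (Rintegral leb setT (fun x => h x * a x))).
  apply: cvgB; last exact: cvg_cst.
  by rewrite (cvg_shiftn N (fun n => Rintegral leb setT (fun x => v n x * a x))); exact: (lim_h _ X).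
have hL : Linfty leb setT h.
  by split => //; exists H; apply: nearW.
have wcv g : L1 leb setT g ->
    Rintegral leb setT (fun x => v n x * g x) @[n --> \oo] -->
    Rintegral leb setT (fun x => h x * g x).
  move=> ig; have [_] := null g ig; rewrite split_u// => cv0.
  rewrite -(cvg_shiftn N).
  by apply/subr_cvg0.
exists h; split; first by split.
have sep : {ae leb2, forall z, halfplane z -> r z * expR (- f0 * z.2) = h z.1}.
  apply: (separated_variables mr rM r0 mh hH) => a c' X sa sc' a0 c0'.
  have ia : L1 leb setT (fun x => a x * c' 0).
    have := L1Z (c' 0) (integrable_continuous_support (smooth1_continuous sa) a0).
    by congr L1; apply/funext => x; rewrite mulrC.
  rewrite -(cvg_unique (@Rhausdorff R) (cvc a c' X sa sc' a0 c0') (wcv _ ia)).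
  by rewrite opprK.
apply: (aeW (aeI rw sep)) => z [H1 H2] zH.
rewrite -H1// -H2// -mulrA -expRD mulNr addNr expR0 mulr1//.
Qed.

End LimitIdentification.

Lemma initial_density_le (R : realType) (m pM L : R) (g : R -> R) : 1 < m -> 0 < pM ->
  {ae leb, forall x, 0 <= g x} ->
  {ae leb, forall x, pressure m (g x) <= pM * \1_(`]0, L[) x} ->
  {ae leb, forall x, `|g x| <= ((m - 1) / m * pM) `^ (m - 1)^-1}.
Proof.
move=> m1 pM0 g0 gp; apply: (aeW (initial_density_bound m1 pM0 g0 gp)) => x /andP[gx0 gx].
by rewrite ger0_norm// (le_trans gx)// ler_piMr ?powR_ge0 ?indicE ?lern1 ?leq_b1.
Qed.

Theorem proposition1p6 (R : realType) (f : R -> R) (pM L : R)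
    (rho_in : R -> R -> R) (rho : R -> R * R -> R)
    (f_lipschitz : [lipschitz f p | p in `[0, +oo[])
    (pM_gt0 : 0 < pM)
    (f_reaction : bistable f pM \/ monostable f pM)
    (L_lt : L < Lstar f)
    (rho_in_ge0 : forall m, 1 < m -> {ae leb, forall x, 0 <= rho_in m x})
    (rho_in_L1 : forall m, 1 < m -> L1 leb setT (rho_in m))
    (p_in_le : forall m, 1 < m ->
       {ae leb, forall x, pressure m (rho_in m x) <= pM * \1_(`]0, L[) x})
    (rho_sol : forall m, 1 < m -> is_solution f m (rho_in m) (rho m))
    (ms : nat -> R) (rho_oo p_oo : R * R -> R)
    (accum : accumulation_along rho ms rho_oo p_oo) :
  {ae leb2, forall z, halfplane z -> p_oo z = 0} /\
  exists rho_in_oo : R -> R,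
    weak_star_cvg leb setT (fun n => rho_in (ms n)) rho_in_oo /\
    {ae leb2, forall z, halfplane z ->
       rho_oo z = rho_in_oo z.1 * expR (f 0 * z.2)}.
Proof.
have weak m (m1 : 1 < m) := (rho_sol m m1).1.
have lim m (m1 : 1 < m) := (rho_sol m m1).2.
have [ms1 ms_oo rcv pcv] := accum.
have [C [ka [C0 ka0 vanish]]] :=
  vanishing_pressure f_lipschitz pM_gt0 f_reaction L_lt rho_in_ge0 rho_in_L1 p_in_le lim.
split; first exact: (limit_pressure_eq0 C0 ka0 ms1 ms_oo vanish pcv).
(* The mollifiers that come with the approximation at exponent [2] are reused as the source of all
   smooth test functions. *)
have [r [u [[eta [e [e0 meta _]]] _ _]]] := lim 2 (ltr1n R 2).
have [S [[sS suppS S1 usuppS cvgS] [primS S01]]] := smooth_steps e0 meta.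
(* For [m >= 2] the exponent [1 / (m - 1)] is at most [1], so the data are bounded by [pM + 1]
   uniformly in [m]. *)
have [N _ HN] := (cvgryPge ms).1 ms_oo 2.
have wL : Linfty leb2 halfplane rho_oo by have [] := rcv.
have in_le n := initial_density_le (ms1 n) pM_gt0 (rho_in_ge0 _ (ms1 n)) (p_in_le _ (ms1 n)).
apply: (identify_limit sS suppS S1 usuppS cvgS primS S01 (C := pM + 1) (N := N)) => //.
- move=> n; split; first by apply/measurable_EFinP; case/integrableP: (rho_in_L1 _ (ms1 n)).
  by eexists; apply: (aeW (in_le n)) => x Hx _; exact: Hx.
- move=> n /HN /= m2; apply: (aeW (in_le n)) => x /le_trans; apply.
  have m1 := ms1 n; have m0 : 0 < ms n by clear -m1; lra.
  have q1 : (ms n - 1) / ms n <= 1 by rewrite ler_pdivrMr; clear -m1; lra.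
  have q0 : 0 <= (ms n - 1) / ms n by rewrite divr_ge0; clear -m1; lra.
  have i01 : 0 <= (ms n - 1)^-1 <= 1 by rewrite invr_ge0 invf_le1; clear -m1 m2; lra.
  apply: (le_trans (powR_le_add1 (mulr_ge0 q0 (ltW pM_gt0)) i01)).
  by rewrite lerD2r ler_piMl// ltW.
- move=> a b X sa sb a0 b0.
  exact: (weak_formulation_limit C0 ka0 ms1 ms_oo vanish f_lipschitz weak rcv sa sb a0 b0).
Qed.
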